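(* As $\beta\to0$ ($\beta>0$), the probability measures $\widetilde{Q}_{0,\beta}^{(4)}$ converge weakly to the mean zero Gaussian white noise $Q_0$, as probability measures on $H^{s}_0(\mathbb{T})$, for $s<-\frac12$.
   Context: $\mathbb{T}=\mathbb{R}/\mathbb{Z}$. $H^s_0(\mathbb{T})$ is the space of real-valued distributions $u=\sum_{n\neq 0}\hat u_n e^{2\pi i n x}$ on $\mathbb{T}$ (so $\hat u_{-n}=\overline{\hat u_n}$) with $\|u\|_{H^s_0}^2=\sum_{n\ne 0}|n|^{2s}|\hat u_n|^2<\infty$. $Q_0$ is the mean zero Gaussian white noise on $\mathbb{T}$: the probability measure on real-valued distributions $u$ with $\int_{\mathbb{T}}u=0$ satisfying $\int e^{i\langle f,u\rangle}\,dQ_0(u)=e^{-\frac12\|f\|_{L^2}^2}$ for every mean zero smooth real-valued function $f$ on $\mathbb{T}$. Let $\{g_n\}_{n\ge1}$ be independent standard complex Gaussian random variables (real and imaginary parts independent, mean zero, variance $1/2$), and $g_{-n}=\overline{g_n}$. For $\beta>0$ put $\tilde\beta=4\pi^2\beta$, and let $\mu_\beta$ be the law of $u(x)=\sum_{n\neq0}\frac{g_n}{\sqrt{1+\tilde\beta n^2}}e^{2\pi i n x}$ (formally $Z^{-1}\exp(-\frac12\int_{\mathbb{T}}u^2-\frac\beta2\int_{\mathbb{T}}u_x^2)\prod_x du(x)$ on real-valued mean zero $u$). Then $$d\widetilde{Q}_{0,\beta}^{(4)}=Z_\beta^{-1}e^{-\beta\int_{\mathbb{T}}u^4}\,d\mu_\beta,$$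 where $Z_\beta$ is the normalizing constant making this a probability measure. *)

(* Defs.v *)
From HB Require Import structures.
From mathcomp Require Import all_boot all_order all_algebra.
From mathcomp Require Import complex.
From mathcomp Require Import all_classical all_reals all_analysis.
From mathcomp Require Import ring lra.

Set Implicit Arguments.
Unset Strict Implicit.
Unset Printing Implicit Defensive.

Import Order.TTheory GRing.Theory Num.Theory.
Import numFieldNormedType.Exports.

Local Open Scope classical_set_scope.
Local Open Scope ring_scope.
Local Open Scope complex_scope.

Section testfun.
Context {R : realType}.

Definition smooth_periodic : {pred R -> R^o} := [pred f : R -> R^o |
  `[< periodic f 1 /\ forall k x, derivable (derive1n k f) x 1 >]].

Lemma derive1n_lin (a : R) (f g : R -> R^o) k :
    f \in smooth_periodic -> g \in smooth_periodic ->
  derive1n k (a *: f + g) = a *: derive1n k f + derive1n k g.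
Proof.
move=> /asboolP[_ sf] /asboolP[_ sg].
elim: k => [//|k IH]; rewrite !derive1nS IH; apply/funext => x.
have df : derivable (a *: derive1n k f) x 1 by exact: derivableZ (sf k x).
by rewrite derive1E (deriveD df (sg k x)) (deriveZ _ (sf k x)) -!derive1E.
Qed.

Fact smooth_periodic_submod : submod_closed smooth_periodic.
Proof.
split.
  apply/asboolP; split=> // k x.
  have -> : derive1n k (0 : R -> R^o) = (0 : R -> R^o).
    elim: k => [//|k IH]; rewrite derive1nS IH; apply/funext => y.
    exact: derive1_cst.
  exact: derivable_cst.
move=> a f g sf sg.
have der k := derive1n_lin a k sf sg.
move/asboolP: sf => [pf sf]; move/asboolP: sg => [pg sg].
apply/asboolP; split=> [x|k x].
  by rewrite !fctE /= pf pg.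
by rewrite der; apply: derivableD (sg k x); exact: derivableZ (sf k x).
Qed.
HB.instance Definition _ :=
  GRing.isSubmodClosed.Build R (R -> R^o) smooth_periodic
    smooth_periodic_submod.

Record testfun := Testfun {
  testfun_val :> R -> R^o ; _ : testfun_val \in smooth_periodic }.
HB.instance Definition _ := [isSub for testfun_val].
HB.instance Definition _ := [Choice of testfun by <:].
HB.instance Definition _ := [SubChoice_isSubLmodule of testfun by <:].

End testfun.
Arguments testfun R : clear implicits.

Section trigonometric.
Context {R : realType}.

Lemma is_derive_trig (a p q x : R) :
  is_derive x 1 (fun x => p * cos (a * x) + q * sin (a * x) : R^o)
    (q * a * cos (a * x) + (- (p * a)) * sin (a * x)).
Proof.
have dax : is_derive x 1 (fun x => a * x) a.
  by rewrite -[X in is_derive _ _ _ X]mulr1; exact: is_deriveZ.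
have dc : is_derive x 1 (fun x => cos (a * x)) (- sin (a * x) * a).
  exact: (@is_derive1_comp _ cos (fun x => a * x) x).
have ds : is_derive x 1 (fun x => sin (a * x)) (cos (a * x) * a).
  exact: (@is_derive1_comp _ sin (fun x => a * x) x).
have dpc : is_derive x 1 (fun x => p * cos (a * x)) (p * (- sin (a * x) * a)).
  exact: is_deriveZ.
have dqs : is_derive x 1 (fun x => q * sin (a * x)) (q * (cos (a * x) * a)).
  exact: is_deriveZ.
apply: (@is_derive_eq _ _ _ _ _ _ _
  (p * (- sin (a * x) * a) + q * (cos (a * x) * a))).
by rewrite /=; ring.
Qed.

Lemma trig_smooth_periodic (n : int) (p q : R) :
  (fun x => p * cos (2 * pi * n%:~R * x) + q * sin (2 * pi * n%:~R * x))
    \in @smooth_periodic R.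
Proof.
have per (h : R -> R) : periodic h (pi *+ 2) ->
    forall y, h (y + 2 * pi * n%:~R) = h y.
  move=> ph y; rewrite mulr_natl; case: n => m.
    by rewrite -pmulrn mulr_natr periodicn.
  rewrite NegzE mulrNz -pmulrn mulrN mulr_natr.
  by rewrite -[y in RHS](subrK (pi *+ 2 *+ m.+1)) (periodicn ph).
set a := 2 * pi * n%:~R in per *; apply/asboolP; split=> [x|k x].
  have -> : a * (x + 1) = a * x + a by rewrite mulrDr mulr1.
  by rewrite (per _ (@cosD2pi R)) (per _ (@sinD2pi R)).
have [p' [q' ->]] : exists p' q' : R,
    derive1n k (fun x => p * cos (a * x) + q * sin (a * x) : R^o) =
    (fun x => p' * cos (a * x) + q' * sin (a * x)).
  elim: k => [|k [p' [q' E]]]; first by exists p, q.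
  exists (q' * a), (- (p' * a)).
  rewrite derive1nS E; apply/funext => y; rewrite derive1E.
  by have H := is_derive_trig a p' q' y; rewrite derive_val.
by have [] := is_derive_trig a p' q' x.
Qed.

Lemma cos_smooth_periodic (n : int) :
  (fun x => cos (2 * pi * n%:~R * x)) \in @smooth_periodic R.
Proof.
have := trig_smooth_periodic n 1 0; under eq_fun do rewrite mul1r mul0r addr0.
by [].
Qed.

Lemma sin_smooth_periodic (n : int) :
  (fun x => sin (2 * pi * n%:~R * x)) \in @smooth_periodic R.
Proof.
have := trig_smooth_periodic n 0 1; under eq_fun do rewrite mul1r mul0r add0r.
by [].
Qed.

Definition cos_test n : testfun R := Testfun (cos_smooth_periodic n).
Definition sin_test n : testfun R := Testfun (sin_smooth_periodic n).

End trigonometric.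

Section torus_distribution.
Context {R : realType}.

(* Functions on the torus are functions of period 1 on R. *)
Definition torus_integral (h : R -> R) : R :=
  \int[lebesgue_measure]_(x in `[0, 1]) h x.

Definition fourier (h : R -> R) (n : int) : R[i] :=
  torus_integral (fun x => h x * cos (2 * pi * n%:~R * x))
  -i* torus_integral (fun x => h x * sin (2 * pi * n%:~R * x)).

(* The topology of the test functions is given by the seminorms sup_x |f^(k) x|. *)
Record torus_distribution := TorusDistribution {
  pairing :> testfun R -> R^o ;
  pairing_linear : linear pairing ;
  pairing_continuous : exists (N : nat) (C : R), forall (f : testfun R) (M : R),
    (forall k x, (k <= N)%N -> `|derive1n k f x| <= M) -> `|pairing f| <= C * M
}.
HB.instance Definition _ (u : torus_distribution) :=
  GRing.isLinear.Build R (testfun R) R^o _ u (pairing_linear u).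

Definition fourier_coef (u : torus_distribution) (n : int) : R[i] :=
  u (cos_test n) -i* u (sin_test n).

(* u = sum_(n != 0) (fourier_coef u n) e_n in the sense of distributions, where
   e_n x = exp (2 i pi n x): the (real) pairing of f with the sum of the terms
   of indices n and - n is the summand below, as <e_n, f> = fourier f (- n). *)
Definition is_fourier_sum (u : torus_distribution) := forall f : testfun R,
  \sum_(1 <= n < N.+1)
    complex.Re (fourier_coef u n * fourier f (- n%:Z)
        + fourier_coef u (- n%:Z) * fourier f n) @[N --> \oo] --> u f.

Definition represents (h : R -> R) (u : torus_distribution) :=
  lebesgue_measure.-integrable `[0, 1] (EFin \o h) /\
  forall f : testfun R, u f = torus_integral (fun x => h x * f x).

(* The integral of u^4, finite exactly when u is a function in L^4: the functions
   representing u are equal almost everywhere, so all members of the set are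
   equal; the infimum over the empty set is +oo. *)
Definition quartic_integral (u : torus_distribution) : \bar R :=
  ereal_inf [set \int[lebesgue_measure]_(x in `[0%R, 1%R]) (h x ^+ 4)%:E
            | h in [set h | represents h u]]%E.

Lemma eq_torus_distribution (u v : torus_distribution) :
  pairing u = pairing v -> u = v.
Proof.
case: u v => [u lu cu] [v lv cv] /= uv; case: _ / uv in lv cv *.
by congr TorusDistribution; exact: Prop_irrelevance.
Qed.

Fact zero_linear : linear ((fun=> 0) : testfun R -> R^o).
Proof. by move=> a f g; rewrite scaler0 addr0. Qed.

Fact zero_continuous : exists (N : nat) (C : R), forall (f : testfun R) (M : R),
  (forall k x, (k <= N)%N -> `|derive1n k f x| <= M) -> `|0 : R| <= C * M.
Proof. by exists 0%N, 0 => f M _; rewrite normr0 mul0r. Qed.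

Definition zero_distribution := TorusDistribution zero_linear zero_continuous.

End torus_distribution.
Arguments torus_distribution R : clear implicits.

Section sobolev.
Context {R : realType}.
Implicit Types (s : R) (a b c : int -> R[i]).

Definition sobolev_sqnorm s c : \bar R :=
  \esum_(n in [set n : int | n != 0])
    (`|n|%N%:R `^ (2 * s) * Normc.normc (c n) ^+ 2)%:E.

(* In the sense of distributions, every Fourier series converges to u, so the
   field sobolev_sum only restates sobolev_mean0; it makes fourier_coef
   injective on sobolev s without appealing to this fact. *)
Record sobolev s := Sobolev {
  sobolev_val :> torus_distribution R ;
  sobolev_mean0 : fourier_coef sobolev_val 0 = 0 ;
  sobolev_sum : is_fourier_sum sobolev_val ;
  sobolev_fin : (sobolev_sqnorm s (fourier_coef sobolev_val) < +oo)%E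
}.

Arguments sobolev_sum {s} _ _.

(* The norm of u - v: the Fourier coefficients depend linearly on u. *)
Definition sobolev_dist s (u v : sobolev s) : R :=
  Num.sqrt
    (fine (sobolev_sqnorm s (fun n => fourier_coef u n - fourier_coef v n))).

Lemma sobolev_sqnorm_ge0 s c : (0 <= sobolev_sqnorm s c)%E.
Proof.
by apply: esum_ge0 => n _; rewrite lee_fin mulr_ge0 ?powR_ge0 ?sqr_ge0.
Qed.

Lemma normc_ge0 (z : R[i]) : 0 <= Normc.normc z.
Proof. by case: z => p q; exact: sqrtr_ge0. Qed.

Lemma sobolev_sqnormD s a b (x y : R) : 0 < x -> 0 < y ->
  (sobolev_sqnorm s a <= (x ^+ 2)%:E)%E ->
  (sobolev_sqnorm s b <= (y ^+ 2)%:E)%E ->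
  (sobolev_sqnorm s (fun n => a n + b n)%R <= ((x + y) ^+ 2)%:E)%E.
Proof.
move=> x0 y0 ax by_.
set w := fun n : int => `|n|%N%:R `^ (2 * s).
have w0 n : 0 <= w n by exact: powR_ge0.
have xy0 : 0 <= y / x by rewrite divr_ge0 ?ltW.
have yx0 : 0 <= x / y by rewrite divr_ge0 ?ltW.
apply: (@le_trans _ _ ((1 + y / x)%:E * sobolev_sqnorm s a
                       + (1 + x / y)%:E * sobolev_sqnorm s b)%E); last first.
  have -> : (x + y) ^+ 2 = (1 + y / x) * x ^+ 2 + (1 + x / y) * y ^+ 2.
    by field; rewrite !gt_eqF.
  by rewrite [leRHS]EFinD leeD// EFinM lee_wpmul2l// lee_fin addr_ge0.
have sumZ (k : R) c : 0 <= k -> (k%:E * sobolev_sqnorm s c)%E =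
    \esum_(n in [set n : int | n != 0]) (k * (w n * Normc.normc (c n) ^+ 2))%:E.
  move=> k0; rewrite /sobolev_sqnorm /esum -ereal_supZl//; last first.
    by apply/set0P; exists 0%E; exists set0;
      [exact: fsets_set0|rewrite fsbig_set0].
  congr ereal_sup; rewrite image_comp; apply: eq_imagel => A [finA _] /=.
  by rewrite ge0_mule_fsumr// => n; rewrite lee_fin mulr_ge0 ?sqr_ge0.
rewrite !sumZ ?addr_ge0// -esumD.
- apply: le_esum => n _; rewrite -EFinD lee_fin.
  rewrite !(mulrCA _ (w n)) -mulrDr ler_wpM2l//.
  have := le_normcD (a n) (b n).
  set p := Normc.normc (a n); set q := Normc.normc (b n).
  move=> pq; apply: (@le_trans _ _ ((p + q) ^+ 2)).
    by rewrite ler_sqr ?nnegrE ?addr_ge0 ?normc_ge0.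
  rewrite -subr_ge0.
  have -> : (1 + y / x) * p ^+ 2 + (1 + x / y) * q ^+ 2 - (p + q) ^+ 2
      = (y * p - x * q) ^+ 2 / (x * y) by field; rewrite !gt_eqF.
  by rewrite divr_ge0 ?sqr_ge0 ?mulr_ge0 ?ltW.
- by move=> n _; rewrite lee_fin; apply: mulr_ge0;
    [exact: addr_ge0|rewrite mulr_ge0 ?sqr_ge0].
- by move=> n _; rewrite lee_fin; apply: mulr_ge0;
    [exact: addr_ge0|rewrite mulr_ge0 ?sqr_ge0].
Qed.

Lemma sobolev_sqnorm0 s c : (forall n, c n = 0) -> sobolev_sqnorm s c = 0%E.
Proof.
by move=> c0; apply: esum1 => n _; rewrite c0 Normc.normc0 expr0n mulr0.
Qed.

Lemma sobolev_sqnorm0_eq0 s c n :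
  sobolev_sqnorm s c = 0%E -> n != 0 -> c n = 0.
Proof.
move=> c0 n0; apply: Normc.eq0_normc.
have : ((`|n|%N%:R `^ (2 * s) * Normc.normc (c n) ^+ 2)%:E
    <= sobolev_sqnorm s c)%E.
  apply: ereal_sup_ubound; exists [set n]; last by rewrite fsbig_set1.
  by split; [exact: finite_set1|move=> _ ->].
rewrite c0 lee_fin pmulr_rle0 ?powR_gt0 ?ltr0n ?absz_gt0// => sq0.
by apply/eqP; rewrite -sqrf_eq0 eq_le sq0 sqr_ge0.
Qed.

Lemma sobolev_sqnormN s c : sobolev_sqnorm s (fun n => - c n) =
  sobolev_sqnorm s c.
Proof. by apply: eq_esum => n _; rewrite normcN. Qed.

Lemma sobolev_sqnormB_fin s (u v : sobolev s) :
  sobolev_sqnorm s (fun n => fourier_coef u n - fourier_coef v n) \is a fin_num.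
Proof.
have bnd (w : sobolev s) : exists2 x : R, 0 < x &
    (sobolev_sqnorm s (fourier_coef w) <= (x ^+ 2)%:E)%E.
  have := sobolev_fin w; have := sobolev_sqnorm_ge0 s (fourier_coef w).
  case: sobolev_sqnorm => [r|//|//]; rewrite lee_fin => r0 _.
  exists (r + 1); first by rewrite ltr_wpDl.
  by rewrite lee_fin; nra.
have [x x0 ux] := bnd u; have [y y0 vy] := bnd v.
rewrite ge0_fin_numE ?sobolev_sqnorm_ge0//.
apply: (@le_lt_trans _ _ ((x + y) ^+ 2)%:E); last exact: ltry.
by apply: sobolev_sqnormD => //; rewrite sobolev_sqnormN.
Qed.

Lemma sobolev_distE s (u v : sobolev s) (x : R) : 0 <= x ->
  (sobolev_dist u v <= x) =
  (sobolev_sqnorm s (fun n => fourier_coef u n - fourier_coef v n)%R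
     <= (x ^+ 2)%:E)%E.
Proof.
move=> x0; rewrite /sobolev_dist.
rewrite -[X in _ = (X <= _)%E](fineK (sobolev_sqnormB_fin u v)) lee_fin.
rewrite -[RHS]ler_sqrt ?sqr_ge0// sqrtr_sqr ger0_norm//.
Qed.

Lemma sobolev_distxx s (u : sobolev s) : sobolev_dist u u = 0.
Proof.
by rewrite /sobolev_dist sobolev_sqnorm0 ?sqrtr0// => n; rewrite subrr.
Qed.

Lemma eq_sobolev s (u v : sobolev s) :
  (forall n, fourier_coef u n = fourier_coef v n) -> u = v.
Proof.
move=> uv; have {uv} : sobolev_val u = sobolev_val v.
  apply/eq_torus_distribution/funext => f.
  have := sobolev_sum u f; under eq_fun do under eq_bigr do rewrite !uv.
  by move=> /(cvg_unique (@Rhausdorff R)); apply; exact: sobolev_sum.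
case: u v => [u u0 uS uF] [v v0 vS vF] /= uv; case: _ / uv in v0 vS vF *.
by congr Sobolev; exact: Prop_irrelevance.
Qed.

Lemma sobolev_dist_eq0 s (u v : sobolev s) : sobolev_dist u v = 0 -> u = v.
Proof.
move=> d0; apply: eq_sobolev => n; have [->|n0] := eqVneq n 0.
  by rewrite !sobolev_mean0.
apply/eqP; rewrite -subr_eq0; apply/eqP.
apply: (@sobolev_sqnorm0_eq0 s
  (fun m => fourier_coef u m - fourier_coef v m)) => //.
apply/eqP; rewrite eq_le sobolev_sqnorm_ge0 andbT.
by have := sobolev_distE u v (lexx 0); rewrite d0 lexx expr0n => <-.
Qed.

Lemma sobolev_dist_sym s (u v : sobolev s) :
  sobolev_dist u v = sobolev_dist v u.
Proof.
rewrite /sobolev_dist -sobolev_sqnormN.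
congr (Num.sqrt (fine (sobolev_sqnorm _ _))).
by apply/funext => n; rewrite opprB.
Qed.

Lemma sobolev_dist_triangle s (v u w : sobolev s) :
  sobolev_dist u w <= sobolev_dist u v + sobolev_dist v w.
Proof.
apply/ler_addgt0Pl => e e0.
have d0 (p q : sobolev s) : 0 < sobolev_dist p q + e / 2.
  by rewrite ltr_wpDl ?sqrtr_ge0 ?divr_gt0.
have -> : e + (sobolev_dist u v + sobolev_dist v w)
   = (sobolev_dist u v + e / 2) + (sobolev_dist v w + e / 2) by field.
rewrite sobolev_distE; last by rewrite addr_ge0 // ltW.
have -> : (fun n => fourier_coef u n - fourier_coef w n) = (fun n =>
    (fourier_coef u n - fourier_coef v n)
    + (fourier_coef v n - fourier_coef w n)).
  by apply/funext => n; rewrite addrA subrK.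
by apply: sobolev_sqnormD => //;
  rewrite -sobolev_distE ?(ltW (d0 _ _)) ?lerDl ?divr_ge0 ?ltW.
Qed.

HB.instance Definition _ s := gen_eqMixin (sobolev s).
HB.instance Definition _ s := gen_choiceMixin (sobolev s).
HB.instance Definition _ s := isMetric.Build R (sobolev s)
  (@sobolev_distxx s) (@sobolev_dist_eq0 s) (@sobolev_dist_sym s)
  (@sobolev_dist_triangle s).

Lemma fourier_coef0 n :
  fourier_coef (zero_distribution : torus_distribution R) n = 0.
Proof. by rewrite /fourier_coef /= oppr0. Qed.

Fact sobolev0_sum : is_fourier_sum (zero_distribution : torus_distribution R).
Proof.
move=> f; rewrite (_ : (fun N => _) = fun=> 0); first exact: cvg_cst.
apply/funext => N; rewrite big1// => n _.
by rewrite !fourier_coef0 !mul0r addr0.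
Qed.

Fact sobolev0_fin s :
  (sobolev_sqnorm s (fourier_coef (zero_distribution : torus_distribution R))
   < +oo)%E.
Proof. by rewrite sobolev_sqnorm0 ?ltry// => n; exact: fourier_coef0. Qed.

Definition sobolev0 s : sobolev s :=
  Sobolev (fourier_coef0 0) sobolev0_sum (sobolev0_fin s).
HB.instance Definition _ s := isPointed.Build (sobolev s) (sobolev0 s).

End sobolev.
Arguments sobolev R s : clear implicits.

Notation borel T := (g_sigma_algebraType (@open T)).

Definition weak_cvg {R : realType} {T : ptopologicalType} {I : Type}
    (F : set_system I) (m : I -> probability (borel T) R)
    (m0 : probability (borel T) R) :=
  forall phi : T -> R, continuous phi -> (exists M : R, forall x, `|phi x| <= M) ->
    (\int[m i]_x phi x)%R @[i --> F] --> (\int[m0]_x phi x)%R.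

Section gaussian.
Context {R : realType}.

(* The white noise as a measure on the space of index s, on which it is carried
   when s < - 1 / 2; both sides are the complex number E[exp (i <f, u>)]. *)
Definition white_noise s (Q : probability (borel (sobolev R s)) R) :=
  forall f : testfun R, torus_integral f = 0 ->
    (\int[Q]_u cos (sobolev_val u f))%R +i* (\int[Q]_u sin (sobolev_val u f))%R
    = (expR (- (torus_integral (fun x => f x ^+ 2) / 2)))%:C.

Section random_series.
Context {d : measure_display} {Omega : measurableType d}
  (P : probability Omega R).
Implicit Types (g : nat -> Omega -> R[i]) (X : Omega -> R).

Definition gaussian_rv (m sigma : R) X := measurable_fun setT X /\
  forall A, measurable A -> P (X @^-1` A) = normal_prob m sigma A.

(* R[i] is identified with R * R as a measurable space. *)
Definition re_im (Z : Omega -> R[i]) w : R * R :=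
  (complex.Re (Z w), complex.Im (Z w)).

Definition std_complex_gaussian (Z : Omega -> R[i]) :=
  [/\ gaussian_rv 0 (Num.sqrt 2^-1) (@complex.Re R \o Z),
      gaussian_rv 0 (Num.sqrt 2^-1) (@complex.Im R \o Z) &
      forall A B, measurable A -> measurable B ->
        P ((@complex.Re R \o Z) @^-1` A `&` (@complex.Im R \o Z) @^-1` B) =
        (P ((@complex.Re R \o Z) @^-1` A) *
         P ((@complex.Im R \o Z) @^-1` B))%E].

Definition independent_family (D : set nat) g :=
  forall (s : seq nat) (A : nat -> set (R * R)), uniq s ->
    (forall n, n \in s -> D n) -> (forall n, measurable (A n)) ->
    P (\bigcap_(n in [set` s]) (re_im (g n) @^-1` A n)) =
    (\prod_(n <- s) P (re_im (g n) @^-1` A n))%E.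

(* Only the g n with 0 < n are used. *)
Definition iid_std_complex_gaussian g :=
  (forall n, (0 < n)%N -> std_complex_gaussian (g n)) /\
  independent_family [set n | (0 < n)%N] g.

Definition two_sided g (n : int) w : R[i] :=
  if (0 <= n)%R then g `|n|%N w else (g `|n|%N w)^*%C.

(* For s < 1 / 2 almost every series defines an element of sobolev R s; U is this
   random element, arbitrary on the exceptional null set. *)
Definition gaussian_series_law s g (beta : R)
    (mu : probability (borel (sobolev R s)) R) :=
  exists2 U : {mfun Omega >-> borel (sobolev R s)},
    (\forall w \ae P, forall n : int, n != 0 ->
       fourier_coef (sobolev_val (U w)) n =
       two_sided g n w / (Num.sqrt (1 + 4 * pi ^+ 2 * beta * n%:~R ^+ 2))%:C)
    & forall A, measurable A -> mu A = distribution P U A.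

End random_series.

Definition quartic_weight s (beta : R) (u : sobolev R s) : \bar R :=
  expeR (- (beta%:E * quartic_integral u))%E.

Definition quartic_gibbs s (beta : R)
    (mu Q : probability (borel (sobolev R s)) R) :=
  let Z := (\int[mu]_u quartic_weight beta u)%E in
  forall A, measurable A ->
    Q A = ((fine Z)^-1%:E * \int[mu]_(u in A) quartic_weight beta u)%E.

End gaussian.

(* Main.v *)
From HB Require Import structures.
Require Import Defs.
From mathcomp Require Import all_boot all_order all_algebra.
From mathcomp Require Import complex.
From mathcomp Require Import all_classical all_reals all_analysis.
From mathcomp Require Import measurable_realfun.
From mathcomp Require Import ring lra.

Set Implicit Arguments.
Unset Strict Implicit.
Unset Printing Implicit Defensive.

Import Order.TTheory GRing.Theory Num.Theory.
Import numFieldNormedType.Exports.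

Local Open Scope classical_set_scope.
Local Open Scope ring_scope.

(** Write mu_beta for the Gaussian measure and Q_beta for the measure with density
    proportional to exp (- beta int u^4).  The pointwise variance of the field
    under mu_beta is of order S = beta ^ (- 1/2), and int u^4 is the average over
    the torus of the fourth power of the field.  Its mean is a constant multiple
    of S^2, so beta int u^4 does not become small.  Its variance, however, is only
    O (S^3): the fourth powers at x and y are correlated through the square of the
    covariance rho (x, y), and int rho (x, y)^2 dy = O (S) by Parseval, all
    variances of the Fourier coefficients being at most 1.  Therefore
    beta int u^4 differs from a bounded constant theta by a quantity of variance
    O (beta^2 S^3) = O (beta ^ (1/2)).  The density is almost constant with high
    probability, the normalizing constant cancels exp (- theta), and Q_beta is
    close to mu_beta, which converges to white noise because the variances
    1 / (1 + 4 pi^2 beta n^2) of its Fourier coefficients tend to 1 and the norm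
    of H^s, s < - 1/2, is insensitive to high frequencies.

    Laws are handled through the real Fourier coordinates coord u n b and their
    characteristic functions (white_noise_coords, series_coords).  By
    law_uniqueness these determine the mean of every function of finitely many
    coordinates, so that moments of the field can be computed on explicit
    combinations of two independent normal variables (gaussian_moment,
    pair_moment4); this gives the mean and the variance of the quartic integral
    of a partial Fourier sum (quartic_mean, quartic_deviation).

    The quartic integral of a distribution is an infimum over the functions that
    represent it.  For mu_beta-almost every u the partial sums at the frequencies
    16 ^ k converge fast enough for their quartic integrals to converge to it
    (quartic_integral_cvg).  With the lemma of Fatou and the inequality of
    Chebyshev this yields bad_set_exists: outside a set of small measure
    beta int u^4 is within delta of theta.

    The measurability of u |-> int u^4 is never established: the integral of a
    nonnegative function is a supremum over simple functions, hence monotone, and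
    this is enough to bound Q_beta from above by a multiple of mu_beta close to 1
    plus a multiple of mu_beta restricted to the bad set (gibbs_le).  Such an
    upper bound controls only the upper limit of the mean of a nonnegative
    function phi (gibbs_limsup), after phi has been replaced by a Lipschitz
    function above it (envelope), for which the convergence of mu_beta is
    quantitative (gaussian_close).  Applied to M + phi and to M - phi, it gives
    the limit. *)

(** * Integrals of bounded functions *)

Lemma dominated_cvg_Rintegral d (T : measurableType d) (R : realType)
    (mu : {measure set T -> \bar R}) (D : set T) (f_ : nat -> T -> R)
    (f g : T -> R) :
  measurable D -> (forall n, measurable_fun D (f_ n)) ->
  (forall x, D x -> f_ ^~ x @ \oo --> f x) ->
  mu.-integrable D (EFin \o g) -> (forall n x, D x -> `|f_ n x| <= g x) ->
  mu.-integrable D (EFin \o f) /\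
  (\int[mu]_(x in D) f_ n x)%R @[n --> \oo] --> (\int[mu]_(x in D) f x)%R.
Proof.
move=> mD mf ff ig fg.
have mlim : measurable_fun D f by exact: (measurable_fun_cvg mf ff).
have fin_cvg : {ae mu, forall x, D x ->
    (EFin \o f_ n) x @[n --> \oo] --> (EFin \o f) x}.
  by apply: aeW => x Dx; apply/fine_cvgP; split; [exact: nearW|exact: ff].
have dom : {ae mu, forall x n, D x -> (`|(EFin \o f_ n) x| <= (EFin \o g) x)%E}.
  by apply: aeW => x n Dx; rewrite lee_fin fg.
have [fint _ H] := @dominated_convergence _ _ _ mu _ mD
  (fun n => EFin \o f_ n) (EFin \o f) (EFin \o g)
  (fun n => (measurable_EFinP _ _).2 (mf n)) ((measurable_EFinP _ _).2 mlim)
  fin_cvg ig dom.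
split=> //; apply: fine_cvg; rewrite /Rintegral fineK//.
exact: integrable_fin_num.
Qed.

Section bounded_integral.
Context d (T : measurableType d) (R : realType) (P : probability T R).

Lemma bounded_integrable (f : T -> R) (M : R) :
  measurable_fun setT f -> (forall x, `|f x| <= M) ->
  P.-integrable setT (EFin \o f).
Proof.
move=> mf fM; apply: measurable_bounded_integrable => //.
  by rewrite (le_lt_trans (probability_le1 _ _)) ?ltry.
exists M; split; first exact: num_real.
by move=> x Mx y _; exact: le_trans (fM y) (ltW Mx).
Qed.

Lemma bounded_integral_EFin (f : T -> R) (M : R) :
  measurable_fun setT f -> (forall x, `|f x| <= M) ->
  (\int[P]_x (f x)%:E = (\int[P]_x f x)%:E)%E.
Proof.
move=> mf fM; rewrite /Rintegral fineK//; apply: integrable_fin_num => //.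
exact: (bounded_integrable mf fM).
Qed.

Lemma bounded_cvg_Rintegral (f_ : nat -> T -> R) (f : T -> R) (M : R) :
  (forall n, measurable_fun setT (f_ n)) -> (forall n x, `|f_ n x| <= M) ->
  (forall x, f_ ^~ x @ \oo --> f x) ->
  (\int[P]_x f_ n x)%R @[n --> \oo] --> (\int[P]_x f x)%R.
Proof.
move=> mf fM ff.
have [] := @dominated_cvg_Rintegral _ _ _ P setT f_ f (cst M) measurableT mf
  (fun x _ => ff x) (finite_measure_integrable_cst P M measurableT)
  (fun n x _ => fM n x).
by [].
Qed.

End bounded_integral.

Lemma measurable_cos (R : realType) : measurable_fun setT (@cos R).
Proof. by apply: continuous_measurable_fun => x; exact: continuous_cos. Qed.

Lemma measurable_sin (R : realType) : measurable_fun setT (@sin R).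
Proof. by apply: continuous_measurable_fun => x; exact: continuous_sin. Qed.

(** * Characteristic functions determine a finite-dimensional law *)

Section sign_limit.
Context (R : realType).
Implicit Type y : R.

(** Iterating this odd polynomial pushes [-1, 1] towards the signs of its points;
    being a polynomial, it can be applied to a character without leaving the
    algebra of trigonometric polynomials. *)
Definition sharpen y : R := y * (3 - y ^+ 2) / 2.

Lemma sharpenN y : sharpen (- y) = - sharpen y.
Proof. by rewrite /sharpen sqrrN !mulNr. Qed.

Lemma sharpen_itv y : `|y| <= 1 -> `|sharpen y| <= 1.
Proof.
rewrite !ler_norml /sharpen => /andP[yl yr].
have pl : 0 <= (2 - y) * (1 + y) ^+ 2 by rewrite mulr_ge0 ?sqr_ge0//; lra.
have pr : 0 <= (2 + y) * (1 - y) ^+ 2 by rewrite mulr_ge0 ?sqr_ge0//; lra.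
by apply/andP; split; lra.
Qed.

Lemma iter_sharpen_itv m y : `|y| <= 1 -> `|iter m sharpen y| <= 1.
Proof. by move=> y1; elim: m => //= m; exact: sharpen_itv. Qed.

Lemma iter_sharpenN m y : iter m sharpen (- y) = - iter m sharpen y.
Proof. by elim: m => //= m ->; rewrite sharpenN. Qed.

Lemma iter_sharpen0 m : iter m sharpen 0 = 0.
Proof. by elim: m => //= m ->; rewrite /sharpen !mul0r. Qed.

(** The point 1 is superattracting for the odd map sharpen, with basin ]0, 1]. *)
Lemma iter_sharpen_pos y : 0 < y <= 1 ->
  iter m sharpen y @[m --> \oo] --> (1 : R).
Proof.
move=> /andP[y0 y1]; set q := (1 - y) * (2 + y) / 2.
have q0 : 0 <= q by rewrite /q; nra.
have q1 : q < 1 by rewrite /q; nra.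
have H m : [/\ y <= iter m sharpen y, iter m sharpen y <= 1 &
    1 - iter m sharpen y <= q ^+ m].
  elim: m => [|m [ym m1 mq]] /=; first by rewrite expr0; split=> //; lra.
  move: (iter m sharpen y) ym m1 mq => z yz z1 zq.
  have pr : 0 <= (2 + z) * (1 - z) ^+ 2 by rewrite mulr_ge0 ?sqr_ge0//; lra.
  have zz : 0 <= z * ((1 - z) * (1 + z)) by rewrite !mulr_ge0//; lra.
  rewrite /sharpen; split; [lra|lra|].
  have -> : 1 - z * (3 - z ^+ 2) / 2 = (1 - z) * (2 + z) / 2 * (1 - z) by field.
  rewrite exprS; apply: ler_pM => //; rewrite ?/q; nra.
have lim : geometric (1 : R) q m @[m --> \oo] --> (0 : R).
  by apply: cvg_geometric; rewrite ger0_norm.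
rewrite -[X in _ --> X]subr0; apply/cvgrPdist_le => e e0.
near=> m; have [ym m1 mq] := H m; rewrite subr0 ger0_norm; last by rewrite subr_ge0.
apply: (le_trans mq); rewrite -[q ^+ m]mul1r.
rewrite -[leLHS]ger0_norm; last by rewrite mul1r exprn_ge0.
rewrite -normrN -[- _]add0r.
by near: m; move/cvgrPdist_le: lim; apply.
Unshelve. all: by end_near. Qed.

Lemma iter_sharpen_cvg y : `|y| <= 1 ->
  iter m sharpen y @[m --> \oo] --> Num.sg y.
Proof.
rewrite ler_norml => /andP[y1 y2]; have [y0|y0|<-] := ltgtP 0 y.
- by rewrite gtr0_sg//; apply: iter_sharpen_pos; rewrite y0.
- rewrite ltr0_sg// -[y]opprK; under eq_fun do rewrite iter_sharpenN.
  by apply: cvgN; apply: iter_sharpen_pos; apply/andP; split; lra.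
- by rewrite sgr0; under eq_fun do rewrite iter_sharpen0; exact: cvg_cst.
Qed.

(** Signs of reals are recovered from signs of sines, for a slow enough sine. *)
Lemma sg_sin_cvg (r : R) : Num.sg (sin (r / k.+1%:R)) @[k --> \oo] --> Num.sg r.
Proof.
wlog r0 : r / 0 < r.
  move=> H; have [r0|r0|<-] := ltgtP 0 r; first exact: H.
    rewrite -[r]opprK; under eq_fun do rewrite mulNr sinN sgrN.
    by rewrite sgrN; apply: cvgN; apply: H; lra.
  by under eq_fun do rewrite mul0r sin0; exact: cvg_cst.
apply: cvg_near_cst; near=> k.
rewrite [RHS]gtr0_sg// gtr0_sg// sin_gt0_pi//.
rewrite divr_gt0//= ltr_pdivrMr//.
have : (1 : R) <= pi by have := @pi_ge2 R; lra.
have : r < k%:R by near: k; exact: nbhs_infty_gtr.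
by rewrite -[k.+1]addn1 natrD => rk p1; nra.
Unshelve. all: by end_near. Qed.

End sign_limit.

Section grid.
Context (R : realType).
Implicit Type r : R.

(** Rounding to multiples of 1 / (k + 1) between - (k + 1) and k + 1, written as
    a count of thresholds so that it factors through finitely many half-lines. *)
Definition grid k r : R :=
  (\sum_(z < 2 * k.+1 ^ 2) (z%:R / k.+1%:R - k.+1%:R <= r)%R%:R) / k.+1%:R - k.+1%:R.

Lemma sum_ord_le (N : nat) r : 0 <= r -> r < N%:R ->
  \sum_(z < N) (z%:R <= r)%R%:R = (Num.trunc r).+1%:R :> R.
Proof.
move=> r0 rN; rewrite -natr_sum; congr _%:R.
have tN : (Num.trunc r < N)%N by rewrite truncn_lt_nat.
rewrite -[RHS]card_ord -sum1_card (big_ord_widen N (fun=> 1%N) tN) [RHS]big_mkcond.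
by apply: eq_bigr => z _; rewrite ltnS truncn_ge_nat//; case: (_ <= _).
Qed.

Lemma grid_cvg r : grid k r @[k --> \oo] --> r.
Proof.
apply/cvgrPdist_le => e e0; near=> k; set q : R := k.+1%:R.
have q0 : 0 < q by rewrite ltr0n.
have rq : `|r| < q.
  by rewrite (@lt_le_trans _ _ k%:R)// ?ler_nat//; near: k; exact: nbhs_infty_gtr.
move: (rq); rewrite ltr_norml => /andP[rq1 rq2].
pose y := q * (r + q).
have y0 : 0 <= y by rewrite mulr_ge0//; lra.
have yN : y < (2 * k.+1 ^ 2)%:R by rewrite natrM natrX -/q /y expr2; nra.
have gridE : grid k r = (Num.trunc y).+1%:R / q - q.
  rewrite /grid -/q; congr (_ / _ - _); rewrite -(sum_ord_le y0 yN).
  apply: eq_bigr => z _; congr (_%:R).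
  by rewrite lerBlDr ler_pdivrMr// mulrC.
have /andP[ty yt] := truncn_itv y0.
have -> : r - grid k r = (y - (Num.trunc y).+1%:R) / q.
  by rewrite gridE /y; field; rewrite gt_eqF.
rewrite normrM normfV (gtr0_norm q0) ler_pdivrMr//.
apply: (@le_trans _ _ 1).
  rewrite ler0_norm; last by lra.
  by rewrite -[_.+1]addn1 natrD; lra.
have : e^-1 < k%:R by near: k; exact: nbhs_infty_gtr.
rewrite -[e^-1]mul1r ltr_pdivrMr// => /ltW/le_trans; apply.
by rewrite mulrC ler_wpM2l ?ltW// /q ltr_nat.
Unshelve. all: by end_near. Qed.

End grid.

Section cos_mean.
Context (R : realType) (I : finType) d (T : measurableType d).
Context (P : probability T R) (X : T -> I -> R).
Hypothesis mX : forall i, measurable_fun setT (X ^~ i).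
Implicit Types (h : (I -> R) -> R) (t x : I -> R) (c : R).

Definition lin t x : R := \sum_i t i * x i.

Lemma linD t t' x : lin (t \+ t') x = lin t x + lin t' x.
Proof. by rewrite /lin -big_split; apply: eq_bigr => i _; rewrite mulrDl. Qed.

Lemma linB t t' x : lin (t \- t') x = lin t x - lin t' x.
Proof.
by rewrite /lin -sumrB; apply: eq_bigr => i _; rewrite mulrBl.
Qed.

Lemma measurable_cos_lin t c :
  measurable_fun setT (fun w => cos (lin t (X w) + c)).
Proof.
apply: (measurableT_comp (@measurable_cos R)).
apply: measurable_funD => //; apply: measurable_sum => i.
exact: measurable_funM.
Qed.

Definition bounded_obs h :=
  (exists M, forall x, `|h x| <= M) /\ measurable_fun setT (h \o X).

Definition cos_mean h t c : R := \int[P]_w (h (X w) * cos (lin t (X w) + c)).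

Lemma bounded_obsM h h' : bounded_obs h -> bounded_obs h' -> bounded_obs (h \* h').
Proof.
move=> [[M hM] mh] [[M' hM'] mh']; split; last exact: measurable_funM.
by exists (M * M') => x; rewrite normrM ler_pM.
Qed.

Lemma bounded_obsD h h' : bounded_obs h -> bounded_obs h' -> bounded_obs (h \+ h').
Proof.
move=> [[M hM] mh] [[M' hM'] mh']; split; last exact: measurable_funD.
by exists (M + M') => x; rewrite (le_trans (ler_normD _ _))// lerD.
Qed.

Lemma bounded_obs_cst (a : R) : bounded_obs (cst a).
Proof. by split; [exists (`|a|) | exact: measurable_cst]. Qed.

Lemma bounded_obs_cos t c : bounded_obs (fun x => cos (lin t x + c)).
Proof. by split; [exists 1 => x; exact: cos_max|exact: measurable_cos_lin]. Qed.

Lemma bounded_obs_integrable h : bounded_obs h ->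
  P.-integrable setT (EFin \o (h \o X)).
Proof. by move=> [[M hM] mh]; apply: (@bounded_integrable _ _ _ P _ M mh) => x; exact: hM. Qed.

Lemma cos_meanD h h' t c : bounded_obs h -> bounded_obs h' ->
  cos_mean (h \+ h') t c = cos_mean h t c + cos_mean h' t c.
Proof.
move=> bh bh'; rewrite /cos_mean -RintegralD//.
- by apply: eq_Rintegral => w _; rewrite /= mulrDl.
- exact: bounded_obs_integrable (bounded_obsM bh (bounded_obs_cos t c)).
- exact: bounded_obs_integrable (bounded_obsM bh' (bounded_obs_cos t c)).
Qed.

Lemma cos_meanZ h (a : R) t c : bounded_obs h ->
  cos_mean (cst a \* h) t c = a * cos_mean h t c.
Proof.
move=> bh; rewrite /cos_mean -RintegralZl//.
- by apply: eq_Rintegral => w _; rewrite /= mulrA.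
- exact: bounded_obs_integrable (bounded_obsM bh (bounded_obs_cos t c)).
Qed.

(** Product-to-sum: the family of all cosine means of h determines that of h
    times a character. *)
Lemma cos_mean_mul_cos h t c t' c' : bounded_obs h ->
  cos_mean (h \* (fun x => cos (lin t' x + c'))) t c =
  2^-1 * (cos_mean h (t \+ t') (c + c') + cos_mean h (t \- t') (c - c')).
Proof.
move=> bh.
have bI u e := bounded_obs_integrable (bounded_obsM bh (bounded_obs_cos u e)).
rewrite /cos_mean -RintegralD ?(bI)// -RintegralZl//; last first.
  have := bounded_obs_integrable (bounded_obsD
   (bounded_obsM bh (bounded_obs_cos (t \+ t') (c + c')))
   (bounded_obsM bh (bounded_obs_cos (t \- t') (c - c')))).
  by [].
apply: eq_Rintegral => w _ /=; rewrite linD linB.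
have -> : lin t (X w) + lin t' (X w) + (c + c') =
  (lin t (X w) + c) + (lin t' (X w) + c') by ring.
have -> : lin t (X w) - lin t' (X w) + (c - c') =
  (lin t (X w) + c) - (lin t' (X w) + c') by ring.
move: (lin t (X w) + c) (lin t' (X w) + c') => A B.
by rewrite cosD cosB; field.
Qed.

Lemma cos_mean_cvg (h_ : nat -> (I -> R) -> R) h M t c :
  (forall n, measurable_fun setT (h_ n \o X)) -> (forall n x, `|h_ n x| <= M) ->
  (forall x, h_ ^~ x @ \oo --> h x) ->
  cos_mean (h_ n) t c @[n --> \oo] --> cos_mean h t c.
Proof.
move=> mh hM hh; apply: (@bounded_cvg_Rintegral _ _ _ P _ _ M).
- by move=> n; apply: measurable_funM; [exact: mh|exact: measurable_cos_lin].
- move=> n w; rewrite normrM -[M]mulr1 ler_pM//; exact: cos_max.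
- by move=> w; apply: cvgM; [exact: hh|exact: cvg_cst].
Qed.

End cos_mean.

Section char_uniqueness.
Context (R : realType) (I : finType).
Context d1 (T1 : measurableType d1) (P1 : probability T1 R) (X1 : T1 -> I -> R).
Context d2 (T2 : measurableType d2) (P2 : probability T2 R) (X2 : T2 -> I -> R).
Hypothesis mX1 : forall i, measurable_fun setT (X1 ^~ i).
Hypothesis mX2 : forall i, measurable_fun setT (X2 ^~ i).
Implicit Types (h g : (I -> R) -> R) (t x : I -> R) (a c : R).

(** Testing h against all characters, and not only its own mean, makes the
    class stable under multiplication by characters. *)
Definition same_means h := [/\ bounded_obs X1 h, bounded_obs X2 h &
  forall t c, cos_mean P1 X1 h t c = cos_mean P2 X2 h t c].

(** The multipliers form an algebra closed under bounded limits which contains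
    the characters; the aim is to see that it contains all bounded continuous
    functions. *)
Definition multiplier g := [/\ bounded_obs X1 g, bounded_obs X2 g &
  forall h, same_means h -> same_means (h \* g)].

Lemma multiplier_cst a : multiplier (cst a).
Proof.
split; try exact: bounded_obs_cst.
move=> h [b1 b2 E]; split; try by apply: bounded_obsM => //; exact: bounded_obs_cst.
move=> t c; have -> : h \* cst a = cst a \* h by apply/funext => x /=; rewrite mulrC.
by rewrite !cos_meanZ// E.
Qed.

Lemma multiplier_cos t c : multiplier (fun x => cos (lin t x + c)).
Proof.
split; try exact: bounded_obs_cos.
move=> h [b1 b2 E]; split; try by apply: bounded_obsM => //; exact: bounded_obs_cos.
by move=> t' c'; rewrite !cos_mean_mul_cos// !E.
Qed.

Lemma multiplierD g g' : multiplier g -> multiplier g' -> multiplier (g \+ g').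
Proof.
move=> [b1 b2 H] [b1' b2' H']; split; try exact: bounded_obsD.
move=> h hh; have [c1 c2 E] := H _ hh; have [c1' c2' E'] := H' _ hh.
have -> : h \* (g \+ g') = (h \* g) \+ (h \* g').
  by apply/funext => x /=; rewrite mulrDr.
split; try exact: bounded_obsD.
by move=> t c; rewrite !cos_meanD// E E'.
Qed.

Lemma multiplierM g g' : multiplier g -> multiplier g' -> multiplier (g \* g').
Proof.
move=> [b1 b2 H] [b1' b2' H']; split; try exact: bounded_obsM.
move=> h /H/H'; have -> // : (h \* g) \* g' = h \* (g \* g').
by apply/funext => x /=; rewrite mulrA.
Qed.

Lemma multiplier_cvg (g_ : nat -> (I -> R) -> R) g (M : R) :
  (forall n, multiplier (g_ n)) -> (forall n x, `|g_ n x| <= M) ->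
  (forall x, g_ ^~ x @ \oo --> g x) -> multiplier g.
Proof.
move=> mg gM gg.
have gM' x : `|g x| <= M.
  have /cvg_norm cn := gg x; rewrite -(cvg_lim _ cn)//; apply: limr_le.
    by apply/cvg_ex; eexists; exact: cn.
  exact: nearW.
have b1 : bounded_obs X1 g.
  split; first by exists M.
  by apply: measurable_fun_cvg => [n|w _]; [have [[]] := mg n|exact: gg].
have b2 : bounded_obs X2 g.
  split; first by exists M.
  by apply: measurable_fun_cvg => [n|w _]; [have [_ []] := mg n|exact: gg].
split=> // h hh; have [c1 c2 _] := hh; split; try exact: bounded_obsM.
move=> t c; have [[K hK] _] := c1.
have cvg d (T : measurableType d) (P : probability T R) (X : T -> I -> R) :
    (forall i, measurable_fun setT (X ^~ i)) ->
    (forall n, bounded_obs X (g_ n)) -> bounded_obs X h ->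
  cos_mean P X (h \* g_ n) t c @[n --> \oo] --> cos_mean P X (h \* g) t c.
  move=> mX bg bh; apply: (@cos_mean_cvg _ _ _ _ _ _ mX _ _ (K * M)).
  - by move=> n; have [] := bounded_obsM bh (bg n).
  - by move=> n x; rewrite normrM ler_pM.
  - by move=> x; apply: cvgM; [exact: cvg_cst|exact: gg].
have C1 := cvg _ _ P1 X1 mX1 (fun n => let: And3 b _ _ := mg n in b) c1.
have C2 := cvg _ _ P2 X2 mX2 (fun n => let: And3 _ b _ := mg n in b) c2.
have E : (fun n => cos_mean P1 X1 (h \* g_ n) t c) =
         (fun n => cos_mean P2 X2 (h \* g_ n) t c).
  by apply/funext => n; have [_ _ /(_ _ hh)[_ _ ->]] := mg n.
by rewrite E in C1; exact: (cvg_unique (@Rhausdorff R) C1 C2).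
Qed.

Lemma multiplier_sg i a : multiplier (fun x => Num.sg (x i - a)).
Proof.
have sg1 (r : R) : `|Num.sg r| <= 1 by rewrite normr_sg; case: eqP.
(* sin (r / (k + 1)) has the sign of r for large k *)
pose y k x := sin ((x i - a) / k.+1%:R).
have my k : multiplier (y k).
  have -> : y k = fun x =>
      cos (lin (fun j => k.+1%:R^-1 * (j == i)%:R) x + (- a / k.+1%:R - pi / 2)).
    apply/funext => x; rewrite /y /lin (bigD1 i)//= eqxx big1 => [|j /negPf->]; last by rewrite mulr0 mul0r.
    by rewrite -cosBpihalf; congr cos; rewrite mulr1; ring.
  exact: multiplier_cos.
have y1 k x : `|y k x| <= 1 by exact: sin_max.
have mit k m : multiplier (fun x => iter m (@sharpen R) (y k x)).
  elim: m => [|m IH]; first exact: my.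
  have -> : (fun x => iter m.+1 (@sharpen R) (y k x)) =
      (fun x => iter m (@sharpen R) (y k x)) \*
      (cst (3 / 2) \+ (cst (- 2^-1) \* ((fun x => iter m (@sharpen R) (y k x)) \*
         (fun x => iter m (@sharpen R) (y k x))))).
    by apply/funext => x /=; rewrite /sharpen; field.
  apply: multiplierM => //; apply: multiplierD; first exact: multiplier_cst.
  by apply: multiplierM; [exact: multiplier_cst|exact: multiplierM].
have ms k : multiplier (fun x => Num.sg (y k x)).
  apply: (multiplier_cvg (mit k) (M := 1)) => [m x|x].
    exact: iter_sharpen_itv.
  exact: iter_sharpen_cvg.
apply: (multiplier_cvg ms (M := 1)) => [k x|x]; first exact: sg1.
exact: sg_sin_cvg.
Qed.

(** A closed half-line has indicator 1 - sg (sg - 1) / 2, where the sign of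
    x i - a enters; at the end point the formula gives 1. *)
Lemma multiplier_ge i a : multiplier (fun x => (a <= x i)%R%:R).
Proof.
have m := multiplier_sg i a.
have -> : (fun x => (a <= x i)%R%:R) = cst 1 \+ (cst (- 2^-1) \*
   ((fun x => Num.sg (x i - a)) \* (cst (- 1) \+ (fun x => Num.sg (x i - a))))).
  apply/funext => x /=; rewrite -subr_ge0.
  by case: sgrP => [_|_|_]; rewrite /=; field.
apply: multiplierD; first exact: multiplier_cst.
apply: multiplierM; first exact: multiplier_cst.
by apply: multiplierM => //; apply: multiplierD => //; exact: multiplier_cst.
Qed.

Lemma multiplier_sum (J : Type) (s : seq J) (F : J -> (I -> R) -> R) :
  (forall j, multiplier (F j)) -> multiplier (fun x => \sum_(j <- s) F j x).
Proof.
move=> mF; elim: s => [|j s IH].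
  by under eq_fun do rewrite big_nil; exact: multiplier_cst.
by under eq_fun do rewrite big_cons; exact: multiplierD.
Qed.

Lemma multiplier_prod (J : Type) (s : seq J) (F : J -> (I -> R) -> R) :
  (forall j, multiplier (F j)) -> multiplier (fun x => \prod_(j <- s) F j x).
Proof.
move=> mF; elim: s => [|j s IH].
  by under eq_fun do rewrite big_nil; exact: multiplier_cst.
by under eq_fun do rewrite big_cons; exact: multiplierM.
Qed.

(** A function of finitely many comparisons is a polynomial in the indicators of
    these comparisons. *)
Lemma multiplier_step (J : finType) (i_ : J -> I) (a_ : J -> R)
    (F : {ffun J -> bool} -> R) :
  multiplier (fun x => F [ffun j => a_ j <= x (i_ j)]).
Proof.
pose ind j (b : bool) x : R := (b == (a_ j <= x (i_ j))%R)%:R.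
have mind j b : multiplier (ind j b).
  case: b.
    rewrite (_ : ind j true = fun x => (a_ j <= x (i_ j))%R%:R); first exact: multiplier_ge.
    by apply/funext => x; rewrite /ind eq_sym eqb_id.
  rewrite (_ : ind j false = cst 1 \+ (cst (- 1) \* (fun x => (a_ j <= x (i_ j))%R%:R))).
    apply: multiplierD; first exact: multiplier_cst.
    by apply: multiplierM; [exact: multiplier_cst|exact: multiplier_ge].
  by apply/funext => x /=; rewrite /ind eq_sym eqbF_neg; case: (_ <= _) => /=; ring.
have -> : (fun x => F [ffun j => a_ j <= x (i_ j)]) = fun x =>
    \sum_(b : {ffun J -> bool}) (cst (F b) \* fun x => \prod_j ind j (b j) x) x.
  apply/funext => x; set b0 := [ffun j => _].
  have b0E j : b0 j = (a_ j <= x (i_ j)) by rewrite ffunE.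
  rewrite (bigD1 b0)//= [X in X + _](_ : _ = F b0); last first.
    by rewrite big1 ?mulr1// => j _; rewrite /ind b0E eqxx.
  rewrite [X in _ + X]big1 ?addr0// => b bb0.
  have [j bj] : exists j, b j != b0 j.
    by apply/existsP; apply: contraNT bb0 => /existsPn H; apply/eqP/ffunP => j;
      apply/eqP; rewrite -[_ == _]negbK; exact: H.
  by rewrite (bigD1 j)//= /ind -b0E (negPf bj) mul0r mulr0.
apply: multiplier_sum => b; apply: multiplierM; first exact: multiplier_cst.
by apply: multiplier_prod.
Qed.

Lemma multiplier_continuous (Phi : (I -> R) -> R) M :
  (forall x, `|Phi x| <= M) ->
  (forall (x_ : nat -> I -> R) x, (forall i, x_ ^~ i @ \oo --> x i) ->
     Phi (x_ n) @[n --> \oo] --> Phi x) ->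
  multiplier Phi.
Proof.
move=> PhiM cPhi.
apply: (@multiplier_cvg (fun k x => Phi (fun i => grid k (x i))) _ M).
- move=> k; pose F (b : {ffun I * 'I_(2 * k.+1 ^ 2) -> bool}) : R :=
    Phi (fun i => (\sum_z (b (i, z))%:R) / k.+1%:R - k.+1%:R).
  have := multiplier_step (fun iz => iz.1)
    (fun iz : I * 'I_(2 * k.+1 ^ 2) => iz.2%:R / k.+1%:R - k.+1%:R) F.
  congr multiplier; apply/funext => x; rewrite /F; congr Phi; apply/funext => i.
  by rewrite /grid; congr (_ / _ - _); apply: eq_bigr => z _; rewrite ffunE.
- by move=> k x; exact: PhiM.
- by move=> x; apply: cPhi => i; exact: grid_cvg.
Qed.

(** A law on R ^ I is determined by its characteristic function; no Fourier
    inversion is needed because trigonometric polynomials already approximate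
    indicators of half-lines boundedly. *)
Theorem law_uniqueness (Phi : (I -> R) -> R) M :
  (forall t c, \int[P1]_w cos (lin t (X1 w) + c) =
               \int[P2]_w cos (lin t (X2 w) + c) :> R) ->
  (forall x, `|Phi x| <= M) ->
  (forall (x_ : nat -> I -> R) x, (forall i, x_ ^~ i @ \oo --> x i) ->
     Phi (x_ n) @[n --> \oo] --> Phi x) ->
  [/\ measurable_fun setT (Phi \o X1), measurable_fun setT (Phi \o X2) &
    \int[P1]_w Phi (X1 w) = \int[P2]_w Phi (X2 w) :> R].
Proof.
move=> E PhiM cPhi; have [b1 b2 H] := multiplier_continuous PhiM cPhi.
split; [exact: b1.2|exact: b2.2|].
have s1 : same_means (cst 1).
  split; try exact: bounded_obs_cst.
  move=> t c; rewrite /cos_mean; under eq_Rintegral do rewrite mul1r.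
  by rewrite E; apply: eq_Rintegral => w _; rewrite mul1r.
have [_ _ /(_ (cst 0) 0)] := H _ s1; rewrite /cos_mean.
have lin0 x : cos (lin (cst 0) x + 0) = 1.
  by rewrite /lin big1 ?addr0 ?cos0// => i _; rewrite mul0r.
under eq_Rintegral do rewrite lin0 mulr1 /= mul1r.
by move=> ->; apply: eq_Rintegral => w _; rewrite lin0 mulr1 /= mul1r.
Qed.

End char_uniqueness.

(** The unbounded case, by truncation and monotone convergence. *)
Theorem law_uniqueness_ge0 (R : realType) (I : finType)
    d1 (T1 : measurableType d1) (P1 : probability T1 R) (X1 : T1 -> I -> R)
    d2 (T2 : measurableType d2) (P2 : probability T2 R) (X2 : T2 -> I -> R)
    (Phi : (I -> R) -> R) :
  (forall i, measurable_fun setT (X1 ^~ i)) ->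
  (forall i, measurable_fun setT (X2 ^~ i)) ->
  (forall t c, \int[P1]_w cos (lin t (X1 w) + c) =
               \int[P2]_w cos (lin t (X2 w) + c) :> R) ->
  (forall x, 0 <= Phi x) ->
  (forall (x_ : nat -> I -> R) x, (forall i, x_ ^~ i @ \oo --> x i) ->
     Phi (x_ n) @[n --> \oo] --> Phi x) ->
  [/\ measurable_fun setT (Phi \o X1), measurable_fun setT (Phi \o X2) &
    (\int[P1]_w (Phi (X1 w))%:E = \int[P2]_w (Phi (X2 w))%:E)%E].
Proof.
move=> mX1 mX2 E Phi0 cPhi.
pose Phi_ k x := Num.min (Phi x) k%:R.
have U k := @law_uniqueness _ _ _ _ P1 _ _ _ P2 _ mX1 mX2 (Phi_ k) k%:R E.
have bnd k x : `|Phi_ k x| <= k%:R.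
  by rewrite /Phi_ ger0_norm ?ge_min ?lexx ?orbT// le_min Phi0 ler0n.
have cont k (x_ : nat -> I -> R) x : (forall i, x_ ^~ i @ \oo --> x i) ->
     Phi_ k (x_ n) @[n --> \oo] --> Phi_ k x.
  move=> /cPhi c; rewrite /Phi_; under eq_fun do rewrite minr_absE.
  rewrite minr_absE; apply: cvgM; last exact: cvg_cst.
  apply: cvgB; first by apply: cvgD => //; exact: cvg_cst.
  by apply: cvg_norm; apply: cvgB => //; exact: cvg_cst.
have {}U k := U k (bnd k) (cont k).
have lim x : Phi_ k x @[k --> \oo] --> Phi x.
  apply: cvg_near_cst; near=> k; apply/min_idPl/ltW.
  by near: k; exact: nbhs_infty_gtr.
have m1 : measurable_fun setT (Phi \o X1).
  apply: (@measurable_fun_cvg _ _ _ _ (fun k => Phi_ k \o X1)) => [k|w _].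
    by have [] := U k.
  exact: lim.
have m2 : measurable_fun setT (Phi \o X2).
  apply: (@measurable_fun_cvg _ _ _ _ (fun k => Phi_ k \o X2)) => [k|w _].
    by have [] := U k.
  exact: lim.
split=> //.
have limI d (T : measurableType d) (P : probability T R) (X : T -> I -> R) :
    (forall k, measurable_fun setT (Phi_ k \o X)) ->
    (\int[P]_w (Phi_ k (X w))%:E)%E @[k --> \oo] --> (\int[P]_w (Phi (X w))%:E)%E.
  move=> mPhi.
  have := @cvg_monotone_convergence _ _ _ P _ measurableT
    (fun k w => (Phi_ k (X w))%:E).
  rewrite (_ : (fun w => limn _) = fun w => (Phi (X w))%:E); last first.
    apply/funext => w; apply/cvg_lim => //; apply/fine_cvgP; split; first exact: nearW.
    exact: lim.
  apply.
  - by move=> k; apply/measurable_EFinP; exact: mPhi.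
  - by move=> k w _; rewrite lee_fin /Phi_ le_min Phi0 ler0n.
  - move=> w _ m n mn; rewrite lee_fin /Phi_ le_min ge_min lexx/=.
    by rewrite ge_min ler_nat mn orbT.
have L1 := limI _ _ P1 X1 (fun k => let: And3 a _ _ := U k in a).
have L2 := limI _ _ P2 X2 (fun k => let: And3 _ a _ := U k in a).
have EE : (fun k => \int[P1]_w (Phi_ k (X1 w))%:E)%E =
          (fun k => \int[P2]_w (Phi_ k (X2 w))%:E)%E.
  apply/funext => k; have [mk1 mk2 e] := U k.
  by rewrite (bounded_integral_EFin P1 mk1 (fun w => bnd k (X1 w)))
    (bounded_integral_EFin P2 mk2 (fun w => bnd k (X2 w))) e.
by rewrite EE in L1; exact: (cvg_unique _ L1 L2).
Unshelve. all: by end_near. Qed.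

(** * Independence and products of expectations *)

Section Rintegral_finite_sum.
Context d (T : measurableType d) (R : realType) (P : probability T R).

Lemma Rintegral_sum (J : Type) (s : seq J) (f : J -> T -> R) :
  (forall j, P.-integrable setT (EFin \o f j)) ->
  \int[P]_w (\sum_(j <- s) f j w) = \sum_(j <- s) \int[P]_w f j w :> R.
Proof.
move=> fi; have H : P.-integrable setT (EFin \o (fun w => \sum_(j <- s) f j w)) /\
    \int[P]_w (\sum_(j <- s) f j w) = \sum_(j <- s) \int[P]_w f j w :> R.
  elim: s => [|j s [IHi IH]].
    under eq_fun do rewrite big_nil; rewrite big_nil; split.
      exact: (finite_measure_integrable_cst P 0 measurableT).
    by rewrite Rintegral_cst// mul0r.
  split.
    under eq_fun do rewrite big_cons.
    by apply: eq_integrable (integrableD measurableT (fi j) IHi).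
  under eq_Rintegral do rewrite big_cons.
  by rewrite RintegralD// IH big_cons.
exact: H.2.
Qed.

End Rintegral_finite_sum.

Section independence.
Context (R : realType) (I : finType) d (T : measurableType d).
Context (P : probability T R) (X : I -> T -> R).
Hypothesis mX : forall i, measurable_fun setT (X i).

Definition independent := forall A : I -> set R, (forall i, measurable (A i)) ->
  P (\bigcap_i (X i @^-1` A i)) = (\prod_i P (X i @^-1` A i))%E.

Hypothesis indepX : independent.

Lemma prod_Rintegral_indic (A : I -> set R) : (forall i, measurable (A i)) ->
  \int[P]_w (\prod_i \1_(A i) (X i w)) =
  \prod_i \int[P]_w (\1_(A i) (X i w)) :> R.
Proof.
move=> mA.
have mXA i : measurable (X i @^-1` A i).
  by rewrite -[X in measurable X]setTI; exact: mX.
have E B : measurable B -> \int[P]_w \1_B w = fine (P B) :> R.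
  by move=> mB; rewrite /Rintegral integral_indic// setIT.
have -> : (fun w => \prod_i \1_(A i) (X i w)) =
    (\1_(\bigcap_i (X i @^-1` A i)) : T -> R).
  apply/funext => w; rewrite [RHS]indicE.
  have [/set_mem h|/negP h] := boolP (w \in _).
    by rewrite big1// => i _; rewrite indicE mem_set//; exact: h.
  have [i Ai] : exists i, ~ A i (X i w).
    by apply/not_existsP => H; apply: h; apply/mem_set => i _; exact: contrapT (H i).
  by rewrite (bigD1 i)//= indicE memNset// mul0r.
rewrite E; last by apply: fin_bigcap_measurable => // i _; exact: mXA.
rewrite indepX//.
have -> : (\prod_i P (X i @^-1` A i) = (\prod_i fine (P (X i @^-1` A i)))%:E)%E.
  rewrite -prodEFin; apply: eq_bigr => i _; rewrite fineK//.
  exact: fin_num_measure.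
by apply: eq_bigr => i _; rewrite -E.
Qed.

Lemma prod_Rintegral_step (Z : finType) (A : I -> Z -> set R) (v : I -> Z -> R) :
  (forall i z, measurable (A i z)) ->
  \int[P]_w (\prod_i \sum_z v i z * \1_(A i z) (X i w)) =
  \prod_i \int[P]_w (\sum_z v i z * \1_(A i z) (X i w)) :> R.
Proof.
move=> mA.
have mind i z : measurable_fun setT (fun w => \1_(A i z) (X i w) : R).
  by apply: (measurableT_comp _ (mX i)); exact: measurable_indic.
have bind i z w : `|\1_(A i z) (X i w) : R| <= 1.
  by rewrite indicE; case: (_ \in _); rewrite ?normr1 ?normr0.
have iind i z : P.-integrable setT (EFin \o (fun w => v i z * \1_(A i z) (X i w))).
  apply: (@bounded_integrable _ _ _ P _ `|v i z|); first exact: measurable_funM.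
  by move=> w; rewrite normrM -[leRHS]mulr1 ler_wpM2l.
under eq_Rintegral do rewrite bigA_distr_bigA.
have mprod (f : {ffun I -> Z}) :
    measurable_fun setT (fun w => \prod_i \1_(A i (f i)) (X i w) : R).
  exact: measurable_prod.
have iprod (f : {ffun I -> Z}) :
    P.-integrable setT (EFin \o (fun w => \prod_i \1_(A i (f i)) (X i w) : R)).
  apply: (@bounded_integrable _ _ _ P _ 1) => // w.
  by rewrite normr_prod; apply: prodr_ile1 => i _; rewrite normr_ge0 bind.
rewrite Rintegral_sum => [|f]; last first.
  rewrite (_ : EFin \o _ = fun w => ((\prod_i v i (f i))%:E *
      (\prod_i \1_(A i (f i)) (X i w))%:E)%E); first exact: integrableZl (iprod f).
  by apply/funext => w /=; rewrite big_split.
transitivity (\prod_i \sum_z v i z * \int[P]_w (\1_(A i z) (X i w)))%R; last first.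
  apply: eq_bigr => i _; rewrite Rintegral_sum//.
  by apply: eq_bigr => z _; rewrite -RintegralZl//;
    apply: (@bounded_integrable _ _ _ P _ 1).
rewrite bigA_distr_bigA; apply: eq_bigr => f _.
under eq_Rintegral do rewrite big_split.
by rewrite /= RintegralZl// prod_Rintegral_indic// -big_split.
Qed.

(** Rounding turns the factors into step functions, for which the product rule
    follows from that for indicators by distributivity. *)
Lemma prod_Rintegral (f : I -> R -> R) (M : R) :
  (forall i x, `|f i x| <= M) -> (forall i, continuous (f i)) ->
  \int[P]_w (\prod_i f i (X i w)) = \prod_i \int[P]_w f i (X i w) :> R.
Proof.
move=> fM cf.
pose N k := (2 * k.+1 ^ 2)%N.
pose cnt k (r : R) : nat := (\sum_(z < N k) (z%:R / k.+1%:R - k.+1%:R <= r :> R)%R)%N.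
have gridE k r : grid k r = (cnt k r)%:R / k.+1%:R - k.+1%:R by rewrite /grid natr_sum.
have mgrid k : measurable_fun setT (@grid R k).
  apply: measurable_funB => //; apply: measurable_funM => //.
  apply: measurable_sum => z.
  rewrite (_ : (fun x => _) = \1_(`[z%:R / k.+1%:R - k.+1%:R, +oo[)).
    exact: measurable_indic.
  by apply/funext => x; rewrite indicE mem_setE in_itv /= andbT.
pose A k (z : 'I_(N k).+1) := (@grid R k) @^-1` [set z%:R / k.+1%:R - k.+1%:R].
have mA k z : measurable (A k z).
  by rewrite -[X in measurable X]setTI; exact: mgrid.
have stepE k (g : R -> R) r :
    g (grid k r) = \sum_(z < (N k).+1) g (z%:R / k.+1%:R - k.+1%:R) * \1_(A k z) r.
  have cN : (cnt k r < (N k).+1)%N.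
    rewrite ltnS /cnt -[leqRHS]card_ord -sum1_card; apply: leq_sum => z _.
    exact: leq_b1.
  rewrite (bigD1 (Ordinal cN))//= big1 => [|z zr].
    by rewrite addr0 indicE mem_set ?mulr1/A/= ?gridE.
  rewrite indicE memNset ?mulr0// /A/= gridE => /addIr.
  have k0 : k.+1%:R != 0 :> R by rewrite pnatr_eq0.
  move=> /(mulIf (invr_neq0 k0))/eqP; rewrite eqr_nat => /eqP cz.
  by move/eqP: zr; apply; apply/val_inj.
have approx k : \int[P]_w (\prod_i f i (grid k (X i w))) =
    \prod_i \int[P]_w f i (grid k (X i w)) :> R.
  under eq_Rintegral do under eq_bigr do rewrite stepE.
  rewrite prod_Rintegral_step//; apply: eq_bigr => i _.
  by apply: eq_Rintegral => w _; rewrite stepE.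
have mf i : measurable_fun setT (f i) by exact: continuous_measurable_fun.
have mfg i k : measurable_fun setT (fun w => f i (grid k (X i w))).
  by apply: (measurableT_comp (mf i)); exact: (measurableT_comp (mgrid k)).
have L : \int[P]_w (\prod_i f i (grid k (X i w))) @[k --> \oo] -->
    \int[P]_w (\prod_i f i (X i w)).
  apply: (@bounded_cvg_Rintegral _ _ _ P _ _ (\prod_(i : I) M)) => [k|k w|w].
  - exact: measurable_prod.
  - by rewrite normr_prod; apply: ler_prod => i _; rewrite normr_ge0 fM.
  - apply: (@cvg_big _ _ _ _ _ (@mul_continuous R)) => i _.
    by apply: continuous_cvg; [exact: cf|exact: grid_cvg].
have L' : \prod_i \int[P]_w f i (grid k (X i w)) @[k --> \oo] -->
    \prod_i \int[P]_w f i (X i w).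
  apply: (@cvg_big _ _ _ _ _ (@mul_continuous R)) => i _.
  apply: (@bounded_cvg_Rintegral _ _ _ P _ _ M) => [k|k w|w] //.
  by apply: continuous_cvg; [exact: cf|exact: grid_cvg].
rewrite (_ : (fun k => \int[P]_w _) = (fun k => \prod_i \int[P]_w f i (grid k (X i w)))) in L.
  exact: (cvg_unique (@Rhausdorff R) L L').
by apply/funext => k.
Qed.

(** The characteristic function of a sum of independent symmetric variables.  In
    the induction the variables already split off remain as a product of factors
    f i (X i), so that independence is used only once, when all are split off;
    the sines contribute nothing because their means vanish. *)
Lemma independent_cos_mean (t : I -> R) (e : I -> R) (c : R) :
  (forall i, \int[P]_w cos (t i * X i w) = e i :> R) ->
  (forall i, \int[P]_w sin (t i * X i w) = 0 :> R) ->
  \int[P]_w cos (lin t (fun i => X i w) + c) = cos c * \prod_i e i :> R.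
Proof.
move=> ce se.
suff S (s : seq I) : uniq s -> forall (f : I -> R -> R) c,
    (forall i x, `|f i x| <= 1) -> (forall i, continuous (f i)) ->
  \int[P]_w (cos (\sum_(i <- s) t i * X i w + c) * \prod_(i | i \notin s) f i (X i w)) =
  cos c * \prod_(i <- s) e i * \prod_(i | i \notin s) \int[P]_w f i (X i w) :> R.
  have le_refl_norm1 : `|1 : R| <= 1 by rewrite normr1.
  have ccst (i : I) : continuous (cst 1 : R -> R) by move=> x; exact: cvg_cst.
  have := S (index_enum I) (index_enum_uniq I) (fun=> cst 1) c
    (fun i x => le_refl_norm1) ccst.
  have none (F : I -> R) : \prod_(i | i \notin index_enum I) F i = 1.
    by apply: big_pred0 => i; rewrite mem_index_enum.
  rewrite none mulr1 => <-; apply: eq_Rintegral => w _.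
  by rewrite none mulr1.
elim: s => [_ f {}c f1 cf|j s IH /= /andP[js us] f {}c f1 cf].
  under eq_Rintegral do rewrite big_nil add0r; rewrite big_nil mulr1.
  have mf i : measurable_fun setT (fun w => f i (X i w)).
    by apply: measurableT_comp => //; exact: continuous_measurable_fun.
  rewrite RintegralZl//; last first.
    apply: (@bounded_integrable _ _ _ P _ 1) => [|w]; first exact: measurable_prod.
    by rewrite normr_prod; apply: prodr_ile1 => i _; rewrite normr_ge0 f1.
  by rewrite (prod_Rintegral f1).
pose g (h : R -> R) i : R -> R := if i == j then fun x => h (t j * x) else f i.
have gE (F G : I -> R) : F j = G j -> (forall i, i != j -> F i = G i) ->
    \prod_(i | i \notin s) F i = G j * \prod_(i | i \notin j :: s) G i.
  move=> Fj FG; rewrite (bigD1 j)//= Fj; congr (_ * _).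
  apply: eq_big => [i|i /andP[_ /FG]//].
  by rewrite inE negb_or andbC.
have gM h (h1 : forall x, `|h x| <= 1) i x : `|g h i x| <= 1.
  by rewrite /g; case: ifP.
have gC h (ch : continuous h) i : continuous (g h i).
  rewrite /g; case: ifP => // _ x; apply: continuous_comp; last exact: ch.
  by apply: mulrl_continuous.
have gX h w : \prod_(i | i \notin s) g h i (X i w) =
    h (t j * X j w) * \prod_(i | i \notin j :: s) f i (X i w).
  rewrite (gE _ (fun i => if i == j then h (t j * X j w) else f i (X i w))); last 2 first.
  - by rewrite /g eqxx.
  - by move=> i /negPf ij; rewrite /g ij.
  rewrite eqxx; congr (_ * _); apply: eq_bigr => i.
  by rewrite inE negb_or => /andP[/negPf-> _].
have gI h : \prod_(i | i \notin s) \int[P]_w g h i (X i w) =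
    \int[P]_w h (t j * X j w) * \prod_(i | i \notin j :: s) \int[P]_w f i (X i w) :> R.
  rewrite (gE _ (fun i => if i == j then \int[P]_w h (t j * X j w) else
     \int[P]_w f i (X i w))); last 2 first.
  - by rewrite /g eqxx.
  - by move=> i /negPf ij; rewrite /g ij.
  rewrite eqxx; congr (_ * _); apply: eq_bigr => i.
  by rewrite inE negb_or => /andP[/negPf-> _].
have Icos := IH us _ c (gM _ (@cos_max R)) (gC _ (@continuous_cos R)).
have Isin := IH us _ (c - pi / 2) (gM _ (@sin_max R)) (gC _ (@continuous_sin R)).
rewrite gI ce in Icos; rewrite gI se mul0r mulr0 in Isin.
transitivity (\int[P]_w (cos (\sum_(i <- s) t i * X i w + c) *
       \prod_(i | i \notin s) g (@cos R) i (X i w)) -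
   \int[P]_w (cos (\sum_(i <- s) t i * X i w + (c - pi / 2)) *
       \prod_(i | i \notin s) g (@sin R) i (X i w)) : R); last first.
  by rewrite Icos Isin subr0 big_cons; ring.
have int h c' (h1 : forall x, `|h x| <= 1) (ch : continuous h) :
  P.-integrable setT (EFin \o (fun w => cos (\sum_(i <- s) t i * X i w + c') *
       \prod_(i | i \notin s) g h i (X i w))).
  apply: (@bounded_integrable _ _ _ P _ 1) => [|w].
    apply: measurable_funM.
      apply: (measurableT_comp (@measurable_cos R)).
      by apply: measurable_funD => //; apply: measurable_sum => i; exact: measurable_funM.
    under eq_fun do rewrite big_mkcond.
    apply: measurable_prod => i _; case: (i \notin s); last exact: measurable_cst.
    by apply: (measurableT_comp _ (mX i)); apply: continuous_measurable_fun; exact: gC.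
  rewrite normrM -[leRHS]mulr1 ler_pM ?cos_max// normr_prod.
  by apply: prodr_ile1 => i _; rewrite normr_ge0 gM.
rewrite -RintegralB//; last 2 first.
- by apply: int; [exact: cos_max|exact: continuous_cos].
- by apply: int; [exact: sin_max|exact: continuous_sin].
apply: eq_Rintegral => w _; rewrite !gX big_cons addrA cosBpihalf.
by rewrite -addrA cosD; ring.
Qed.

End independence.

(** * The normal law with variance 1 / 2 *)

Section fundamental_theorem.
Context (R : realType).
Local Notation leb := (@lebesgue_measure R).

Lemma integral_is_derive (F f : R -> R) (a b : R) : a < b ->
  (forall x : R, is_derive x 1 F (f x)) -> continuous f ->
  (\int[leb]_(x in `[a, b]) (f x)%:E = (F b - F a)%:E)%E.
Proof.
move=> ab dF cf; have cF : continuous F.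
  by move=> x; apply/differentiable_continuous/derivable1_diffP; case: (dF x).
rewrite (@continuous_FTC2 _ f F)//.
- exact: continuous_subspaceT.
- split=> [x _||]; first by case: (dF x).
  + by apply: cvg_at_right_filter; exact: cF.
  + by apply: cvg_at_left_filter; exact: cF.
- by move=> x _; rewrite derive1E; apply: derive_val.
Qed.

Lemma Rintegral_is_derive (F f : R -> R) (a b : R) : a < b ->
  (forall x : R, is_derive x 1 F (f x)) -> continuous f ->
  \int[leb]_(x in `[a, b]) f x = F b - F a :> R.
Proof. by move=> ab dF cf; rewrite /Rintegral (integral_is_derive ab dF cf). Qed.

Lemma integral_itv_cvg (f : R -> R) : leb.-integrable setT (EFin \o f) ->
  \int[leb]_(x in `[- n.+1%:R, n.+1%:R]) f x @[n --> \oo] --> \int[leb]_x f x.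
Proof.
move=> fi; pose f_ n := f \_ `[- n.+1%:R, n.+1%:R].
under eq_fun do rewrite Rintegral_mkcond.
have mf : measurable_fun setT f by apply/measurable_EFinP; exact: measurable_int fi.
apply: (proj2 (@dominated_cvg_Rintegral _ _ _ leb setT f_ f (fun x => `|f x|)
  measurableT _ _ _ _)).
- move=> n; apply/(measurable_restrictT _ _).1 => //; exact: measurable_funTS.
- move=> x _; apply: cvg_near_cst; near=> n; rewrite /f_ patchE ifT// inE/=.
  have : `|x| < n%:R by near: n; exact: nbhs_infty_gtr.
  rewrite in_itv/= ltr_norml => /andP[/ltW xl /ltW xr].
  have nn : n%:R <= n.+1%:R :> R by rewrite ler_nat.
  by rewrite (le_trans _ xl) ?lerN2// (le_trans xr).
- exact: integrable_norm fi.
- by move=> n x _; rewrite /f_ patchE; case: ifP => // _; rewrite normr0.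
Unshelve. all: by end_near. Qed.

End fundamental_theorem.

Section gaussian_integrals.
Context (R : realType).
Local Notation leb := (@lebesgue_measure R).
Implicit Types t c x : R.

Let half_gauss x : R := expR (- (x ^+ 2 / 2)).

Lemma gauss_funE x : gauss_fun x = half_gauss x * half_gauss x.
Proof. by rewrite /gauss_fun /half_gauss -expRD; congr expR; field. Qed.

Lemma integrable_half_gauss : leb.-integrable setT (EFin \o half_gauss).
Proof.
have := @integrable_normal_pdf R 0 1.
move=> /(integrableZl measurableT (normal_peak (1 : R))^-1).
apply: eq_integrable => // x _; rewrite normal_pdfE ?oner_neq0//.
rewrite -EFinM mulrA mulVf ?mul1r; last first.
  by rewrite gt_eqF// normal_peak_gt0// oner_neq0.
by rewrite /= /normal_fun /half_gauss subr0 expr1n mulNr.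
Qed.

Lemma integrable_poly_gauss (p : R -> R) C : measurable_fun setT p ->
  (forall x, `|p x| <= C * expR (x ^+ 2 / 2)) ->
  leb.-integrable setT (EFin \o (fun x => p x * gauss_fun x)).
Proof.
move=> mp pC; apply: (@le_integrable _ _ _ leb setT measurableT _
    (fun x => (C * half_gauss x)%:E)).
- apply/measurable_EFinP; apply: measurable_funM => //; exact: measurable_gauss_fun.
- move=> x _ /=; rewrite lee_fin normrM (ger0_norm (gauss_fun_ge0 _)) gauss_funE.
  rewrite mulrA [leRHS]ger0_norm; last first.
    rewrite mulr_ge0 ?expR_ge0//.
    by rewrite -(pmulr_lge0 _ (expR_gt0 (x ^+ 2 / 2))) (le_trans _ (pC x)).
  rewrite ler_wpM2r ?expR_ge0//.
  by rewrite /half_gauss expRN ler_pdivrMr ?expR_gt0.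
- under eq_fun do rewrite EFinM.
  exact: integrableZl integrable_half_gauss.
Qed.

Lemma integrable_bounded_gauss (p : R -> R) : measurable_fun setT p ->
  (forall x, `|p x| <= 1) ->
  leb.-integrable setT (EFin \o (fun x => p x * gauss_fun x)).
Proof.
move=> mp p1; apply: (@integrable_poly_gauss _ 1) => // x.
by rewrite mul1r (le_trans (p1 x))// (le_trans _ (expR_ge1Dx _))// lerDl divr_ge0// sqr_ge0.
Qed.

Lemma le_abs_exp_sqr x : `|x| <= expR (x ^+ 2 / 2).
Proof.
have := expR_ge1Dx (x ^+ 2 / 2); rewrite -real_normK ?num_real//.
by move: `|x| => y; nra.
Qed.

(** From y <= exp y at y = x ^ 2 / 8, raised to the power 4; the constant is
    written 8 ^ 4 since its value never matters. *)
Lemma le_pow8_exp_sqr x : `|x ^+ 8| <= 8 ^+ 4 * expR (x ^+ 2 / 2).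
Proof.
have -> : expR (x ^+ 2 / 2) = expR (x ^+ 2 / 8) ^+ 4.
  by rewrite -expRM_natl; congr expR; rewrite mulr_natl; field.
have x2 : 0 <= x ^+ 2 by exact: sqr_ge0.
have e8 : x ^+ 2 / 8 <= expR (x ^+ 2 / 8).
  by apply: le_trans (expR_ge1Dx _); rewrite lerDr.
have -> : x ^+ 8 = (x ^+ 2) ^+ 4 by rewrite -exprM.
rewrite ger0_norm; last exact: exprn_ge0.
have le8 : x ^+ 2 <= 8 * expR (x ^+ 2 / 8) by rewrite -ler_pdivrMl// mulrC.
by rewrite -exprMn; apply: lerXn2r => //; rewrite nnegrE// mulr_ge0// expR_ge0.
Qed.

(** Integrating the derivative of sin (t x + c) exp (- x ^ 2) over the line. *)
Lemma gauss_by_parts t c :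
  \int[leb]_x (x * sin (t * x + c) * gauss_fun x) =
  t / 2 * \int[leb]_x (cos (t * x + c) * gauss_fun x) :> R.
Proof.
pose F x := sin (t * x + c) * gauss_fun x.
pose f x := t * (cos (t * x + c) * gauss_fun x) - 2 * (x * sin (t * x + c) * gauss_fun x).
have dF (x : R) : is_derive x 1 F (f x).
  have dax : is_derive x 1 (fun x => t * x + c) t.
    by apply: is_derive_eq; rewrite /= addr0 [_ *: _]mulr1.
  have ds : is_derive x 1 (fun x => sin (t * x + c)) (cos (t * x + c) * t).
    exact: (@is_derive1_comp _ sin (fun x => t * x + c) x).
  have dg : is_derive x 1 (@gauss_fun R) (gauss_fun x * (- (2 * x))).
    have dx2 : is_derive x 1 (fun x : R => - x ^+ 2) (- (2 * x)).
      by apply: is_derive_eq; rewrite -[x%:A]/(x * 1); ring.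
    exact: (@is_derive1_comp _ expR (fun x => - x ^+ 2) x).
  apply: (@is_derive_eq _ _ _ _ _ _ _
   (sin (t * x + c) *: (gauss_fun x * (- (2 * x))) +
    gauss_fun x *: (cos (t * x + c) * t))).
    exact: is_deriveM.
  by rewrite /f -![_ *: _]/(_ * _); ring.
have clin : continuous (fun x : R => t * x + c).
  by move=> x; apply: cvgD; [apply: mulrl_continuous|exact: cvg_cst].
have csin : continuous (fun x : R => sin (t * x + c)).
  by move=> x; apply: continuous_comp; [exact: clin|exact: continuous_sin].
have ccos : continuous (fun x : R => cos (t * x + c)).
  by move=> x; apply: continuous_comp; [exact: clin|exact: continuous_cos].
have cf : continuous f.
  move=> x; apply: cvgB; apply: cvgM; try exact: cvg_cst.
  - by apply: cvgM; [exact: ccos|exact: continuous_gauss_fun].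
  - apply: cvgM; last exact: continuous_gauss_fun.
    by apply: cvgM; [exact: cvg_id|exact: csin].
have icos : leb.-integrable setT (EFin \o (fun x => cos (t * x + c) * gauss_fun x)).
  apply: integrable_bounded_gauss; first exact: continuous_measurable_fun.
  by move=> x; exact: cos_max.
have isin : leb.-integrable setT (EFin \o (fun x => x * sin (t * x + c) * gauss_fun x)).
  apply: (@integrable_poly_gauss _ 1).
    by apply: measurable_funM => //; exact: continuous_measurable_fun.
  move=> x; rewrite normrM mul1r -[leRHS]mulr1 ler_pM//; last exact: sin_max.
  exact: le_abs_exp_sqr.
have itc := integrableZl measurableT t icos.
have its := integrableZl measurableT 2 isin.
have fi : leb.-integrable setT (EFin \o f) := integrableB measurableT itc its.
have lim0 : \int[leb]_(x in `[- n.+1%:R, n.+1%:R]) f x @[n --> \oo] --> (0 : R).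
  have -> : (fun n : nat => \int[leb]_(x in `[- n.+1%:R, n.+1%:R]) f x) =
      (fun n : nat => F n.+1%:R - F (- n.+1%:R)).
    apply/funext => n; apply: Rintegral_is_derive => //.
    by rewrite (@lt_trans _ _ 0) ?oppr_lt0 ?ltr0n.
  rewrite -[X in _ --> X](subrr 0).
  have g0 : gauss_fun n.+1%:R @[n --> \oo] --> (0 : R).
    apply: (cvg_comp _ _ _ cvg_gauss_fun).
    apply/cvgryPge => A; near=> n; rewrite (@le_trans _ _ n%:R)// ?ler_nat//.
    by near: n; exact: nbhs_infty_ger.
  have F0 (r : nat -> R) : (forall n, gauss_fun (r n) = gauss_fun n.+1%:R :> R) ->
      F (r n) @[n --> \oo] --> (0 : R).
    move=> rE; apply: norm_cvg0; apply: (squeeze_cvgr _ (cvg_cst 0) g0).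
    near=> n; rewrite normr_ge0/= /F rE normrM (ger0_norm (gauss_fun_ge0 _)).
    by rewrite -[leRHS]mul1r ler_wpM2r ?gauss_fun_ge0 ?sin_max.
  apply: cvgB; apply: F0 => // n.
  by rewrite /gauss_fun sqrrN.
have /(cvg_unique (@Rhausdorff R) lim0) := integral_itv_cvg fi.
rewrite RintegralB// !RintegralZl// => /esym/eqP; rewrite subr_eq0 => /eqP E.
by rewrite mulrAC E mulrAC divff// mul1r.
Unshelve. all: by end_near. Qed.

Let char t c : R := \int[leb]_x (cos (t * x + c) * gauss_fun x).

(** Differentiation under the integral sign followed by the integration by parts
    gives the differential equation char' = - (t / 2) char. *)
Lemma is_derive_char t c : is_derive t 1 (char ^~ c) (- (t / 2) * char t c).
Proof.
pose f (t x : R) := cos (t * x + c) * gauss_fun x.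
pose f' (t x : R) := - (x * sin (t * x + c) * gauss_fun x).
have df (r x : R) : is_derive r 1 (f ^~ x) (f' r x).
  have dax : is_derive r 1 (fun t => t * x + c) x.
    have dx : is_derive r 1 (fun t => t * x) (x *: 1).
      under eq_fun do rewrite mulrC; exact: is_deriveZ.
    by apply: is_derive_eq; rewrite /= addr0 [_ *: _]mulr1.
  have dc : is_derive r 1 (fun t => cos (t * x + c)) (- sin (r * x + c) * x).
    exact: (@is_derive1_comp _ cos (fun t => t * x + c) r).
  have -> : f' r x = gauss_fun x * (- sin (r * x + c) * x) by rewrite /f'; ring.
  rewrite (_ : f ^~ x = fun t => gauss_fun x * cos (t * x + c)).
    exact: is_deriveZ.
  by apply/funext => u; rewrite /f mulrC.
have clin (r : R) : continuous (fun x : R => r * x + c).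
  by move=> x; apply: cvgD; [apply: mulrl_continuous|exact: cvg_cst].
have icos (r : R) : leb.-integrable setT (EFin \o f r).
  apply: integrable_bounded_gauss => [|x]; last exact: cos_max.
  apply: (measurableT_comp (@measurable_cos R)); exact: continuous_measurable_fun.
have ig : leb.-integrable setT (EFin \o (fun x => `|x| * gauss_fun x)).
  apply: (@integrable_poly_gauss _ 1) => [|x]; first by apply: continuous_measurable_fun; exact: norm_continuous.
  by rewrite mul1r normr_id le_abs_exp_sqr.
have tI : `]t - 1, t + 1[%classic t by rewrite /= in_itv/=; lra.
have d1f : partial1of2 f = f'.
  by apply/funext => r; apply/funext => x; rewrite partial1of2E; apply: derive_val.
have g0 x : 0 <= `|x| * gauss_fun x by rewrite mulr_ge0// gauss_fun_ge0.
have ub (r x : R) : `]t - 1, t + 1[%classic r -> setT x ->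
    `|partial1of2 f r x| <= `|x| * gauss_fun x.
  move=> _ _; rewrite d1f /f' normrN normrM (ger0_norm (gauss_fun_ge0 _)).
  rewrite ler_wpM2r ?gauss_fun_ge0// normrM -[leRHS]mulr1 ler_wpM2l//.
  exact: sin_max.
have dom := @derivable_under_integral R _ _ leb f setT measurableT t (t - 1) (t + 1)
  tI (fun r _ => icos r) (fun r x _ _ => @ex_derive _ _ _ _ _ _ _ (df r x)) _ g0 ig ub.
have val := @differentiation_under_integral R _ _ leb f setT measurableT t (t - 1) (t + 1)
  tI (fun r _ => icos r) (fun r x _ _ => @ex_derive _ _ _ _ _ _ _ (df r x)) _ g0 ig ub.
apply: DeriveDef => //; rewrite -derive1E val.
rewrite mulNr -gauss_by_parts d1f /f' -mulN1r -RintegralZl//.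
  by apply: eq_Rintegral => x _; rewrite mulN1r.
apply: (@integrable_poly_gauss _ 1) => [|x].
  apply: measurable_funM => //; apply: (measurableT_comp (@measurable_sin R)).
  exact: continuous_measurable_fun.
rewrite normrM mul1r -[leRHS]mulr1 ler_pM//; last exact: sin_max.
exact: le_abs_exp_sqr.
Qed.

Lemma integral_cos_gauss t c : \int[leb]_x (cos (t * x + c) * gauss_fun x) =
  Num.sqrt pi * (expR (- (t ^+ 2 / 4)) * cos c) :> R.
Proof.
pose h t := char t c * expR (t ^+ 2 / 4).
have dh (r : R) : is_derive r 1 h 0.
  have de : is_derive r 1 (fun t : R => expR (t ^+ 2 / 4)) (expR (r ^+ 2 / 4) * (r / 2)).
    have dx2 : is_derive r 1 (fun t : R => t ^+ 2 / 4) (r / 2).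
      rewrite (_ : (fun t : R => t ^+ 2 / 4) = fun t : R => 4^-1 *: t ^+ 2).
        by apply: is_derive_eq; rewrite -[r%:A]/(r * 1) -[_ *: _]/(_ * _); field.
      by apply/funext => u; rewrite mulrC.
    exact: (@is_derive1_comp _ expR (fun t : R => t ^+ 2 / 4) r).
  have dc := is_derive_char r c.
  apply: (@is_derive_eq _ _ _ _ _ _ _ (char r c *: (expR (r ^+ 2 / 4) * (r / 2)) +
     expR (r ^+ 2 / 4) *: (- (r / 2) * char r c))).
    exact: is_deriveM.
  by rewrite -![_ *: _]/(_ * _); ring.
have /(_ t 0) : forall x y, h x = h y by move=> x y; exact: is_derive_0_is_cst.
rewrite /h expr0n mul0r expR0 mulr1 => E.
rewrite -[LHS]/(char t c).
have -> : char t c = char 0 c * expR (- (t ^+ 2 / 4)).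
  by rewrite -E -mulrA -expRD subrr expR0 mulr1.
have -> : char 0 c = Num.sqrt pi * cos c.
  rewrite /char; under eq_Rintegral do rewrite mul0r add0r.
  rewrite RintegralZl//; last exact: integrableT_gauss.
  by rewrite mulrC /Rintegral integralT_gauss.
by ring.
Qed.

Let nu := @normal_prob R 0 (Num.sqrt 2^-1).

Lemma normal_pdf_gauss x :
  normal_pdf 0 (Num.sqrt 2^-1) x = (Num.sqrt pi)^-1 * gauss_fun x.
Proof.
rewrite normal_pdfE ?gt_eqF ?sqrtr_gt0 ?invr_gt0//.
rewrite /normal_peak /normal_fun /gauss_fun subr0 sqr_sqrtr ?invr_ge0//.
have h2 : 2^-1 *+ 2 = 1 :> R by field.
by rewrite -mulrnAl h2 mul1r divr1.
Qed.

Lemma integral_normal_prob (f : R -> R) : nu.-integrable setT (EFin \o f) ->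
  (\int[nu]_x (f x)%:E = \int[leb]_x (f x * ((Num.sqrt pi)^-1 * gauss_fun x))%:E)%E.
Proof.
move=> fi; have mf := measurable_int _ fi.
have dom : nu `<< leb := @normal_prob_dominates R 0 (Num.sqrt 2^-1).
transitivity (\int[leb]_x ((f x)%:E * (normal_pdf 0 (Num.sqrt 2^-1) x)%:E))%E; last first.
  by apply: eq_integral => x _; rewrite -EFinM normal_pdf_gauss.
have mpdf : measurable_fun setT (fun x => (normal_pdf 0 (Num.sqrt 2^-1) x : R)%:E).
  by apply/measurable_EFinP; exact: measurable_normal_pdf.
rewrite -(Radon_Nikodym_change_of_variables dom)//.
apply: ae_eq_integral => //.
- exact: emeasurable_funM.
- exact: emeasurable_funM.
- apply: ae_eqe_mul2l => /=.
  rewrite Radon_NikodymE//=; case: cid => /= h [h1 h2 h3].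
  apply: integral_ae_eq => //=.
  + by move=> E E01 mE; rewrite -h3.
Qed.

Section random_variable.
Context d (Omega : measurableType d) (P : probability Omega R).
Variable X : Omega -> R.
Hypothesis gX : gaussian_rv P 0 (Num.sqrt 2^-1) X.

Lemma bounded_gaussian_mean (f : R -> R) (M : R) : measurable_fun setT f ->
  (forall x, `|f x| <= M) ->
  \int[P]_w f (X w) = (Num.sqrt pi)^-1 * \int[leb]_x (f x * gauss_fun x) :> R.
Proof.
move=> mf fM; have [mX XA] := gX.
have mfX : measurable_fun setT (f \o X) by exact: measurableT_comp.
have fnu : nu.-integrable setT (EFin \o f) by exact: (bounded_integrable nu mf fM).
pose Y : Omega -> g_sigma_algebraType (R.-ocitv.-measurable) := X.
have mY : measurable_fun setT Y by exact: mX.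
pose mY' := isMeasurableFun.Build _ _ _ _ _ mY.
pose Y' : {mfun Omega >-> g_sigma_algebraType (R.-ocitv.-measurable)} := HB.pack Y mY'.
have -> : \int[P]_w f (X w) = fine (\int[distribution P Y']_x (f x)%:E).
  rewrite integral_distribution//; first exact/measurable_EFinP.
  exact: (@bounded_integrable _ _ _ P _ M).
have -> : (\int[distribution P Y']_x (f x)%:E = \int[nu]_x (f x)%:E)%E.
  by apply: eq_measure_integral => A mA _; exact: XA.
rewrite integral_normal_prob// -RintegralZl//.
  by rewrite /Rintegral; congr fine; apply: eq_integral => x _; rewrite mulrCA.
have ig : leb.-integrable setT (EFin \o (fun x => M * gauss_fun x)).
  exact: (integrableZl measurableT M (@integrableT_gauss R)).
apply: le_integrable ig => //.
  apply/measurable_EFinP; apply: measurable_funM => //; exact: measurable_gauss_fun.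
move=> x _; rewrite /= lee_fin !normrM ler_wpM2r//.
by rewrite (le_trans (fM x))// ler_norm.
Qed.

Lemma gaussian_cos_mean t c :
  \int[P]_w cos (t * X w + c) = expR (- (t ^+ 2 / 4)) * cos c :> R.
Proof.
rewrite (@bounded_gaussian_mean (fun x => cos (t * x + c)) 1); last 2 first.
- apply: (measurableT_comp (@measurable_cos R)).
  by apply: measurable_funD => //; exact: measurable_funM.
- by move=> x; exact: cos_max.
rewrite integral_cos_gauss mulrA mulVf ?mul1r//.
by rewrite gt_eqF// sqrtr_gt0 pi_gt0.
Qed.

Lemma gaussian_sin_mean t : \int[P]_w sin (t * X w) = 0 :> R.
Proof.
have := gaussian_cos_mean t (- (pi / 2)).
rewrite -[X in cos X]add0r cosBpihalf sin0 mulr0 => <-.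
by apply: eq_Rintegral => w _; rewrite cosBpihalf.
Qed.

(** Only a finite upper bound is needed.  It is obtained by monotone convergence
    from the truncations min (x ^ 8, k), to which bounded_gaussian_mean applies. *)
Lemma gaussian_moment8 : (\int[P]_w (X w ^+ 8)%:E <=
  ((Num.sqrt pi)^-1 * (8 ^+ 4 * \int[leb]_x expR (- (x ^+ 2 / 2)))%R)%:E)%E.
Proof.
have [mX XA] := gX; set K := _ * _.
pose f k (x : R) := Num.min (x ^+ 8) k%:R.
have x8 (x : R) : 0 <= x ^+ 8 by rewrite exprn_even_ge0.
have mf k : measurable_fun setT (f k).
  by apply: measurable_minr => //; exact: measurable_funX.
have fb k x : `|f k x| <= k%:R.
  by rewrite ger0_norm ?ge_min ?lexx ?orbT// le_min x8 ler0n.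
have fK k : (\int[P]_w (f k (X w))%:E <= K%:E)%E.
  rewrite (@bounded_integral_EFin _ _ _ _ _ k%:R) => [||w]; last exact: fb.
    rewrite lee_fin (bounded_gaussian_mean (mf k) (fb k)) ler_wpM2l//.
    rewrite -RintegralZl//; last exact: integrable_half_gauss.
    have fe (x : R) : f k x <= 8 ^+ 4 * expR (x ^+ 2 / 2).
      by apply: le_trans (le_pow8_exp_sqr x); rewrite ge_min ler_norm.
    apply: le_Rintegral => //.
    - apply: (@integrable_poly_gauss _ (8 ^+ 4)) => // x.
      rewrite ger0_norm; first exact: fe.
      by rewrite le_min x8 ler0n.
    - exact: (integrableZl measurableT (8 ^+ 4) integrable_half_gauss).
    - move=> x _; rewrite gauss_funE mulrA ler_wpM2r ?expR_ge0//.
      by rewrite /half_gauss expRN ler_pdivrMr ?expR_gt0.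
  exact: measurableT_comp.
have lim : (fun w => limn (fun k => (f k (X w))%:E)) = fun w => (X w ^+ 8)%:E.
  apply/funext => w; apply/cvg_lim => //; apply: cvg_near_cst; near=> k.
  congr (_%:E); apply/min_idPl/ltW; near: k; exact: nbhs_infty_gtr.
rewrite -lim monotone_convergence//.
- apply: lime_le; last exact: nearW.
  apply: ereal_nondecreasing_is_cvgn => k l kl; apply: ge0_le_integral => //.
  + by move=> w _; rewrite lee_fin le_min x8 ler0n.
  + by apply/measurable_EFinP; exact: measurableT_comp.
  + by apply/measurable_EFinP; exact: measurableT_comp.
  + move=> w _; rewrite lee_fin /f le_min ge_min lexx/= ge_min ler_nat kl orbT//.
- by move=> k; apply/measurable_EFinP; exact: measurableT_comp.
- by move=> k w _; rewrite lee_fin le_min x8 ler0n.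
- by move=> w _ k l kl; rewrite lee_fin /f le_min ge_min lexx/= ge_min ler_nat kl orbT.
Unshelve. all: by end_near. Qed.

End random_variable.

End gaussian_integrals.

(** * Trigonometric polynomials on the torus *)

Section trigonometric_modes.
Context (R : realType).
Local Notation leb := (@lebesgue_measure R).
Implicit Types (n m : nat) (b c : bool) (x y : R) (k : int).

Lemma sinD2pi_int k y : sin (y + 2 * pi * k%:~R) = sin y.
Proof.
rewrite mulr_natl; case: k => m.
  by rewrite -pmulrn mulr_natr (periodicn (@sinD2pi R)).
rewrite NegzE mulrNz -pmulrn mulrN mulr_natr.
by rewrite -[y in RHS](subrK (pi *+ 2 *+ m.+1)) (periodicn (@sinD2pi R)).
Qed.

Lemma continuous_affine (a c : R) : continuous (fun x : R => a * x + c).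
Proof. by move=> x; apply: cvgD; [exact: mulrl_continuous|exact: cvg_cst]. Qed.

Lemma continuous_cos_affine (a c : R) : continuous (fun x => cos (a * x + c)).
Proof.
move=> x; apply: (continuous_comp (f := fun x => a * x + c)).
  exact: continuous_affine.
exact: continuous_cos.
Qed.

Lemma torus_integrable (h : R -> R) : continuous h ->
  leb.-integrable `[0, 1] (EFin \o h).
Proof.
move=> ch; apply: continuous_compact_integrable; first exact: segment_compact.
exact: continuous_subspaceT.
Qed.

Lemma torus_integral_cos k (c : R) : k != 0 ->
  torus_integral (fun x => cos (2 * pi * k%:~R * x + c)) = 0.
Proof.
move=> k0; set a := 2 * pi * k%:~R.
have a0 : a != 0.
  by rewrite /a mulf_neq0 ?intr_eq0// mulf_neq0// gt_eqF// pi_gt0.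
pose F x := a^-1 * sin (a * x + c).
have dF x : is_derive x 1 F (cos (a * x + c)).
  have dax : is_derive x 1 (fun x => a * x + c) a.
    by apply: is_derive_eq; rewrite /= addr0 [_ *: _]mulr1.
  have ds : is_derive x 1 (fun x => sin (a * x + c)) (cos (a * x + c) * a).
    exact: (@is_derive1_comp _ sin (fun x => a * x + c) x).
  have -> : cos (a * x + c) = a^-1 * (cos (a * x + c) * a) by field.
  exact: is_deriveZ.
rewrite /torus_integral (Rintegral_is_derive ltr01 dF (@continuous_cos_affine a c)).
by rewrite /F mulr1 mulr0 add0r (addrC a) sinD2pi_int subrr.
Qed.

(** Frequencies start at 1, since distributions of mean zero have no constant
    mode. *)
Definition mode n b : testfun R := if b then cos_test n.+1 else sin_test n.+1.

(** A sine is a shifted cosine, which halves the number of product formulas. *)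
Definition phase b : R := if b then 0 else - (pi / 2).

Lemma modeE n b x : mode n b x = cos (2 * pi * (n.+1%:Z)%:~R * x + phase b).
Proof. by case: b; rewrite /mode /= ?addr0// cosBpihalf. Qed.

Lemma mode_continuous n b : continuous (mode n b : R -> R).
Proof.
have -> : (mode n b : R -> R) = fun x => cos (2 * pi * (n.+1%:Z)%:~R * x + phase b).
  by apply/funext => x; rewrite modeE.
exact: continuous_cos_affine.
Qed.

Lemma mode_le1 n b x : `|mode n b x| <= 1.
Proof. by rewrite modeE cos_max. Qed.

Lemma torus_integral_mode n b : torus_integral (mode n b) = 0.
Proof.
rewrite -(torus_integral_cos (k := n.+1) (phase b))//.
by apply: eq_Rintegral => x _; rewrite modeE.
Qed.

Lemma torus_integral_cst (r : R) : torus_integral (cst r) = r.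
Proof.
have E : @lebesgue_measure R `[0, 1]%classic = 1%E.
  by rewrite lebesgue_measure_itv/= lte_fin ltr01 oppr0 adde0.
by rewrite /torus_integral Rintegral_cst// [fine _](congr1 fine E) mulr1.
Qed.

Lemma torus_integralD (f g : R -> R) : continuous f -> continuous g ->
  torus_integral (fun x => f x + g x) = torus_integral f + torus_integral g.
Proof. by move=> cf cg; rewrite /torus_integral RintegralD//; exact: torus_integrable. Qed.

Lemma torus_integralZ (a : R) (f : R -> R) : continuous f ->
  torus_integral (fun x => a * f x) = a * torus_integral f.
Proof. by move=> cf; rewrite /torus_integral RintegralZl//; exact: torus_integrable. Qed.

Lemma continuous_sum (J : Type) (s : seq J) (f : J -> R -> R) :
  (forall j, continuous (f j)) -> continuous (fun x => \sum_(j <- s) f j x).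
Proof.
move=> cf; elim: s => [|j s IH] x.
  by under eq_fun do rewrite big_nil; exact: cvg_cst.
under eq_fun do rewrite big_cons.
by apply: cvgD; [exact: cf|exact: IH].
Qed.

Lemma torus_integral_sum (J : Type) (s : seq J) (f : J -> R -> R) :
  (forall j, continuous (f j)) ->
  torus_integral (fun x => \sum_(j <- s) f j x) =
  \sum_(j <- s) torus_integral (f j).
Proof.
move=> cf; elim: s => [|j s IH].
  rewrite big_nil /torus_integral; under eq_Rintegral do rewrite big_nil.
  by rewrite Rintegral_cst// mul0r.
rewrite big_cons -IH -torus_integralD//; last exact: continuous_sum.
by apply: eq_Rintegral => x _; rewrite big_cons.
Qed.

Lemma torus_integral_modeM n b m c :
  torus_integral (fun x => mode n b x * mode m c x) =
  2^-1 * ((n, b) == (m, c))%:R.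
Proof.
have E x : mode n b x * mode m c x =
    2^-1 * (cos (2 * pi * (n.+1%:Z + m.+1%:Z)%:~R * x + (phase b + phase c)) +
            cos (2 * pi * (n%:Z - m%:Z)%:~R * x + (phase b - phase c))).
  rewrite !modeE; set A := _ * x + phase b; set B := _ * x + phase c.
  have -> : 2 * pi * (n.+1%:Z + m.+1%:Z)%:~R * x + (phase b + phase c) = A + B.
    by rewrite /A /B rmorphD /=; ring.
  have -> : 2 * pi * (n%:Z - m%:Z)%:~R * x + (phase b - phase c) = A - B.
    have -> : n%:Z - m%:Z = n.+1%:Z - m.+1%:Z by rewrite !intS; ring.
    by rewrite /A /B rmorphB /=; ring.
  by clearbody A B; rewrite cosD cosB; field.
rewrite /torus_integral; under eq_Rintegral do rewrite E.
rewrite -/(torus_integral _) torus_integralZ; last first.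
  by move=> x; apply: cvgD; exact: continuous_cos_affine.
rewrite torus_integralD; try exact: continuous_cos_affine.
rewrite torus_integral_cos// add0r; congr (_ * _).
rewrite xpair_eqE; have [<-|nm] := eqVneq n m; last first.
  by rewrite torus_integral_cos// subr_eq0 eqz_nat.
rewrite /torus_integral; under eq_Rintegral do rewrite subrr mulr0 mul0r add0r.
rewrite -/(torus_integral _) torus_integral_cst.
by case: b c {E} => [] []; rewrite /phase /= ?subrr ?cos0// ?sub0r ?opprK ?subr0 ?cosN cos_pihalf.
Qed.

Section trigonometric_polynomial.
Context (N : nat).
Implicit Type t : 'I_N * bool -> R.

Definition trig_poly t x : R := \sum_j t j * mode j.1 j.2 x.

Lemma trig_poly_continuous t : continuous (trig_poly t).
Proof.
apply: continuous_sum => j x; apply: cvgM; first exact: cvg_cst.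
exact: mode_continuous.
Qed.

Lemma torus_integral_trig_poly t : torus_integral (trig_poly t) = 0.
Proof.
have cm (j : 'I_N * bool) : continuous (fun x => t j * mode j.1 j.2 x).
  by move=> x; apply: cvgM; [exact: cvg_cst|exact: mode_continuous].
rewrite torus_integral_sum// big1// => j _.
by rewrite torus_integralZ ?torus_integral_mode ?mulr0//; exact: mode_continuous.
Qed.

Lemma torus_integral_trig_polyM t (f : R -> R) : continuous f ->
  torus_integral (fun x => trig_poly t x * f x) =
  \sum_j t j * torus_integral (fun x => mode j.1 j.2 x * f x).
Proof.
move=> cf.
have cmf n b : continuous (fun x => mode n b x * f x).
  by move=> x; apply: cvgM; [exact: mode_continuous|exact: cf].
transitivity (torus_integral (fun x => \sum_j t j * (mode j.1 j.2 x * f x))).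
  apply: eq_Rintegral => x _; rewrite mulr_suml.
  by apply: eq_bigr => j _; rewrite mulrA.
rewrite torus_integral_sum => [|j]; last first.
  by move=> x; apply: cvgM; [exact: cvg_cst|exact: cmf].
by apply: eq_bigr => j _; rewrite torus_integralZ.
Qed.

Lemma torus_integral_trig_poly_mode t n b :
  torus_integral (fun x => trig_poly t x * mode n b x) =
  2^-1 * \sum_(j : 'I_N * bool | (nat_of_ord j.1, j.2) == (n, b)) t j.
Proof.
rewrite torus_integral_trig_polyM; last exact: mode_continuous.
rewrite mulr_sumr [RHS]big_mkcond; apply: eq_bigr => j _.
rewrite torus_integral_modeM; case: eqP => _; rewrite ?mulr1 ?mulr0//.
by rewrite mulrC.
Qed.

Lemma parseval t :
  torus_integral (fun x => trig_poly t x ^+ 2) = 2^-1 * \sum_j t j ^+ 2.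
Proof.
transitivity (torus_integral (fun x => trig_poly t x * trig_poly t x)).
  by apply: eq_Rintegral => x _; rewrite expr2.
rewrite torus_integral_trig_polyM; last exact: trig_poly_continuous.
rewrite mulr_sumr; apply: eq_bigr => -[i b] _ /=.
transitivity (t (i, b) * torus_integral (fun x => trig_poly t x * mode i b x)).
  by congr (_ * _); apply: eq_Rintegral => x _; rewrite mulrC.
rewrite torus_integral_trig_poly_mode (big_pred1 (i, b)) => [|[j c]]; first by rewrite /= expr2; ring.
by rewrite /= xpair_eqE.
Qed.

End trigonometric_polynomial.

End trigonometric_modes.

(** * Fourier coordinates of distributions and Sobolev spaces *)

Section fourier_coordinates.
Context (R : realType).
Implicit Types (u v : torus_distribution R) (n N : nat) (b : bool).

Definition coord u n b : R := u (mode R n b).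

Lemma testfun_continuous (f : testfun R) : continuous (f : R -> R).
Proof.
case: f => f /asboolP[_ sf] x /=.
by apply/differentiable_continuous/derivable1_diffP; exact: (sf 0%N).
Qed.

Lemma fourier_coef_coord u n :
  fourier_coef u n.+1 = (coord u n true -i* coord u n false)%C.
Proof. by []. Qed.

Lemma cos_testN n : cos_test (- n%:Z) = cos_test n :> testfun R.
Proof.
apply: val_inj; apply/funext => x /=.
by rewrite mulrNz mulrN mulNr cosN.
Qed.

Lemma sin_testN n : sin_test (- n%:Z) = - sin_test n :> testfun R.
Proof.
apply: val_inj; apply/funext => x /=.
by rewrite mulrNz mulrN mulNr sinN.
Qed.

Lemma fourier_coef_coordN u n :
  fourier_coef u (- n.+1%:Z) = (coord u n true +i* coord u n false)%C.
Proof.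
rewrite /fourier_coef cos_testN sin_testN.
by have /= -> := raddfN u (sin_test n.+1); rewrite opprK.
Qed.

Lemma fourier_mode (f : testfun R) n : fourier f n.+1 =
  (torus_integral (fun x => f x * mode R n true x) -i*
   torus_integral (fun x => f x * mode R n false x))%C.
Proof. by []. Qed.

Lemma fourier_modeN (f : testfun R) n : fourier f (- n.+1%:Z) =
  (torus_integral (fun x => f x * mode R n true x) +i*
   torus_integral (fun x => f x * mode R n false x))%C.
Proof.
rewrite /fourier; congr (_ +i* _)%C.
  by apply: eq_Rintegral => x _; rewrite mulrNz mulrN mulNr cosN.
rewrite -mulN1r -torus_integralZ; last first.
  move=> x; apply: cvgM; first exact: testfun_continuous.
  exact: testfun_continuous (sin_test (- n.+1%:Z)) x.
apply: eq_Rintegral => x _.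
have -> : sin (2 * pi * (- n.+1%:Z)%:~R * x) = - mode R n false x.
  by rewrite mulrNz mulrN mulNr sinN.
by rewrite mulrN mulN1r opprK.
Qed.

(** The partial Fourier sum: frequency n contributes the conjugate terms of
    indices n and - n, whence the factor 2. *)
Definition partial_sum u N : R -> R :=
  trig_poly (fun j : 'I_N * bool => 2 * coord u j.1 j.2).

Lemma partial_sumE u N x :
  partial_sum u N x = \sum_(n < N) \sum_b 2 * coord u n b * mode R n b x.
Proof. by rewrite (pair_bigA _ (fun (n : 'I_N) b => 2 * coord u n b * mode R n b x)). Qed.

Lemma fourier_partial_sum u (f : testfun R) N :
  \sum_(1 <= n < N.+1)
    complex.Re (fourier_coef u n * fourier f (- n%:Z)
        + fourier_coef u (- n%:Z) * fourier f n) =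
  torus_integral (fun x => partial_sum u N x * f x).
Proof.
rewrite torus_integral_trig_polyM; last exact: testfun_continuous.
rewrite -(pair_bigA _ (fun (n : 'I_N) b => 2 * coord u n b *
  torus_integral (fun x => mode R n b x * f x))).
rewrite big_add1 succnK big_mkord; apply: eq_bigr => n _.
rewrite fourier_coef_coord fourier_coef_coordN fourier_mode fourier_modeN.
have fm b : torus_integral (fun x => mode R n b x * f x) =
    torus_integral (fun x => f x * mode R n b x).
  by apply: eq_Rintegral => x _; rewrite mulrC.
by rewrite big_bool !fm /=; ring.
Qed.

Lemma is_fourier_sumE u : is_fourier_sum u <-> forall f : testfun R,
  torus_integral (fun x => partial_sum u N x * f x) @[N --> \oo] --> u f.
Proof.
split=> H f; last by have := H f; under eq_fun do rewrite -fourier_partial_sum.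
by have := H f; under eq_fun do rewrite fourier_partial_sum.
Qed.

End fourier_coordinates.

Section sobolev_norm.
Context (R : realType) (s : R).
Implicit Types (u v : sobolev R s) (n N : nat) (b : bool).

Definition weight n : R := 2 * n.+1%:R `^ (2 * s).

Lemma weight_ge0 n : 0 <= weight n.
Proof. by rewrite mulr_ge0// powR_ge0. Qed.

Lemma weight_gt0 n : 0 < weight n.
Proof. by rewrite mulr_gt0// powR_gt0. Qed.

Lemma normc_sqr (a b : R) : Normc.normc (a +i* b)%C ^+ 2 = a ^+ 2 + b ^+ 2.
Proof. by rewrite sqr_sqrtr// addr_ge0 ?sqr_ge0. Qed.

(** Each frequency is counted twice in the norm, once for n and once for - n. *)
Lemma sobolev_sqnorm_conj (c : int -> R[i]) :
  (forall n, c (- n.+1%:Z) = (c n.+1)^*%C) ->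
  sobolev_sqnorm s c =
  (\sum_(n <oo) (weight n * Normc.normc (c n.+1) ^+ 2)%:E)%E.
Proof.
move=> cN; rewrite /sobolev_sqnorm; set a := (fun n : int => _%:E).
have a0 (n : int) : (0 <= a n)%E by rewrite lee_fin mulr_ge0 ?powR_ge0 ?sqr_ge0.
rewrite (esumID [set n : int | 0 < n]) => [|n _]; last exact: a0.
have -> : [set n : int | n != 0] `&` [set n | 0 < n] =
    [set n.+1%:Z | n in [set: nat]].
  apply/seteqP; split=> [n [_ /=]|_ [n _ <-]//].
  by case: n => // -[//|n] _; exists n.
have -> : [set n : int | n != 0] `&` ~` [set n | 0 < n] =
    [set - n.+1%:Z | n in [set: nat]].
  apply/seteqP; split=> [n [/= n0 nn]|_ [n _ <-]//].
  by case: n n0 nn => [[//|n] _ []//|n] _ _; exists n.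
rewrite !esum_image; try by move=> m n _ _ [].
rewrite -esumD => [|n _|n _]; try exact: a0.
rewrite -nneseries_esumT => [|n]; last first.
  by apply: adde_ge0; [exact: (a0 n.+1)|exact: (a0 (- n.+1%:Z))].
apply: eq_eseriesr => n _; rewrite /a -EFinD abszN cN.
have -> : Normc.normc (c n.+1)^*%C = Normc.normc (c n.+1).
  by case: (c n.+1) => x y; rewrite /= sqrrN.
by congr (_%:E); rewrite /weight /=; ring.
Qed.

Lemma sobolev_sqnorm_coordB (u v : torus_distribution R) :
  sobolev_sqnorm s (fun n : int => fourier_coef u n - fourier_coef v n) =
  (\sum_(n <oo) (weight n * \sum_b (coord u n b - coord v n b) ^+ 2)%:E)%E.
Proof.
rewrite sobolev_sqnorm_conj => [|n]; last first.
  by rewrite !fourier_coef_coordN !fourier_coef_coord rmorphB /= !opprK.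
apply: eq_eseriesr => n _; congr (_ * _)%:E.
rewrite !fourier_coef_coord big_bool.
rewrite -[X in Normc.normc X]/(((coord u n true - coord v n true) +i*
  (- coord u n false - - coord v n false))%C) normc_sqr.
by rewrite -opprD sqrrN.
Qed.

Lemma sobolev_dist_sqr u v :
  ((sobolev_dist u v ^+ 2)%:E =
   \sum_(n <oo) (weight n * \sum_b (coord u n b - coord v n b) ^+ 2)%:E)%E.
Proof.
rewrite -sobolev_sqnorm_coordB -(fineK (sobolev_sqnormB_fin u v)).
by rewrite /sobolev_dist sqr_sqrtr// fine_ge0// sobolev_sqnorm_ge0.
Qed.

Lemma coord_le_dist u v n b :
  `|coord u n b - coord v n b| <= sobolev_dist u v / Num.sqrt (weight n).
Proof.
rewrite ler_pdivlMr ?sqrtr_gt0 ?weight_gt0//.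
rewrite -ler_sqr ?nnegrE ?mulr_ge0 ?sqrtr_ge0// exprMn sqr_sqrtr ?weight_ge0//.
rewrite real_normK ?num_real// -lee_fin sobolev_dist_sqr.
have q0 k : 0 <= \sum_b (coord u k b - coord v k b) ^+ 2 :> R.
  by apply: sumr_ge0 => c _; exact: sqr_ge0.
pose e k := (weight k * \sum_b (coord u k b - coord v k b) ^+ 2)%:E.
have e0 k : (0 <= e k)%E by rewrite lee_fin mulr_ge0 ?weight_ge0.
apply: (@le_trans _ _ (e n)).
  rewrite lee_fin mulrC ler_wpM2l ?weight_ge0// (bigD1 b)//= lerDl.
  by apply: sumr_ge0 => c _; exact: sqr_ge0.
have := @nneseries_lim_ge R e xpredT 0 n.+1 (fun k _ _ => e0 k).
rewrite big_nat_recr//=; apply: le_trans.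
by rewrite leeDr// sume_ge0.
Qed.

Lemma lipschitz_continuous (phi : sobolev R s -> R) (L : R) :
  (forall u v, `|phi u - phi v| <= L * sobolev_dist u v) -> continuous phi.
Proof.
move=> philip u; have FF : Filter (nbhs u) := nbhs_filter u.
apply/cvgrPdist_lt => e e0.
have L0 : 0 < `|L| + 1 by rewrite ltr_wpDl.
have r0 : 0 < e / (`|L| + 1) by rewrite divr_gt0.
apply: filterS (nbhsx_ballx u _ r0) => v; rewrite ballEmdist/= => uv.
apply: (le_lt_trans (philip u v)).
rewrite ltr_pdivlMr// mulrC in uv; apply: le_lt_trans uv.
by rewrite ler_wpM2r ?sqrtr_ge0// (le_trans (ler_norm L))// lerDl.
Qed.

Lemma continuous_borel (T : ptopologicalType) (phi : T -> R) : continuous phi ->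
  measurable_fun setT (phi : borel T -> R).
Proof.
move=> /continuousP cphi; apply: (measurability _ (RGenOpens.measurableE R)).
move=> _ [_ [a [b ->] <-]]; rewrite setTI; apply: sub_sigma_algebra.
exact/cphi/interval_open.
Qed.

Lemma coord_continuous n b : continuous (fun u : sobolev R s => coord u n b).
Proof.
apply: (@lipschitz_continuous _ (Num.sqrt (weight n))^-1) => u v.
by rewrite mulrC; exact: coord_le_dist.
Qed.

End sobolev_norm.

Lemma eseries_finite (R : realType) (e : nat -> \bar R) N :
  (forall n, (N <= n)%N -> e n = 0%E) ->
  (\sum_(n <oo) e n = \sum_(n < N) e n)%E.
Proof.
move=> e0; apply/cvg_lim => //; apply: cvg_near_cst; near=> M.
have NM : (N <= M)%N by near: M; exact: nbhs_infty_ge.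
rewrite (big_cat_nat (n := N))//= big_mkord [X in (_ + X)%E]big1_seq ?adde0// => n.
by rewrite mem_index_iota => /andP[_ /andP[/e0]].
Unshelve. all: by end_near. Qed.

Section trigonometric_distribution.
Context (R : realType) (N : nat) (t : nat -> bool -> R).
Let T : R -> R := trig_poly (fun j : 'I_N * bool => t j.1 j.2).

(** Trigonometric polynomials as elements of every Sobolev space; they are the
    values of the truncation map. *)
Definition trig_pairing (f : testfun R) : R^o := torus_integral (fun x => T x * f x).

Let cT : continuous T. Proof. exact: trig_poly_continuous. Qed.

Lemma trig_pairing_linear : linear trig_pairing.
Proof.
move=> a f g; rewrite /trig_pairing.
rewrite -[a *: torus_integral _]/(a * torus_integral _).
have cTf (h : testfun R) : continuous (fun x => T x * h x).
  by move=> x; apply: cvgM; [exact: cT|exact: testfun_continuous].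
rewrite -torus_integralZ// -torus_integralD//; last first.
  by move=> x; apply: cvgM; [exact: cvg_cst|exact: cTf].
by apply: eq_Rintegral => x _ /=; rewrite mulrDr mulrCA.
Qed.

Lemma trig_pairing_continuous : exists (K : nat) (C : R),
  forall (f : testfun R) (M : R),
    (forall k x, (k <= K)%N -> `|derive1n k f x| <= M) -> `|trig_pairing f| <= C * M.
Proof.
exists 0%N, (\sum_(j : 'I_N * bool) `|t j.1 j.2|) => f M fM.
have fM0 x : `|f x| <= M by exact: (fM 0%N).
have TC x : `|T x| <= \sum_(j : 'I_N * bool) `|t j.1 j.2|.
  rewrite (le_trans (ler_norm_sum _ _ _))// ler_sum// => j _.
  by rewrite normrM -[leRHS]mulr1 ler_wpM2l// mode_le1.
have cTf : continuous (fun x => T x * f x).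
  by move=> x; apply: cvgM; [exact: cT|exact: testfun_continuous].
apply: le_trans (le_normr_Rintegral _ _) _ => //; first exact: torus_integrable.
rewrite -[leRHS]torus_integral_cst; apply: le_Rintegral => //.
- apply: (torus_integrable (h := fun x => `|T x * f x|)) => x.
  by apply: cvg_norm; exact: cTf.
- apply: (torus_integrable (h := cst _)) => x; exact: cvg_cst.
- by move=> x _; rewrite /= normrM ler_pM.
Qed.

Definition trig_distribution : torus_distribution R :=
  TorusDistribution trig_pairing_linear trig_pairing_continuous.

Lemma coord_trig_distribution n b :
  coord trig_distribution n b = if (n < N)%N then t n b / 2 else 0.
Proof.
rewrite /coord /= /trig_pairing /T torus_integral_trig_poly_mode.
case: ifPn => [nN|nN].
  rewrite (big_pred1 (Ordinal nN, b)) => [|[j c]]; first by rewrite /= mulrC.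
  by rewrite /= !xpair_eqE.
rewrite big_pred0 ?mulr0// => -[j c] /=; rewrite xpair_eqE.
by apply: contraNF nN => /andP[/eqP <-].
Qed.

Lemma partial_sum_trig_distribution M : (N <= M)%N ->
  partial_sum trig_distribution M = T.
Proof.
move=> NM; apply/funext => x; rewrite partial_sumE /T /trig_poly.
rewrite -(pair_bigA _ (fun (n : 'I_N) b => t n b * mode R n b x)).
rewrite (big_ord_widen M (fun n => \sum_b t n b * mode R n b x))//.
rewrite [RHS]big_mkcond; apply: eq_bigr => n _.
case: ifPn => nN; first by apply: eq_bigr => b _; rewrite coord_trig_distribution nN; field.
by rewrite big1// => b _; rewrite coord_trig_distribution (negPf nN) mulr0 mul0r.
Qed.

Lemma trig_distribution_sum : is_fourier_sum trig_distribution.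
Proof.
apply/is_fourier_sumE => f; apply: cvg_near_cst; near=> M.
rewrite partial_sum_trig_distribution//; near: M; exact: nbhs_infty_ge.
Unshelve. all: by end_near. Qed.

Lemma trig_distribution_mean0 : fourier_coef trig_distribution 0 = 0.
Proof.
rewrite /fourier_coef /= /trig_pairing.
have -> : (fun x => T x * cos_test 0 x) = T.
  by apply/funext => x /=; rewrite mulr0 mul0r cos0 mulr1.
have -> : (fun x => T x * sin_test 0 x) = cst 0.
  by apply/funext => x /=; rewrite mulr0 mul0r sin0 mulr0.
by rewrite torus_integral_trig_poly torus_integral_cst oppr0.
Qed.

Lemma trig_distribution_fin s :
  (sobolev_sqnorm s (fourier_coef trig_distribution) < +oo)%E.
Proof.
rewrite sobolev_sqnorm_conj => [|n]; last first.
  by rewrite fourier_coef_coord fourier_coef_coordN /= opprK.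
rewrite (@eseries_finite _ _ N) ?sumEFin ?ltry// => n Nn.
rewrite fourier_coef_coord !coord_trig_distribution ltnNge Nn /= oppr0.
by rewrite expr0n addr0 sqrtr0 expr0n mulr0.
Qed.

Definition trig_sobolev s : sobolev R s :=
  Sobolev trig_distribution_mean0 trig_distribution_sum (trig_distribution_fin s).

End trigonometric_distribution.

Section truncation.
Context (R : realType) (s : R).
Implicit Types (u v : sobolev R s) (t : nat -> bool -> R).

Definition truncate N u : sobolev R s :=
  trig_sobolev N (fun n b => 2 * coord u n b) s.

Lemma trig_sobolev_dist N t t' :
  sobolev_dist (trig_sobolev N t s) (trig_sobolev N t' s) ^+ 2 =
  \sum_(n < N) weight s n * \sum_b ((t n b - t' n b) / 2) ^+ 2.
Proof.
apply: EFin_inj; rewrite sobolev_dist_sqr (@eseries_finite _ _ N) => [|n Nn].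
  rewrite -sumEFin; apply: eq_bigr => n _.
  congr (_ * _)%:E; apply: eq_bigr => b _.
  by rewrite !coord_trig_distribution ltn_ord mulrBl.
rewrite big1 ?mulr0// => b _.
by rewrite !coord_trig_distribution ltnNge Nn /= subr0 expr0n.
Qed.

Lemma truncate_dist N u :
  ((sobolev_dist u (truncate N u) ^+ 2)%:E =
   \sum_(N <= n <oo) (weight s n * \sum_b coord u n b ^+ 2)%:E)%E.
Proof.
rewrite sobolev_dist_sqr.
rewrite (nneseries_split 0 N) => [|n _]; last first.
  by rewrite lee_fin mulr_ge0 ?weight_ge0 ?sumr_ge0// => b _; exact: sqr_ge0.
rewrite add0n big1_seq ?add0e => [|n]; last first.
  rewrite mem_index_iota => /andP[_ /andP[_ nN]].
  rewrite big1 ?mulr0// => b _; rewrite coord_trig_distribution nN.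
  by rewrite (mulrC 2) mulfK// subrr expr0n.
congr (limn _); apply/funext => M; apply: eq_big_nat => n /andP[Nn _].
congr (_ * _)%:E; apply: eq_bigr => b _.
by rewrite coord_trig_distribution ltnNge Nn subr0.
Qed.

End truncation.

(** * Gaussian Fourier coefficients *)

Section gaussian_coordinates.
Context (R : realType) (s : R).
Local Notation H := (sobolev R s).
Implicit Types (N n : nat) (b : bool).

Definition coords N (u : H) (j : 'I_N * bool) : R := coord u j.1 j.2.

Lemma measurable_coord n b :
  measurable_fun setT (fun u : borel H => coord (u : H) n b).
Proof. by apply: continuous_borel => u; exact: coord_continuous. Qed.

(** The Fourier coordinates are independent centered Gaussian variables, those of
    frequency n + 1 having variance v n / 2. *)
Definition gaussian_coords (m : probability (borel H) R) (v : nat -> R) :=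
  forall N (t : 'I_N * bool -> R) (c : R),
    \int[m]_u cos (lin t (coords u) + c) =
    expR (- ((\sum_j t j ^+ 2 * v j.1) / 4)) * cos c :> R.

(** White noise is tested against the trigonometric polynomial with coefficients
    t; the real part of the characteristic function gives the cosine, and the
    imaginary part vanishes. *)
Lemma white_noise_coords (Q0 : probability (borel H) R) :
  white_noise Q0 -> gaussian_coords Q0 (cst 1).
Proof.
move=> wn N t c.
pose f : testfun R := \sum_j t j *: mode R j.1 j.2.
have fE : (f : R -> R) = trig_poly t.
  rewrite /f; apply/funext => x; rewrite /trig_poly.
  elim/big_rec2: _ => [//|j g y _ <-] /=.
  by [].
have uf (u : H) : sobolev_val u f = lin t (coords u).
  by rewrite /f linear_sum; apply: eq_bigr => j _; rewrite linearZ.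
have mu1 : measurable_fun setT (fun u : borel H => lin t (coords (u : H))).
  by apply: measurable_sum => j; apply: measurable_funM => //; exact: measurable_coord.
have := wn f; rewrite fE torus_integral_trig_poly => /(_ erefl).
have -> : torus_integral (fun x => trig_poly t x ^+ 2) / 2 =
    (\sum_j t j ^+ 2 * 1) / 4.
  rewrite parseval; under [in RHS]eq_bigr do rewrite mulr1.
  by field.
under eq_Rintegral do rewrite uf.
under [X in (_ +i* X)%C]eq_Rintegral do rewrite uf.
move=> [Ecos Esin]; rewrite -Ecos.
have ic : Q0.-integrable setT (EFin \o (fun u : borel H => cos (lin t (coords (u : H))))).
  apply: (@bounded_integrable _ _ _ Q0 _ 1) => [|u]; last exact: cos_max.
  exact: (measurableT_comp (@measurable_cos R)).
have is_ : Q0.-integrable setT (EFin \o (fun u : borel H => sin (lin t (coords (u : H))))).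
  apply: (@bounded_integrable _ _ _ Q0 _ 1) => [|u]; last exact: sin_max.
  exact: (measurableT_comp (@measurable_sin R)).
transitivity (\int[Q0]_u (cos c * cos (lin t (coords u)) - sin c * sin (lin t (coords u))) : R).
  by apply: eq_Rintegral => u _; rewrite cosD; ring.
rewrite RintegralB//; last 2 first.
- exact: (integrableZl measurableT _ ic).
- exact: (integrableZl measurableT _ is_).
by rewrite !RintegralZl// Esin mulr0 subr0 mulrC.
Qed.

Definition series_variance (beta : R) n : R :=
  (1 + 4 * pi ^+ 2 * beta * n.+1%:R ^+ 2)^-1.

Lemma frequency_ge0 (beta : R) n : 0 < beta -> 0 <= 4 * pi ^+ 2 * beta * n.+1%:R ^+ 2.
Proof.
move=> b0; rewrite mulr_ge0 ?sqr_ge0// mulr_ge0 ?(ltW b0)//.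
by rewrite mulr_ge0 ?sqr_ge0.
Qed.

Lemma series_variance_gt0 beta n : 0 < beta -> 0 < series_variance beta n.
Proof.
by move=> b0; rewrite invr_gt0 ltr_wpDr// frequency_ge0.
Qed.

Lemma divc_real (a b r : R) : r != 0 ->
  ((a +i* b) / r%:C = (a / r) +i* (b / r))%C.
Proof.
move=> r0; have rC : (r%:C)%C != 0 :> R[i] by rewrite eq_complex /= negb_and r0.
apply: (canLR (mulfK rC)); rewrite /= [RHS]/GRing.mul /= !mulr0 subr0 add0r.
by rewrite !divfK.
Qed.

Section random_series.
Context d (Omega : measurableType d) (P : probability Omega R).
Context (g : nat -> Omega -> R[i]).
Hypothesis iid_g : iid_std_complex_gaussian P g.

Definition real_gaussian n b w : R := if b then complex.Re (g n.+1 w) else complex.Im (g n.+1 w).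

Lemma real_gaussianP n b : gaussian_rv P 0 (Num.sqrt 2^-1) (real_gaussian n b).
Proof. by have [/(_ n.+1 erefl)[gR gI _] _] := iid_g; case: b. Qed.

Lemma measurable_real_gaussian n b : measurable_fun setT (real_gaussian n b).
Proof. by have [] := real_gaussianP n b. Qed.

(** Independence of the complex variables and of the two parts of each of them
    combine into independence of the whole real family. *)
Lemma real_gaussian_independent N :
  independent P (fun j : 'I_N * bool => real_gaussian j.1 j.2).
Proof.
move=> A mA; have [gauss ind] := iid_g.
pose B n : set (R * R) := if n is k.+1 then
  if (insub k : option 'I_N) is Some i then A (i, true) `*` A (i, false) else setT else setT.
have mB n : measurable (B n).
  case: n => [|k] /=; first exact: measurableT.
  by case: (insub k : option 'I_N) => // i; apply: measurableX; exact: mA.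
pose sN := [seq n.+1 | n <- iota 0 N].
have usN : uniq sN by rewrite map_inj_uniq ?iota_uniq// => m n [].
have := ind sN B usN _ mB.
have -> : \bigcap_(n in [set` sN]) (re_im (g n) @^-1` B n) =
    \bigcap_(j in [set: 'I_N * bool]) (real_gaussian j.1 j.2 @^-1` A j).
  apply/seteqP; split=> w Bw.
    move=> -[i b] _ /=.
    have : i.+1 \in sN by rewrite map_f// mem_iota add0n leq0n/=.
    move=> /Bw /=; rewrite valK => -[/= AR AI].
    by case: b.
  move=> n /= /mapP[k]; rewrite mem_iota add0n => /andP[_ kN] ->.
  rewrite /= insubT /=; split.
    exact: (Bw (Ordinal kN, true)).
  exact: (Bw (Ordinal kN, false)).
move=> ->; last by move=> n /mapP[k _ ->].
transitivity (\prod_(i < N) \prod_b P (real_gaussian i b @^-1` A (i, b)))%E; last first.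
  by rewrite pair_bigA; apply: eq_bigr => -[].
rewrite big_map -[X in iota 0 X](subn0 N) -/(index_iota 0 N) big_mkord.
apply: eq_bigr => i _; rewrite /= valK big_bool.
have [_ _ RI] := gauss i.+1 erefl.
exact: RI.
Qed.

Lemma lin_gaussian_mean N (t : 'I_N * bool -> R) c :
  \int[P]_w cos (lin t (fun j => real_gaussian j.1 j.2 w) + c) =
  expR (- ((\sum_j t j ^+ 2) / 4)) * cos c :> R.
Proof.
rewrite (independent_cos_mean _ (@real_gaussian_independent N)
  (e := fun j => expR (- (t j ^+ 2 / 4)))).
- by rewrite -expR_sum sumrN mulr_suml mulrC.
- by move=> j; exact: measurable_real_gaussian.
- move=> j; have := gaussian_cos_mean (real_gaussianP j.1 j.2) (t j) 0.
  by under eq_Rintegral do rewrite addr0; rewrite cos0 mulr1.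
- by move=> j; exact: gaussian_sin_mean (real_gaussianP j.1 j.2) (t j).
Qed.

(** The minus sign of the sine coordinates, which are opposite to imaginary parts,
    is absorbed in the coefficients t'. *)
Lemma series_coords (beta : R) (mu : probability (borel H) R) : 0 < beta ->
  gaussian_series_law P g beta mu -> gaussian_coords mu (series_variance beta).
Proof.
move=> beta0 [U Ug muU] N t c.
have ml : measurable_fun setT (fun u : borel H => cos (lin t (coords (u : H)) + c)).
  apply: (measurableT_comp (@measurable_cos R)); apply: measurable_funD => //.
  by apply: measurable_sum => j; apply: measurable_funM => //; exact: measurable_coord.
have mlU := measurableT_comp ml (measurable_funPT U).
pose lam n : R := Num.sqrt (1 + 4 * pi ^+ 2 * beta * n.+1%:R ^+ 2).
have lam2 n : (lam n)^-1 ^+ 2 = series_variance beta n.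
  by rewrite exprVn sqr_sqrtr// addr_ge0// frequency_ge0.
have lam0 n : lam n != 0.
  have : (lam n)^-1 ^+ 2 != 0 by rewrite lam2 gt_eqF// series_variance_gt0.
  by rewrite sqrf_eq0 invr_eq0.
pose t' (j : 'I_N * bool) := (if j.2 then t j else - t j) / lam j.1.
have -> : \sum_j t j ^+ 2 * series_variance beta j.1 = \sum_j t' j ^+ 2.
  apply: eq_bigr => j _; rewrite /t' exprMn lam2; congr (_ * _).
  by case: ifP => // _; rewrite sqrrN.
rewrite -lin_gaussian_mean.
have -> : \int[mu]_u cos (lin t (coords u) + c) =
    \int[P]_w cos (lin t (coords (U w)) + c) :> R.
  rewrite /Rintegral; congr fine.
  rewrite (@eq_measure_integral _ _ _ _ (distribution P U)) => [|A mA _]; last exact: muU.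
  rewrite integral_distribution//; first exact/measurable_EFinP.
  by apply: (@bounded_integrable _ _ _ P _ 1) => // w; exact: cos_max.
rewrite /Rintegral; congr fine; apply: ae_eq_integral => //.
- exact/measurable_EFinP.
- apply/measurable_EFinP; apply: (measurableT_comp (@measurable_cos R)).
  apply: measurable_funD => //; apply: measurable_sum => j.
  by apply: measurable_funM => //; exact: measurable_real_gaussian.
apply: filterS Ug => w Uw _; congr (cos (_ + _))%:E.
apply: eq_bigr => -[n b] _; rewrite /t' /coords /=.
have := Uw n.+1 erefl; rewrite fourier_coef_coord /two_sided /=.
rewrite -[Num.sqrt _]/(lam n) /real_gaussian.
case: (g n.+1 w) => x y; rewrite divc_real// => -[ER EI].
case: b; rewrite /=; first by rewrite ER; ring.
by rewrite -[coord _ _ _]opprK EI; ring.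
Qed.

End random_series.

End gaussian_coordinates.

(** * Fourth moments of Gaussian fields *)

Section reference_pair.
Context (R : realType) d (Omega : measurableType d) (P : probability Omega R).
Context (g : nat -> Omega -> R[i]).
Hypothesis iid_g : iid_std_complex_gaussian P g.

Local Notation xi := (real_gaussian g 0).

Lemma measurable_xi b : measurable_fun setT (xi b).
Proof. exact: measurable_real_gaussian iid_g _ _. Qed.

Lemma xi_independent : independent P xi.
Proof.
move=> A mA; have := real_gaussian_independent iid_g (N := 1) (A := fun j => A j.2)
  (fun j => mA j.2).
rewrite -(pair_bigA _ (fun (i : 'I_1) b => P (real_gaussian g i b @^-1` A b))).
rewrite big_ord1 => <-; congr (P _); apply/seteqP; split=> w Aw.
  by move=> [i b] _; rewrite ord1; exact: Aw.
by move=> b _; exact: (Aw (ord0, b)).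
Qed.

Lemma xi_char (t : bool -> R) c :
  \int[P]_w cos (lin t (xi ^~ w) + c) =
  expR (- ((t true ^+ 2 + t false ^+ 2) / 4)) * cos c :> R.
Proof.
rewrite (independent_cos_mean measurable_xi xi_independent
  (e := fun b => expR (- (t b ^+ 2 / 4)))).
- by rewrite big_bool /= -expRD mulrDl opprD mulrC.
- move=> b; have := gaussian_cos_mean (real_gaussianP iid_g 0 b) (t b) 0.
  by under eq_Rintegral do rewrite addr0; rewrite cos0 mulr1.
- by move=> b; exact: gaussian_sin_mean (real_gaussianP iid_g 0 b) (t b).
Qed.

Definition moment8 : R := (Num.sqrt pi)^-1 *
  (8 ^+ 4 * \int[@lebesgue_measure R]_x expR (- (x ^+ 2 / 2))).

Lemma xi_moment8 b : (\int[P]_w (xi b w ^+ 8)%:E <= moment8%:E)%E.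
Proof. exact: gaussian_moment8 (real_gaussianP iid_g 0 b). Qed.

Lemma measurable_xiX b k : measurable_fun setT (fun w => xi b w ^+ k).
Proof. by apply: measurable_funX; exact: measurable_xi. Qed.

Lemma integrable_xi8 b : P.-integrable setT (fun w => (xi b w ^+ 8)%:E).
Proof.
apply/integrableP; split; first exact/measurable_EFinP/measurable_xiX.
apply: (@le_lt_trans _ _ moment8%:E); last exact: ltry.
apply: le_trans (xi_moment8 b).
by under eq_integral do rewrite gee0_abs ?lee_fin ?exprn_even_ge0//.
Qed.

Lemma integrable_xiX b k : (k <= 8)%N -> P.-integrable setT (fun w => (xi b w ^+ k)%:E).
Proof.
move=> k8; apply: (@le_integrable _ _ _ P setT measurableT _
    (fun w => (1 + xi b w ^+ 8)%:E)).
- exact/measurable_EFinP/measurable_xiX.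
- move=> w _ /=; rewrite lee_fin [leRHS]ger0_norm; last by rewrite addr_ge0// exprn_even_ge0.
  have -> : xi b w ^+ 8 = `|xi b w| ^+ 8 by rewrite -normrX ger0_norm// exprn_even_ge0.
  rewrite normrX; move: `|_| (normr_ge0 (xi b w)) => x x0.
  have [x1|x1] := leP x 1.
    by rewrite (le_trans (exprn_ile1 _ _ _))// lerDl exprn_ge0.
  by apply: (le_trans (ler_weXn2l (ltW x1) k8)); rewrite lerDr.
- have h1 := finite_measure_integrable_cst P 1 measurableT.
  exact: (integrableD measurableT h1 (integrable_xi8 b)).
Qed.

Lemma continuous_expr (k : nat) : continuous (fun x : R => x ^+ k).
Proof. by move=> x; exact: exprn_continuous. Qed.

(** Uniqueness of laws in dimension one, the comparison variable being a multiple
    of the reference variable xi true of variance 1 / 2. *)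
Lemma gaussian_law d' (T : measurableType d') (m : probability T R) (L : T -> R)
    (V : R) (Phi : R -> R) : measurable_fun setT L -> 0 <= V ->
  (forall t c, \int[m]_u cos (t * L u + c) = expR (- (t ^+ 2 * V / 4)) * cos c :> R) ->
  continuous Phi -> (forall x, 0 <= Phi x) ->
  (\int[m]_u (Phi (L u))%:E = \int[P]_w (Phi (Num.sqrt V * xi true w))%:E)%E.
Proof.
move=> mL V0 cL cPhi Phi0.
have [|||||_ _ //] := @law_uniqueness_ge0 R unit _ _ m (fun u _ => L u) _ _ P
  (fun w _ => Num.sqrt V * xi true w) (fun x => Phi (x tt)).
- by move=> _; exact: mL.
- by move=> _; apply: measurable_funM => //; exact: measurable_xi.
- have lin1 (t x : unit -> R) : lin t x = t tt * x tt.
    by rewrite /lin (bigD1 tt)//= big1 ?addr0// => -[].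
  move=> t c; under eq_Rintegral do rewrite lin1.
  rewrite cL; under eq_Rintegral do rewrite lin1 mulrA.
  rewrite (gaussian_cos_mean (real_gaussianP iid_g 0 true)).
  by rewrite exprMn sqr_sqrtr.
- by move=> x; exact: Phi0.
- by move=> x_ x /(_ tt); apply: continuous_cvg; exact: cPhi.
Qed.

Definition moment k : R := \int[P]_w xi true w ^+ k.

Lemma gaussian_moment d' (T : measurableType d') (m : probability T R) (L : T -> R)
    (V : R) k : measurable_fun setT L -> 0 <= V -> (k.*2 <= 8)%N ->
  (forall t c, \int[m]_u cos (t * L u + c) = expR (- (t ^+ 2 * V / 4)) * cos c :> R) ->
  (\int[m]_u (L u ^+ k.*2)%:E = (V ^+ k * moment k.*2)%:E)%E.
Proof.
move=> mL V0 k8 cL.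
rewrite (gaussian_law (Phi := fun x => x ^+ k.*2) mL V0 cL).
- rewrite /moment -RintegralZl//; last exact: integrable_xiX.
  rewrite /Rintegral fineK; last first.
    apply: integrable_fin_num => //.
    exact: (integrableZl measurableT (V ^+ k) (integrable_xiX true k8)).
  apply: eq_integral => w _; rewrite exprMn -[Num.sqrt V ^+ _]/(_) -mul2n exprM sqr_sqrtr//.
- exact: continuous_expr.
- by move=> x; rewrite exprn_even_ge0// odd_double.
Qed.

Lemma moment_xi b k : (k.*2 <= 8)%N -> \int[P]_w xi b w ^+ k.*2 = moment k.*2.
Proof.
move=> k8; rewrite /(\int[P]_w _)%R (gaussian_moment (V := 1) (measurable_xi b))//.
  by rewrite /= expr1n mul1r.
by move=> t c; rewrite mulr1 (gaussian_cos_mean (real_gaussianP iid_g 0 b)).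
Qed.

Lemma moment8_ge : moment 8 <= moment8.
Proof.
rewrite -lee_fin /moment /Rintegral fineK; first exact: xi_moment8.
by apply: integrable_fin_num => //; exact: integrable_xiX.
Qed.

Lemma moment_ge0 k : 0 <= moment k.*2.
Proof. by apply: Rintegral_ge0 => w _; rewrite exprn_even_ge0// odd_double. Qed.

Lemma integrable_sum8 : P.-integrable setT
  (EFin \o (fun w => xi true w ^+ 8 + xi false w ^+ 8)).
Proof. exact: (integrableD measurableT (integrable_xi8 true) (integrable_xi8 false)). Qed.

Lemma mul_le_sum8 (x y : R) k : (k <= 4)%N ->
  0 <= x ^+ (8 - k.*2) * y ^+ k.*2 <= x ^+ 8 + y ^+ 8.
Proof.
move=> k4; have k8 : (k.*2 <= 8)%N by rewrite -(leq_double k 4) in k4.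
have e8 (z : R) : 0 <= z ^+ 8 by rewrite exprn_even_ge0.
have od : odd (8 - k.*2) = false by rewrite oddB// odd_double.
rewrite mulr_ge0 ?exprn_even_ge0 ?od ?odd_double//=.
have absE (z : R) j : odd j = false -> z ^+ j = `|z| ^+ j.
  by move=> oj; rewrite -normrX ger0_norm// exprn_even_ge0// oj.
rewrite (absE x (8 - k.*2)%N od) (absE y k.*2) ?odd_double// (absE x 8)// (absE y 8)//.
move: `|x| `|y| (normr_ge0 x) (normr_ge0 y) => {e8} a b a0 b0.
have [ab|ba] := leP a b.
  apply: (@le_trans _ _ (b ^+ 8)); last by rewrite lerDr exprn_ge0.
  rewrite -[in leRHS](subnK k8) exprD ler_wpM2r ?exprn_ge0//.
  by apply: lerXn2r => //; rewrite nnegrE.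
apply: (@le_trans _ _ (a ^+ 8)); last by rewrite lerDl exprn_ge0.
rewrite -[in leRHS](subnK k8) exprD ler_wpM2l ?exprn_ge0//.
by apply: lerXn2r => //; rewrite ?nnegrE// ltW.
Qed.

Lemma integrable_xi_mul k : (k <= 4)%N -> P.-integrable setT
  (EFin \o (fun w => xi true w ^+ (8 - k.*2) * xi false w ^+ k.*2)).
Proof.
move=> k4; apply: (@le_integrable _ _ _ P setT measurableT _
   (EFin \o (fun w => xi true w ^+ 8 + xi false w ^+ 8))).
- by apply/measurable_EFinP; apply: measurable_funM; exact: measurable_xiX.
- move=> w _ /=; rewrite lee_fin.
  have /andP[l u] := mul_le_sum8 (xi true w) (xi false w) k4.
  by rewrite !ger0_norm// addr_ge0// exprn_even_ge0.
- exact: integrable_sum8.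
Qed.

Lemma moment_mul_le k : (k <= 4)%N ->
  \int[P]_w (xi true w ^+ (8 - k.*2) * xi false w ^+ k.*2) <= 2 * moment8.
Proof.
move=> k4; apply: (@le_trans _ _ (\int[P]_w (xi true w ^+ 8 + xi false w ^+ 8))).
  apply: le_Rintegral => //; [exact: integrable_xi_mul|exact: integrable_sum8|].
  by move=> w _; have /andP[] := mul_le_sum8 (xi true w) (xi false w) k4.
rewrite RintegralD//; [|exact: integrable_xi8..].
by rewrite (moment_xi true (k := 4)) ?(moment_xi false (k := 4))//; have := moment8_ge; lra.
Qed.

(** The product rule for independent variables, extended to the unbounded function
    x ^ 4 through its truncations. *)
Lemma moment44 : \int[P]_w (xi true w ^+ 4 * xi false w ^+ 4) = moment 4 ^+ 2.
Proof.
pose f k (x : R) : R := Num.min (x ^+ 4) k%:R.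
have x4 (x : R) : 0 <= x ^+ 4 by rewrite exprn_even_ge0.
have cf k : continuous (f k).
  have -> : f k = fun x => (x ^+ 4 + k%:R - `|x ^+ 4 - k%:R|) / 2.
    by apply/funext => x; exact: minr_absE.
  move=> x; apply: cvgM; last exact: cvg_cst.
  have cx := @continuous_expr 4 x.
  apply: cvgB; first by apply: cvgD => //; exact: cvg_cst.
  by apply: cvg_norm; apply: cvgB => //; exact: cvg_cst.
have f0 k x : 0 <= f k x by rewrite le_min x4 ler0n.
have fx k x : f k x <= x ^+ 4 by rewrite ge_min lexx.
have fk k x : f k x <= k%:R by rewrite ge_min lexx orbT.
have lim x : f k x @[k --> \oo] --> x ^+ 4.
  apply: cvg_near_cst; near=> k; apply/min_idPl/ltW.
  by near: k; exact: nbhs_infty_gtr.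
have mfx k b : measurable_fun setT (fun w => f k (xi b w)).
  apply: (measurableT_comp _ (measurable_xi b)).
  by apply: continuous_measurable_fun; exact: cf.
have L b : \int[P]_w f k (xi b w) @[k --> \oo] --> moment 4.
  rewrite -(moment_xi b (k := 2))//.
  apply: (proj2 (@dominated_cvg_Rintegral _ _ _ P setT _ _ (fun w => xi b w ^+ 4)
    measurableT _ _ _ _)).
  - by move=> k; exact: mfx.
  - by move=> w _; exact: lim.
  - exact: integrable_xiX.
  - by move=> k w _; rewrite ger0_norm.
have L2 : \int[P]_w (f k (xi true w) * f k (xi false w)) @[k --> \oo] -->
    \int[P]_w (xi true w ^+ 4 * xi false w ^+ 4).
  apply: (proj2 (@dominated_cvg_Rintegral _ _ _ P setT _ _
    (fun w => xi true w ^+ 4 * xi false w ^+ 4) measurableT _ _ _ _)).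
  - by move=> k; exact: measurable_funM.
  - by move=> w _; apply: cvgM; exact: lim.
  - exact: (integrable_xi_mul (k := 2)).
  - by move=> k w _; rewrite ger0_norm ?mulr_ge0// ler_pM.
have prodE k : \int[P]_w (f k (xi true w) * f k (xi false w)) =
    (\int[P]_w f k (xi true w)) * (\int[P]_w f k (xi false w)).
  have := prod_Rintegral measurable_xi xi_independent (f := fun=> f k) (M := k%:R)
    (fun _ x => _) (fun=> cf k).
  rewrite big_bool /= => <-.
    by apply: eq_Rintegral => w _; rewrite big_bool.
  by move=> _ x; rewrite ger0_norm.
rewrite (_ : (fun k => _) = fun k => (\int[P]_w f k (xi true w)) * (\int[P]_w f k (xi false w))) in L2.
  apply: (cvg_unique (@Rhausdorff R) L2); rewrite expr2; apply: cvgM; exact: L.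
by apply/funext => k.
Unshelve. all: by end_near. Qed.

End reference_pair.

Section pair_moments.
Context (R : realType) d (Omega : measurableType d) (P : probability Omega R).
Context (g : nat -> Omega -> R[i]).
Hypothesis iid_g : iid_std_complex_gaussian P g.

Local Notation xi := (real_gaussian g 0).
Local Notation moment := (moment P g).

(** The pair has the law of (r xi_1, a xi_1 + e b xi_2) for both signs e, and the
    odd powers of xi_2 cancel in the sum over the two signs. *)
Lemma pair_moment4 d' (T : measurableType d') (m : probability T R) (X1 X2 : T -> R)
    (V rho : R) : measurable_fun setT X1 -> measurable_fun setT X2 ->
  0 < V -> rho ^+ 2 <= V ^+ 2 ->
  (forall a b c, \int[m]_u cos (a * X1 u + b * X2 u + c) =
     expR (- ((a ^+ 2 * V + 2 * a * b * rho + b ^+ 2 * V) / 4)) * cos c :> R) ->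
  (\int[m]_u (X1 u ^+ 4 * X2 u ^+ 4)%:E <=
   (moment 4 ^+ 2 * V ^+ 4 + 13 * moment8 R * V ^+ 2 * rho ^+ 2)%:E)%E.
Proof.
move=> mX1 mX2 V0 rhoV cX.
have mxi c := measurable_xi iid_g c.
set r := Num.sqrt V; have r0 : 0 < r by rewrite sqrtr_gt0.
have r2 : r ^+ 2 = V by rewrite sqr_sqrtr// ltW.
set a := rho / r; have ra : r * a = rho by rewrite mulrC divfK ?gt_eqF.
have a2 : a ^+ 2 * V = rho ^+ 2 by rewrite -r2 -exprMn mulrC ra.
have aV : a ^+ 2 <= V by rewrite -(ler_pM2r V0) a2 (le_trans rhoV)// expr2.
set b := Num.sqrt (V - a ^+ 2).
have b2 : b ^+ 2 = V - a ^+ 2 by rewrite sqr_sqrtr// subr_ge0.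
pose Y e w := a * xi true w + e * b * xi false w.
have mY e : measurable_fun setT (Y e).
  by apply: measurable_funD; apply: measurable_funM => //; exact: mxi.
have mrxi : measurable_fun setT (fun w => r * xi true w).
  by apply: measurable_funM => //; exact: mxi.
have x4 (x : R) : 0 <= x ^+ 4 by rewrite exprn_even_ge0.
have y4 (x y : R) : 0 <= x ^+ 4 * y ^+ 4 by rewrite mulr_ge0.
have law e : e ^+ 2 = 1 -> (\int[m]_u (X1 u ^+ 4 * X2 u ^+ 4)%:E =
    \int[P]_w ((r * xi true w) ^+ 4 * Y e w ^+ 4)%:E)%E.
  move=> e2; have [|||||_ _ //] := @law_uniqueness_ge0 R bool _ _ m
    (fun u c => if c then X1 u else X2 u) _ _ P
    (fun w c => if c then r * xi true w else Y e w)
    (fun x => x true ^+ 4 * x false ^+ 4).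
  - by case.
  - by case.
  - move=> t c; under eq_Rintegral do rewrite /lin big_bool /=.
    rewrite cX.
    transitivity (\int[P]_w cos (lin
      (fun i => if i then t true * r + t false * a else t false * (e * b)) (xi ^~ w) + c)).
      rewrite (xi_char iid_g) !exprMn e2 mul1r b2; congr (expR (- (_ / 4)) * _).
      by rewrite sqrrD exprMn r2 -ra; ring.
    apply: eq_Rintegral => w _; rewrite /lin !big_bool /=; congr (cos (_ + c)).
    by rewrite /Y; ring.
  - by move=> x; exact: y4.
  - move=> x_ x xl.
    have X4 c : x_ n c ^+ 4 @[n --> \oo] --> x c ^+ 4.
      exact: (cvg_comp _ _ (xl c) (@continuous_expr R 4 (x c))).
    exact: cvgM (X4 true) (X4 false).
set I := (X in (X <= _)%E).
pose h0 w := a ^+ 4 * xi true w ^+ 8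
   + 6 * a ^+ 2 * b ^+ 2 * (xi true w ^+ 6 * xi false w ^+ 2)
   + b ^+ 4 * (xi true w ^+ 4 * xi false w ^+ 4).
pose h w := 2 * V ^+ 2 * h0 w.
have [i8 i6 i4] : [/\ P.-integrable setT (EFin \o fun w => xi true w ^+ 8),
    P.-integrable setT (EFin \o fun w => xi true w ^+ 6 * xi false w ^+ 2) &
    P.-integrable setT (EFin \o fun w => xi true w ^+ 4 * xi false w ^+ 4)].
  split; [exact: integrable_xi8|exact: (integrable_xi_mul iid_g (k := 1))|].
  exact: (integrable_xi_mul iid_g (k := 2)).
have j8 := integrableZl measurableT (a ^+ 4) i8.
have j6 := integrableZl measurableT (6 * a ^+ 2 * b ^+ 2) i6.
have j4 := integrableZl measurableT (b ^+ 4) i4.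
have j86 := integrableD measurableT j8 j6.
have jh : P.-integrable setT (EFin \o h0) := integrableD measurableT j86 j4.
have II : (I + I = (\int[P]_w h w)%:E)%E.
  rewrite {1}/I (law 1) ?expr1n// /I (law (-1)) ?sqrrN ?expr1n//.
  rewrite -ge0_integralD//; last 4 first.
  - by move=> w _; rewrite lee_fin.
  - by apply/measurable_EFinP; apply: measurable_funM; exact: measurable_funX.
  - by move=> w _; rewrite lee_fin.
  - by apply/measurable_EFinP; apply: measurable_funM; exact: measurable_funX.
  rewrite /Rintegral fineK; last first.
    apply: integrable_fin_num => //.
    exact: (integrableZl measurableT (2 * V ^+ 2) jh).
  apply: eq_integral => w _; rewrite -EFinD /h /h0 /Y -r2; congr (_%:E).
  by ring.
have hE : \int[P]_w h w <=
    2 * V ^+ 2 * (a ^+ 4 * moment8 R + 6 * a ^+ 2 * b ^+ 2 * (2 * moment8 R)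
     + b ^+ 4 * moment 4 ^+ 2).
  have -> : \int[P]_w h w = 2 * V ^+ 2 * \int[P]_w h0 w by exact: RintegralZl.
  rewrite ler_wpM2l ?mulr_ge0 ?(ltW V0)//.
  rewrite (RintegralD measurableT j86 j4) (RintegralD measurableT j8 j6).
  rewrite !RintegralZl// (moment44 iid_g).
  rewrite lerD2r lerD// ler_wpM2l ?exprn_even_ge0//.
  - exact: moment8_ge.
  - by rewrite mulr_ge0 ?sqr_ge0// mulr_ge0 ?sqr_ge0.
  - exact: (moment_mul_le iid_g (k := 1)).
have M0 : 0 <= moment8 R.
  by apply: le_trans (moment8_ge iid_g); exact: (moment_ge0 P g 4).
have bound : 2 * V ^+ 2 * (a ^+ 4 * moment8 R + 6 * a ^+ 2 * b ^+ 2 * (2 * moment8 R)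
     + b ^+ 4 * moment 4 ^+ 2) <=
   2 * (moment 4 ^+ 2 * V ^+ 4 + 13 * moment8 R * V ^+ 2 * rho ^+ 2).
  have bV : b ^+ 2 <= V by rewrite b2 lerBlDr lerDl sqr_ge0.
  have h4 : a ^+ 4 <= rho ^+ 2.
    by rewrite -a2 (exprM _ 2 2) expr2 ler_wpM2l ?sqr_ge0.
  have h22 : a ^+ 2 * b ^+ 2 <= rho ^+ 2 by rewrite -a2 ler_wpM2l ?sqr_ge0.
  have hb : b ^+ 4 <= V ^+ 2.
    by rewrite (exprM _ 2 2); apply: lerXn2r => //; rewrite nnegrE ?sqr_ge0// ltW.
  rewrite -mulrA ler_pM2l//.
  have -> : moment 4 ^+ 2 * V ^+ 4 + 13 * moment8 R * V ^+ 2 * rho ^+ 2 =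
    V ^+ 2 * (rho ^+ 2 * moment8 R + 6 * rho ^+ 2 * (2 * moment8 R)
              + V ^+ 2 * moment 4 ^+ 2) by ring.
  have {}h22 : 6 * a ^+ 2 * b ^+ 2 <= 6 * rho ^+ 2 by rewrite -mulrA ler_wpM2l.
  rewrite ler_wpM2l ?sqr_ge0//; apply: lerD; first apply: lerD.
  - exact: ler_wpM2r.
  - by apply: ler_wpM2r => //; exact: mulr_ge0 (ler0n _ 2) M0.
  - by apply: ler_wpM2r => //; exact: sqr_ge0.
have I0 : (0 <= I)%E by apply: integral_ge0 => u _; rewrite lee_fin.
move: II I0; case: I => [i| |]//; rewrite -EFinD => -[ii] _; rewrite lee_fin.
rewrite -(ler_pM2l (ltr0n _ 2)); apply: le_trans (le_trans hE bound).
by rewrite -ii mulrDl !mul1r.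
Qed.

End pair_moments.

(** * The quartic integral of a Gaussian field *)

Lemma probability_integral_cst (R : realType) d (T : measurableType d)
  (P : probability T R) (r : R) : (\int[P]_x r%:E = r%:E)%E.
Proof. by rewrite integral_cst//= probability_setT mule1. Qed.

Section torus_tonelli.
Context (R : realType) d (T : measurableType d) (m : probability T R).
Local Notation leb := (@lebesgue_measure R).
Local Notation mR := (measurableTypeR R).
Variable f : T * mR -> R.
Hypothesis mf : measurable_fun setT f.
Hypothesis f0 : forall z, 0 <= f z.

Local Notation f1 := (fun z : T * mR => (f z * (\1_(`[0, 1]%classic) z.2 : R))%:E).

Lemma measurable_torus_section : measurable_fun setT f1.
Proof.
apply/measurable_EFinP; apply: measurable_funM => //.
by apply: (measurableT_comp _ measurable_snd).
Qed.

Lemma torus_section_ge0 z : (0 <= f1 z)%E.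
Proof. by rewrite lee_fin mulr_ge0. Qed.

Lemma torus_sectionE u :
  (\int[leb]_(x in `[0%R, 1%R]) (f (u, x))%:E = \int[leb]_x f1 (u, x))%E.
Proof.
rewrite integral_mkcond; apply: eq_integral => x _ /=.
by rewrite patchE indicE; case: ifP => _; rewrite ?mulr1 ?mulr0.
Qed.

Lemma measurable_torus_integral :
  measurable_fun setT (fun u => \int[leb]_(x in `[0%R, 1%R]) (f (u, x))%:E)%E.
Proof.
rewrite (_ : (fun u => _) = fun u => \int[leb]_x f1 (u, x))%E; last first.
  by apply/funext => u; exact: torus_sectionE.
exact: (@measurable_fun_fubini_tonelli_F _ _ _ _ _ leb f1 measurable_torus_section torus_section_ge0).
Qed.

Lemma torus_tonelli :
  (\int[m]_u \int[leb]_(x in `[0%R, 1%R]) (f (u, x))%:E =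
   \int[leb]_(x in `[0%R, 1%R]) \int[m]_u (f (u, x))%:E)%E.
Proof.
under eq_integral do rewrite torus_sectionE.
rewrite (@fubini_tonelli _ _ _ _ _ m leb f1 measurable_torus_section torus_section_ge0).
rewrite [RHS]integral_mkcond; apply: eq_integral => x _ /=.
rewrite patchE indicE; case: ifP => _; first by under eq_integral do rewrite mulr1.
by under eq_integral do rewrite mulr0; rewrite integral0.
Qed.

End torus_tonelli.

Section frequency_band.
Context (R : realType).
Implicit Types (u : torus_distribution R) (K N n : nat) (x y : R).
Local Notation mode := (mode R).

(** The frequencies are K + 1, ..., N, index n standing for frequency n + 1. *)
Definition band u K N x : R :=
  \sum_(K <= n < N) \sum_b 2 * coord u n b * mode n b x.

Lemma partial_sum_band u N : partial_sum u N = band u 0 N.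
Proof. by apply/funext => x; rewrite partial_sumE /band big_mkord. Qed.

Lemma bandD u K M N x : (K <= M)%N -> (M <= N)%N ->
  band u K N x = band u K M x + band u M N x.
Proof. by move=> KM MN; rewrite /band (big_cat_nat KM MN). Qed.

Lemma sum_band (V : nmodType) K N (F : nat -> bool -> V) :
  \sum_(K <= n < N) \sum_b F n b =
  \sum_(j : 'I_N * bool) (if (K <= j.1)%N then F j.1 j.2 else 0).
Proof.
rewrite -(pair_bigA _ (fun (n : 'I_N) b => if (K <= n)%N then F n b else 0)) /=.
rewrite big_geq_mkord [LHS]big_mkcond; apply: eq_bigr => n _ /=.
by case: ifP => // _; rewrite big1.
Qed.

Definition band_coef K N x (j : 'I_N * bool) : R :=
  (K <= j.1)%:R * (2 * mode j.1 j.2 x).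

Lemma band_lin s (u : sobolev R s) K N x :
  band u K N x = lin (band_coef K x) (coords (N := N) u).
Proof.
rewrite /band sum_band; apply: eq_bigr => j _; rewrite /band_coef /coords.
by case: ifP => _; rewrite ?mul0r// mul1r; ring.
Qed.

Lemma band_continuous u K N : continuous (band u K N).
Proof.
have -> : band u K N =
    trig_poly (fun j : 'I_N * bool => if (K <= j.1)%N then 2 * coord u j.1 j.2 else 0).
  apply/funext => x; rewrite /band sum_band; apply: eq_bigr => j _.
  by case: ifP => _; rewrite ?mul0r.
exact: trig_poly_continuous.
Qed.

Lemma mode_sqr n x : \sum_b mode n b x ^+ 2 = 1.
Proof. by rewrite big_bool; exact: cos2Dsin2. Qed.

Definition mode_kernel n x y : R := \sum_b mode n b x * mode n b y.

Lemma mode_kernel_le1 n x y : `|mode_kernel n x y| <= 1.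
Proof.
rewrite -[leRHS]normr1 -ler_sqr ?nnegrE// !real_normK ?num_real// /mode_kernel.
have := mode_sqr n x; have := mode_sqr n y; rewrite !big_bool /=.
move: (cos _) (sin _) (cos _) (sin _) => c d a b cd ab.
rewrite expr1n -(mulr1 1) -{1}cd -ab -subr_ge0.
rewrite (_ : _ - _ = (a * d - b * c) ^+ 2); first exact: sqr_ge0.
by ring.
Qed.

Lemma mode_sqrD n (a b x y : R) : \sum_c (a * mode n c x + b * mode n c y) ^+ 2 =
  a ^+ 2 + 2 * a * b * mode_kernel n x y + b ^+ 2.
Proof.
transitivity (a ^+ 2 * (\sum_c mode n c x ^+ 2) + 2 * a * b * mode_kernel n x y
  + b ^+ 2 * (\sum_c mode n c y ^+ 2)); last by rewrite !mode_sqr !mulr1.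
by rewrite /mode_kernel !big_bool /=; ring.
Qed.

End frequency_band.

Section band_moments.
Context (R : realType) (s : R).
Local Notation H := (sobolev R s).
Local Notation leb := (@lebesgue_measure R).
Context d (Omega : measurableType d) (P : probability Omega R).
Context (g : nat -> Omega -> R[i]).
Hypothesis iid_g : iid_std_complex_gaussian P g.
Context (m : probability (borel H) R) (v : nat -> R).
Hypothesis m_v : gaussian_coords m v.
Hypothesis v0 : forall n, 0 < v n.
Hypothesis v1 : forall n, v n <= 1.
Implicit Types (K N n : nat) (x y : R).

Local Notation kappa := (moment P g 4).

(** Twice the variance of the band at any point, in accordance with the variance
    v n / 2 of the coordinates. *)
Definition variance K N : R := 4 * \sum_(K <= n < N) v n.

Definition covariance K N x y : R :=
  4 * \sum_(K <= n < N) v n * mode_kernel n x y.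

Lemma variance_ge0 K N : 0 <= variance K N.
Proof. by rewrite mulr_ge0// sumr_ge0// => n _; exact: ltW. Qed.

Lemma covariance_le K N x y : covariance K N x y ^+ 2 <= variance K N ^+ 2.
Proof.
rewrite -[_ ^+ 2]real_normK ?num_real// lerXn2r ?nnegrE ?variance_ge0//.
rewrite normrM ger0_norm// ler_wpM2l//; apply: (le_trans (ler_norm_sum _ _ _)).
apply: ler_sum => n _; rewrite normrM (gtr0_norm (v0 n)) ler_piMr ?(ltW (v0 n))//.
exact: mode_kernel_le1.
Qed.

(** Gaussian fields: any two values have the characteristic function of a Gaussian
    pair, whose covariance matrix is half of the one displayed. *)
Lemma band_char K N (a b c : R) x y :
  \int[m]_u cos (a * band u K N x + b * band u K N y + c) =
  expR (- ((a ^+ 2 * variance K N + 2 * a * b * covariance K N x y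
            + b ^+ 2 * variance K N) / 4)) * cos c :> R.
Proof.
pose t j := a * band_coef (N := N) K x j + b * band_coef K y j.
transitivity (\int[m]_u cos (lin t (coords u) + c) : R).
  apply: eq_Rintegral => u _; rewrite !band_lin /lin !mulr_sumr -big_split /=.
  by congr (cos (_ + c)); apply: eq_bigr => j _; rewrite /t; ring.
rewrite m_v; congr (expR (- (_ / 4)) * _).
transitivity (\sum_(K <= n < N) \sum_c
    4 * v n * (a * mode R n c x + b * mode R n c y) ^+ 2).
  rewrite sum_band; apply: eq_bigr => j _; rewrite /t /band_coef.
  by case: ifP => _; [rewrite !mul1r; ring|rewrite !mul0r !mulr0 addr0 expr0n mul0r].
rewrite /variance /covariance !mulr_sumr -!big_split /=; apply: eq_bigr => n _.
by rewrite -mulr_sumr mode_sqrD; ring.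
Qed.

Lemma measurable_band2 K N : measurable_fun setT
  (fun z : borel H * measurableTypeR R => band (z.1 : H) K N (z.2 : R)).
Proof.
rewrite /band; under eq_fun do rewrite sum_band.
apply: measurable_sum => j; case: (K <= j.1)%N; last exact: measurable_cst.
apply: measurable_funM; first apply: measurable_funM => //.
  exact: (measurableT_comp (measurable_coord _ _) measurable_fst).
apply: (measurableT_comp _ measurable_snd).
by apply: continuous_measurable_fun; exact: mode_continuous.
Qed.

Lemma measurable_band K N x : measurable_fun setT (fun u : borel H => band (u : H) K N x).
Proof. exact: (measurableT_comp (measurable_band2 K N) (measurable_pair2 x)). Qed.

Lemma band_moment K N x :
  (\int[m]_u (band u K N x ^+ 4)%:E = (variance K N ^+ 2 * kappa)%:E)%E.
Proof.
apply: (gaussian_moment iid_g (k := 2) (measurable_band K N x)) => //.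
  exact: variance_ge0.
move=> t c; have := band_char K N t 0 c x x.
by rewrite mulr0 mul0r expr0n mul0r !addr0 => <-; under [in RHS]eq_Rintegral do
  rewrite mul0r addr0.
Qed.

Lemma band_pair_moment K N x y : 0 < variance K N ->
  (\int[m]_u (band u K N x ^+ 4 * band u K N y ^+ 4)%:E <=
   (kappa ^+ 2 * variance K N ^+ 4
    + 13 * moment8 R * variance K N ^+ 2 * covariance K N x y ^+ 2)%:E)%E.
Proof.
move=> V0; apply: (pair_moment4 iid_g) => //; try exact: measurable_band.
  exact: covariance_le.
by move=> a b c; exact: band_char.
Qed.

Lemma covariance_continuous K N x : continuous (covariance K N x).
Proof.
move=> y; apply: cvgM; first exact: cvg_cst.
apply: (continuous_sum (f := fun n y => v n * mode_kernel n x y)) => n {}y.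
apply: cvgM; first exact: cvg_cst.
apply: (continuous_sum (f := fun b y => mode R n b x * mode R n b y)) => b {}y.
by apply: cvgM; [exact: cvg_cst|exact: mode_continuous].
Qed.

(** Parseval gives 8 sum v n ^ 2, and v n ^ 2 <= v n. *)
Lemma covariance_mean_sqr K N x :
  torus_integral (fun y => covariance K N x y ^+ 2) <= 2 * variance K N.
Proof.
pose t (j : 'I_N * bool) := if (K <= j.1)%N then 4 * v j.1 * mode R j.1 j.2 x else 0.
have tE y : covariance K N x y = trig_poly t y.
  rewrite /covariance /mode_kernel mulr_sumr.
  transitivity (\sum_(K <= n < N) \sum_b (4 * v n * mode R n b x * mode R n b y)).
    by apply: eq_bigr => n _; rewrite !mulr_sumr; apply: eq_bigr => b _; rewrite !mulrA.
  by rewrite sum_band; apply: eq_bigr => j _; rewrite /t; case: ifP => _; rewrite ?mul0r.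
have -> : torus_integral (fun y => covariance K N x y ^+ 2) =
    torus_integral (fun y => trig_poly t y ^+ 2).
  by apply: eq_Rintegral => y _; rewrite tE.
rewrite parseval.
have -> : \sum_j t j ^+ 2 = \sum_(K <= n < N) \sum_b 16 * v n ^+ 2 * mode R n b x ^+ 2.
  rewrite sum_band; apply: eq_bigr => j _; rewrite /t; case: ifP => _; last by rewrite expr0n.
  by ring.
rewrite /variance !mulr_sumr; apply: ler_sum => n _.
rewrite -mulr_sumr mode_sqr mulr1.
have -> : 2^-1 * (16 * v n ^+ 2) = 2 * (4 * v n) * v n by field.
by rewrite ler_piMr// !mulr_ge0// ltW.
Qed.

Definition quartic K N (u : torus_distribution R) : R :=
  torus_integral (fun x => band u K N x ^+ 4).

Lemma band4_continuous (u : torus_distribution R) K N :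
  continuous (fun x => band u K N x ^+ 4).
Proof.
move=> x; apply: (cvg_comp (band u K N) (fun y : R => y ^+ 4)).
  exact: band_continuous.
exact: continuous_expr.
Qed.

Lemma quartic_EFin K N (u : torus_distribution R) :
  (quartic K N u)%:E = (\int[leb]_(x in `[0%R, 1%R]) (band u K N x ^+ 4)%:E)%E.
Proof.
rewrite /quartic /torus_integral /Rintegral fineK//; apply: integrable_fin_num => //.
by apply: torus_integrable; exact: band4_continuous.
Qed.

Lemma quartic_ge0 K N u : 0 <= quartic K N u.
Proof. by apply: Rintegral_ge0 => x _; rewrite exprn_even_ge0. Qed.

Lemma measurable_band4 K N : measurable_fun setT
  (fun z : borel H * measurableTypeR R => band (z.1 : H) K N (z.2 : R) ^+ 4).
Proof. by apply: measurable_funX; exact: measurable_band2. Qed.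

Lemma measurable_quartic K N :
  measurable_fun setT (fun u : borel H => quartic K N (u : H)).
Proof.
apply/measurable_EFinP; rewrite (_ : _ \o _ = fun u : borel H =>
  \int[leb]_(x in `[0%R, 1%R]) (band (u : H) K N x ^+ 4)%:E)%E; last first.
  by apply/funext => u /=; rewrite quartic_EFin.
apply: (measurable_torus_integral (measurable_band4 K N)) => z.
by rewrite exprn_even_ge0.
Qed.

Lemma quartic_mean K N :
  (\int[m]_u (quartic K N u)%:E = (variance K N ^+ 2 * kappa)%:E)%E.
Proof.
under eq_integral do rewrite quartic_EFin.
rewrite (torus_tonelli m (measurable_band4 K N)); last first.
  by move=> z; rewrite exprn_even_ge0.
under eq_integral do rewrite band_moment.
rewrite integral_cst//= lebesgue_measure_itv/= lte_fin ltr01 oppr0 adde0.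
by rewrite mule1.
Qed.

(** The square of the quartic integral is a double integral over the torus, so its
    mean is the double integral of the moments of pairs. *)
Lemma quartic_sqr_mean K N : 0 < variance K N ->
  (\int[m]_u (quartic K N u ^+ 2)%:E <=
   (kappa ^+ 2 * variance K N ^+ 4 + 26 * moment8 R * variance K N ^+ 3)%:E)%E.
Proof.
move=> V0; set V := variance K N.
have b0 (u : H) x : 0 <= band u K N x ^+ 4 by rewrite exprn_even_ge0.
have mq2 : measurable_fun setT
    (fun z : borel H * measurableTypeR R => band (z.1 : H) K N (z.2 : R) ^+ 4
      * quartic K N (z.1 : H)).
  apply: measurable_funM; first exact: measurable_band4.
  exact: (measurableT_comp (measurable_quartic K N) measurable_fst).
have E0 (u : H) (r : R) : 0 <= r -> (r * quartic K N u)%:E =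
    (\int[leb]_(x in `[0%R, 1%R]) (r * band u K N x ^+ 4)%:E)%E.
  move=> r0; under eq_integral do rewrite EFinM.
  rewrite ge0_integralZl_EFin//= -?quartic_EFin//.
  - by move=> x _; rewrite lee_fin.
  - apply/measurable_EFinP; apply: measurable_funTS.
    by apply: continuous_measurable_fun; exact: band4_continuous.
have E1 (u : H) : (quartic K N u ^+ 2)%:E =
    (\int[leb]_(x in `[0%R, 1%R]) (band u K N x ^+ 4 * quartic K N u)%:E)%E.
  under eq_integral do rewrite mulrC.
  by rewrite -E0 ?quartic_ge0// expr2.
under eq_integral do rewrite E1.
rewrite (torus_tonelli m mq2); last by move=> z; rewrite mulr_ge0 ?quartic_ge0.
apply: (@le_trans _ _ (\int[leb]_(x in `[0%R, 1%R])
   (kappa ^+ 2 * V ^+ 4 + 26 * moment8 R * V ^+ 3)%:E)%E); last first.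
  rewrite integral_cst//= lebesgue_measure_itv/= lte_fin ltr01 oppr0 adde0.
  by rewrite mule1.
have mb2 x : measurable_fun setT
    (fun z : borel H * measurableTypeR R => band (z.1 : H) K N x ^+ 4
      * band (z.1 : H) K N (z.2 : R) ^+ 4).
  apply: measurable_funM; last exact: measurable_band4.
  apply: measurable_funX.
  exact: (measurableT_comp (measurable_band K N x) measurable_fst).
have E2 x : (\int[m]_u (band u K N x ^+ 4 * quartic K N u)%:E =
    \int[leb]_(y in `[0%R, 1%R]) \int[m]_u (band u K N x ^+ 4 * band u K N y ^+ 4)%:E)%E.
  rewrite -(torus_tonelli m (mb2 x)); last by move=> z; rewrite mulr_ge0.
  by apply: eq_integral => u _; exact: E0.
have M0 : 0 <= moment8 R.
  by apply: le_trans (moment8_ge iid_g); exact: (moment_ge0 P g 4).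
apply: ge0_le_integral => //=.
- by move=> x _; apply: integral_ge0 => u _; rewrite lee_fin mulr_ge0 ?quartic_ge0.
- apply: measurable_funTS.
  apply: (measurable_fun_fubini_tonelli_G
   (fun z : borel H * measurableTypeR R => (band (z.1 : H) K N (z.2 : R) ^+ 4
      * quartic K N (z.1 : H))%:E)).
    exact/measurable_EFinP.
  by move=> z; rewrite lee_fin mulr_ge0 ?quartic_ge0.
move=> x _; rewrite E2.
apply: (@le_trans _ _ (\int[leb]_(y in `[0%R, 1%R])
  (kappa ^+ 2 * V ^+ 4 + 13 * moment8 R * V ^+ 2 * covariance K N x y ^+ 2)%:E)%E).
  apply: ge0_le_integral => //=.
  - by move=> y _; apply: integral_ge0 => u _; rewrite lee_fin mulr_ge0.
  - apply: measurable_funTS.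
    apply: (measurable_fun_fubini_tonelli_G
     (fun z : borel H * measurableTypeR R => (band (z.1 : H) K N x ^+ 4
      * band (z.1 : H) K N (z.2 : R) ^+ 4)%:E)).
      exact/measurable_EFinP.
    by move=> z; rewrite lee_fin mulr_ge0.
  - apply/measurable_EFinP; apply: measurable_funD => //.
    apply: measurable_funM => //; apply: measurable_funX.
    apply: measurable_funTS.
    by apply: continuous_measurable_fun; exact: covariance_continuous.
  - by move=> y _; exact: band_pair_moment.
pose q y := kappa ^+ 2 * V ^+ 4 + 13 * moment8 R * V ^+ 2 * covariance K N x y ^+ 2.
have ccov2 : continuous (fun y => covariance K N x y ^+ 2).
  move=> y; apply: (cvg_comp (covariance K N x) (fun y : R => y ^+ 2)).
    exact: covariance_continuous.
  exact: continuous_expr.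
have ccov : continuous (fun y => 13 * moment8 R * V ^+ 2 * covariance K N x y ^+ 2).
  by move=> y; apply: cvgM; [exact: cvg_cst|exact: ccov2].
have cq : continuous q by move=> y; apply: cvgD; [exact: cvg_cst|exact: ccov].
have -> : (\int[leb]_(y in `[0%R, 1%R]) (q y)%:E = (torus_integral q)%:E)%E.
  rewrite /torus_integral /Rintegral fineK//; apply: integrable_fin_num => //.
  exact: torus_integrable.
rewrite lee_fin /q torus_integralD//; last by move=> y; exact: cvg_cst.
rewrite torus_integral_cst torus_integralZ// lerD2l.
apply: (@le_trans _ _ (13 * moment8 R * V ^+ 2 * (2 * V))).
  apply: ler_wpM2l; last exact: covariance_mean_sqr.
  by apply: mulr_ge0; [exact: mulr_ge0 (ler0n _ 13) M0|exact: sqr_ge0].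
by rewrite le_eqVlt; apply/orP; left; apply/eqP; ring.
Qed.

(** The variance of the quartic integral is of lower order than the square of its
    mean, because the covariance of the field is square integrable uniformly. *)
Lemma quartic_deviation K N : 0 < variance K N ->
  (\int[m]_u ((quartic K N u - kappa * variance K N ^+ 2) ^+ 2)%:E <=
   (26 * moment8 R * variance K N ^+ 3)%:E)%E.
Proof.
move=> V0; set V := variance K N; set c := kappa * V ^+ 2.
have c0 : 0 <= c by rewrite mulr_ge0 ?sqr_ge0 ?(moment_ge0 P g 2).
have mq := measurable_quartic K N.
have mD : measurable_fun setT (fun u : borel H => (quartic K N (u : H) - c) ^+ 2).
  by apply: measurable_funX; exact: measurable_funB.
set I := (X in (X <= _)%E).
have EE : (I + (2 * c * c)%:E = \int[m]_u (quartic K N u ^+ 2)%:E + (c ^+ 2)%:E)%E.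
  have -> : ((2 * c * c)%:E = \int[m]_u (2 * c * quartic K N u)%:E)%E.
    under eq_integral do rewrite EFinM.
    rewrite ge0_integralZl_EFin//= ?quartic_mean.
    - by rewrite -EFinM /c mulrA mulrAC [kappa * _]mulrC -/V; congr (_%:E); ring.
    - by move=> u _; rewrite lee_fin quartic_ge0.
    - exact/measurable_EFinP.
    - by rewrite mulr_ge0.
  rewrite -[X in (_ = _ + X)%E](probability_integral_cst m).
  rewrite -!ge0_integralD//.
  - by apply: eq_integral => u _ /=; rewrite -!EFinD; congr (_%:E); ring.
  - by move=> u _; rewrite lee_fin sqr_ge0.
  - by apply/measurable_EFinP; apply: measurable_funX.
  - by move=> u _; rewrite lee_fin sqr_ge0.
  - by move=> u _; rewrite lee_fin sqr_ge0.
  - exact/measurable_EFinP.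
  - by move=> u _; rewrite lee_fin; apply: mulr_ge0; [exact: mulr_ge0|exact: quartic_ge0].
  - by apply/measurable_EFinP; apply: measurable_funM.
have bound : (I + (2 * c * c)%:E <= (kappa ^+ 2 * V ^+ 4 + 26 * moment8 R * V ^+ 3)%:E
    + (c ^+ 2)%:E)%E by rewrite EE leeD2r//; exact: quartic_sqr_mean.
have I0 : (0 <= I)%E by apply: integral_ge0 => u _; rewrite lee_fin sqr_ge0.
move: I0 bound; case: I {EE} => [i| |]// _; rewrite -!EFinD !lee_fin.
by rewrite /c => h; rewrite -(lerD2r (2 * (kappa * V ^+ 2) * (kappa * V ^+ 2)));
  apply: (le_trans h); rewrite le_eqVlt; apply/orP; left; apply/eqP; ring.
Qed.

End band_moments.

(** * Size of the Fourier coefficients as beta tends to zero *)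

Section variance_sums.
Context (R : realType) (beta : R).
Hypothesis beta0 : 0 < beta.

(** The reciprocal of the frequency beyond which the field is smoothed: the
    variances of the coordinates are 1 / (1 + w ^ 2 n ^ 2). *)
Definition frequency_scale : R := Num.sqrt (4 * pi ^+ 2 * beta).
Local Notation w := frequency_scale.

Lemma frequency_scale_sqr : w ^+ 2 = 4 * pi ^+ 2 * beta.
Proof. by rewrite sqr_sqrtr// !mulr_ge0 ?exprn_ge0 ?pi_ge0 ?ltW. Qed.

Lemma frequency_scale_gt0 : 0 < w.
Proof. by rewrite sqrtr_gt0 mulr_gt0// mulr_gt0// exprn_gt0// pi_gt0. Qed.

Lemma beta_le_scale : beta <= w ^+ 2.
Proof.
rewrite frequency_scale_sqr ler_peMl ?ltW//.
have := pi_ge2 R; set p : R := pi => p2; have := sqr_ge0 (p - 2); nra.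
Qed.

(** The series is compared with the telescoping sum of
    (2 / w) (1 / (1 + w n) - 1 / (1 + w (n + 1))). *)
Lemma sum_series_variance K N : (K <= N)%N ->
  \sum_(K <= n < N) series_variance beta n <= 2 / w / (1 + w * K%:R).
Proof.
move=> KN; have w0 := frequency_scale_gt0.
have den n : 0 < 1 + w * n%:R by rewrite ltr_pwDl// mulr_ge0// ltW.
pose q n := 2 / w / (1 + w * n%:R).
have q0 n : 0 <= q n by rewrite divr_ge0 ?divr_ge0 ?ltW.
suff: \sum_(K <= n < N) series_variance beta n <= q K - q N.
  by move/le_trans; apply; rewrite gerBl.
rewrite -opprB -(telescope_sumr q KN) -sumrN; apply: ler_sum => n _.
rewrite opprB /series_variance -frequency_scale_sqr -exprMn /q.
set t := w * n.+1%:R.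
have tE : w * n%:R = t - w by rewrite /t -natr1 mulrDr mulr1 addrK.
have t0 : 0 < t by rewrite mulr_gt0.
have dn := den n; have dn1 := den n.+1; rewrite tE -/t in dn dn1 *.
have -> : 2 / w / (1 + (t - w)) - 2 / w / (1 + t) = 2 / ((1 + (t - w)) * (1 + t)).
  by field; rewrite !gt_eqF.
have p0 : 0 < 1 + t ^+ 2 by rewrite ltr_pwDl// sqr_ge0.
rewrite ler_pdivlMr ?mulr_gt0// mulrC ler_pdivrMr//.
apply: (@le_trans _ _ ((1 + t) ^+ 2)); first by rewrite expr2 ler_wpM2r ?(ltW dn1)// lerD2l gerBl ltW.
rewrite -subr_ge0 (_ : _ - _ = (1 - t) ^+ 2) ?sqr_ge0//; ring.
Qed.

Local Notation V := (variance (series_variance beta)).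

Lemma variance_le N : V 0 N <= 8 / w.
Proof.
have := sum_series_variance (leq0n N); rewrite mulr0 addr0 divr1 => h.
by apply: (le_trans (ler_wpM2l _ h)) => //; rewrite mulrA -natrM.
Qed.

Lemma variance_tail K N : (0 < K)%N -> (K <= N)%N -> V K N <= 8 / w ^+ 2 / K%:R.
Proof.
move=> K0 KN; have w0 := frequency_scale_gt0; have k0 : 0 < K%:R :> R by rewrite ltr0n.
apply: (le_trans (ler_wpM2l _ (sum_series_variance KN))) => //.
rewrite (_ : 8 / w ^+ 2 / K%:R = 8 / w / (w * K%:R)); last by field; rewrite !gt_eqF.
have -> : 4 * (2 / w / (1 + w * K%:R)) = 8 / w / (1 + w * K%:R) by rewrite !mulrA -natrM.
rewrite ler_wpM2l ?divr_ge0 ?(ltW w0)// lef_pV2 ?posrE ?mulr_gt0//.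
  by rewrite lerDr.
by rewrite ltr_pwDl// mulr_ge0// ltW.
Qed.

Lemma variance_gt0 N : (0 < N)%N -> 0 < V 0 N.
Proof.
case: N => // N _; rewrite mulr_gt0// big_nat_recl//= ltr_pwDl//.
  exact: series_variance_gt0.
by apply: sumr_ge0 => n _; rewrite ltW// series_variance_gt0.
Qed.

Lemma series_variance_le1 n : series_variance beta n <= 1.
Proof.
by rewrite invf_le1 ?lerDl ?ltr_pwDl ?frequency_ge0.
Qed.

End variance_sums.

(** * The quartic integral as a limit of partial sums *)
Section smooth_product.
Context (R : realType).

(** Differentiability to the order n + 1, by recursion on the derivative instead of
    iteration from the outside, so that the product rule fits an induction on n. *)
Fixpoint times_derivable n (f : R -> R^o) : Prop :=
  (forall x, derivable f x 1) /\
  (if n is k.+1 then times_derivable k (derive1 f) else True).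

Lemma times_derivable_weaken n f : times_derivable n.+1 f -> times_derivable n f.
Proof. by elim: n f => [|n IH] f [df df']; split=> //; exact: IH. Qed.

Lemma times_derivableP (f : R -> R^o) :
  (forall k x, derivable (derive1n k f) x 1) <-> (forall n, times_derivable n f).
Proof.
split=> [sf n|tf k].
  have : forall k x, derivable (derive1n k f) x 1 by [].
  elim: n f {sf} => [|n IH] f sf; split=> //; first exact: (sf 0%N).
    exact: (sf 0%N).
  by apply: IH => k; move: (sf k.+1); rewrite /derive1n iterSr.
move: (tf k) => {tf}; elim: k f => [|k IH] f [df] // tf.
by rewrite /derive1n iterSr; exact: IH.
Qed.

Lemma times_derivableD n f g : times_derivable n f -> times_derivable n g ->
  times_derivable n (fun x => f x + g x).
Proof.
elim: n f g => [|n IH] f g [df tf] [dg tg]; split=> //; try by move=> x; exact: derivableD.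
rewrite (_ : derive1 _ = fun x => derive1 f x + derive1 g x); first exact: IH.
by apply/funext => x; rewrite !derive1E (deriveD (df x) (dg x)).
Qed.

Lemma times_derivableM n f g : times_derivable n f -> times_derivable n g ->
  times_derivable n (fun x => f x * g x).
Proof.
elim: n f g => [|n IH] f g tf tg.
  by case: tf => df _; case: tg => dg _; split=> // x; exact: derivableM.
have [df tf'] := tf; have [dg tg'] := tg.
split; first by move=> x; exact: derivableM.
rewrite (_ : derive1 _ = fun x => f x * derive1 g x + g x * derive1 f x).
  by apply: times_derivableD; apply: IH => //; exact: times_derivable_weaken.
by apply/funext => x; rewrite !derive1E (deriveM (df x) (dg x)).
Qed.

(** Cubes of trigonometric polynomials will serve as test functions. *)
Lemma smooth_periodicM (f g : R -> R^o) : f \in smooth_periodic ->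
  g \in smooth_periodic -> (fun x => f x * g x) \in smooth_periodic.
Proof.
move=> /asboolP[pf /times_derivableP sf] /asboolP[pg /times_derivableP sg].
apply/asboolP; split=> [x|]; first by rewrite /= pf pg.
by apply/times_derivableP => n; exact: times_derivableM.
Qed.

Lemma trig_poly_smooth_periodic N (t : 'I_N * bool -> R) :
  (trig_poly t : R -> R^o) \in smooth_periodic.
Proof.
pose f : testfun R := \sum_j t j *: mode R j.1 j.2.
rewrite (_ : trig_poly t = f); first exact: valP.
rewrite /f; apply/funext => x; rewrite /trig_poly.
by elim/big_rec2: _ => [//|j y h _ ->].
Qed.

End smooth_product.

Section quartic_inequalities.
Context (R : realType).
Implicit Types x y : R.

Lemma fourth_power_sum x y : (x + y) ^+ 4 <= 8 * (x ^+ 4 + y ^+ 4).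
Proof.
rewrite -subr_ge0.
have -> : 8 * (x ^+ 4 + y ^+ 4) - (x + y) ^+ 4 =
    ((x - y) ^+ 2) ^+ 2 + 6 * (x ^+ 2 - y ^+ 2) ^+ 2 by ring.
by apply: addr_ge0; [exact: sqr_ge0|apply: mulr_ge0 => //; exact: sqr_ge0].
Qed.

Lemma young_cubic x y : x * y ^+ 3 <= 4^-1 * x ^+ 4 + 3 / 4 * y ^+ 4.
Proof.
rewrite -subr_ge0.
have -> : 4^-1 * x ^+ 4 + 3 / 4 * y ^+ 4 - x * y ^+ 3 =
    4^-1 * ((x - y) ^+ 2 * ((x + y) ^+ 2 + 2 * y ^+ 2)) by field.
apply: mulr_ge0; first by rewrite invr_ge0.
apply: mulr_ge0; first exact: sqr_ge0.
by apply: addr_ge0; [exact: sqr_ge0|apply: mulr_ge0 => //; exact: sqr_ge0].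
Qed.

End quartic_inequalities.

Section quartic_limit.
Context (R : realType).
Local Notation leb := (@lebesgue_measure R).
Local Notation mR := (measurableTypeR R).
Local Notation I := (`[0, 1]%classic : set mR).

(** The fourth powers of the blocks between the frequencies 16 ^ k and
    16 ^ (k + 1), weighted so that their summability makes the partial sums
    converge geometrically. *)
Definition roughness (u : torus_distribution R) : \bar R :=
  (\sum_(k <oo) (16 ^+ k * quartic (16 ^ k) (16 ^ k.+1) u)%:E)%E.

Context (u : torus_distribution R).
Hypothesis u_sum : is_fourier_sum u.
Hypothesis rough_u : (roughness u < +oo)%E.

Let T k x : R := band u 0 (16 ^ k) x.
Let D k x : R := band u (16 ^ k) (16 ^ k.+1) x.
Let a (x : mR) : \bar R := (\sum_(k <oo) (16 ^+ k * D k x ^+ 4)%:E)%E.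
Let E : set mR := I `&` [set x | a x < +oo]%E.

Let D4_ge0 k x : 0 <= 16 ^+ k * D k x ^+ 4.
Proof. by apply: mulr_ge0; [exact: exprn_ge0|exact: exprn_even_ge0]. Qed.

Let a_ge0 x : (0 <= a x)%E.
Proof. by apply: nneseries_ge0 => k _ _; rewrite lee_fin. Qed.

Let cD4 k : continuous (fun x => 16 ^+ k * D k x ^+ 4).
Proof.
move=> x; apply: cvgM; first exact: cvg_cst.
exact: band4_continuous.
Qed.

Let mD4 k : measurable_fun setT (fun x : mR => (16 ^+ k * D k x ^+ 4)%:E).
Proof. by apply/measurable_EFinP; apply: continuous_measurable_fun; exact: cD4. Qed.

Let ma : measurable_fun setT a.
Proof. by apply: ge0_emeasurable_sum => // k x _ _; rewrite lee_fin. Qed.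

Let mI : measurable I. Proof. exact: measurable_itv. Qed.

Let mE : measurable E.
Proof.
apply: measurableI => //; rewrite -[X in measurable X]setTI.
exact: emeasurable_fun_infty_o.
Qed.

Let EI : E `<=` I. Proof. by move=> x []. Qed.

Let int_a : (\int[leb]_(x in I) a x < +oo)%E.
Proof.
rewrite /a integral_nneseries//; last 2 first.
- by move=> k; apply: measurable_funTS; exact: mD4.
- by move=> k x _; rewrite lee_fin.
apply: le_lt_trans rough_u; rewrite /roughness; apply: lee_nneseries => k _ //.
  by move=> _; apply: integral_ge0 => x _; rewrite lee_fin.
under eq_integral do rewrite EFinM.
rewrite ge0_integralZl_EFin//= ?exprn_ge0//.
- by rewrite -quartic_EFin.
- by move=> x _; rewrite lee_fin exprn_even_ge0.
- by apply/measurable_EFinP; apply: measurable_funTS;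
    apply: continuous_measurable_fun; exact: band4_continuous.
Qed.

Let integrable_a : leb.-integrable I a.
Proof.
apply/integrableP; split; first exact: measurable_funTS.
by under eq_integral do rewrite gee0_abs//.
Qed.

Let null_IE : leb (I `\` E) = 0.
Proof.
have [N [mN N0 sN]] := integrable_ae mI integrable_a.
apply: (@subset_measure0 _ _ _ leb _ N) => //; first exact: measurableD.
move=> x [Ix nE]; apply: sN => h; apply: nE; split=> //=.
by rewrite -ge0_fin_numE//; exact: h.
Qed.

(** The series a is finite almost everywhere on the torus, so integrals may be
    taken over the set E, where all pointwise statements hold. *)
Let restrict_E (f : R -> R) : leb.-integrable I (EFin \o f) ->
  \int[leb]_(x in I) f x = \int[leb]_(x in E) f x.
Proof.
move=> mf; rewrite /Rintegral.
rewrite (@negligible_integral _ _ _ leb I (I `\` E))//; last first.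
  exact: measurableD.
by rewrite setDD (setIidr EI).
Qed.

Let M x : R := `|T 0 x| + 2 * Num.sqrt (Num.sqrt (fine (a x))).
Let e x : R := 8 * T 0 x ^+ 4 + 128 * fine (a x).

Let M_ge0 x : 0 <= M x.
Proof. by rewrite addr_ge0// mulr_ge0// sqrtr_ge0. Qed.

Let M4_le x : M x ^+ 4 <= e x.
Proof.
rewrite /e; have fa : 0 <= fine (a x) by rewrite fine_ge0.
have -> : 128 * fine (a x) = 8 * (2 * Num.sqrt (Num.sqrt (fine (a x)))) ^+ 4.
  by rewrite exprMn (exprM (Num.sqrt _) 2 2) !sqr_sqrtr ?sqrtr_ge0//; ring.
have -> : T 0 x ^+ 4 = `|T 0 x| ^+ 4.
  by rewrite -normrX ger0_norm// exprn_even_ge0.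
by rewrite -mulrDr; exact: fourth_power_sum.
Qed.

Let b x : R := Num.sqrt (Num.sqrt (fine (a x))).

(** A fourth root of a x bounds all blocks, with a geometric factor: the weights
    16 ^ k are the fourth powers of 2 ^ k. *)
Let D_le k x : E x -> `|D k x| <= b x * (2^-1) ^+ k.
Proof.
move=> [_ /= ax]; have fa : 0 <= fine (a x) by rewrite fine_ge0.
have b0 : 0 <= b x by exact: sqrtr_ge0.
have b4 : b x ^+ 4 = fine (a x) by rewrite (exprM _ 2 2) !sqr_sqrtr ?sqrtr_ge0.
have : 16 ^+ k * D k x ^+ 4 <= b x ^+ 4.
  rewrite b4 -lee_fin fineK; last by rewrite ge0_fin_numE.
  have h0 n : (0 <= (16 ^+ n * D n x ^+ 4)%:E)%E by rewrite lee_fin.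
  apply: le_trans (nneseries_lim_ge k.+1 (fun n _ _ => h0 n)).
  by rewrite big_nat_recr//= leeDr// sume_ge0.
rewrite exprVn ler_pdivlMr ?exprn_gt0// => h.
rewrite -(ler_pXn2r (n := 4)) ?nnegrE ?mulr_ge0 ?exprn_ge0// exprMn.
rewrite -exprM mulnC exprM -[X in X * _]normrX ger0_norm ?exprn_even_ge0//.
by rewrite -natrX mulrC.
Qed.

Let T_succ k x : T k.+1 x = T k x + D k x.
Proof. by rewrite /T /D; apply: bandD => //; rewrite leq_exp2l. Qed.

Let T_le_M k x : E x -> `|T k x| <= M x.
Proof.
move=> Ex; have b0 : 0 <= b x by exact: sqrtr_ge0.
apply: (@le_trans _ _ (`|T 0 x| + b x * (2 - 2 * (2^-1) ^+ k))); last first.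
  rewrite lerD2l mulrC ler_wpM2r// gerBl mulr_ge0// exprn_ge0// invr_ge0//.
elim: k => [|k IH]; first by rewrite expr0 mulr1 subrr mulr0 addr0.
rewrite T_succ; apply: (le_trans (ler_normD _ _)).
apply: (le_trans (lerD IH (D_le k Ex))).
rewrite exprS le_eqVlt; apply/orP; left; apply/eqP.
by rewrite mulVKf//; ring.
Qed.

Let h x : R := if (a x < +oo)%E then limn (T ^~ x) else 0.

Let T_cvg x : E x -> T ^~ x @ \oo --> h x.
Proof.
move=> Ex; have [_ /= ax] := Ex; rewrite /h ax.
have TE : T ^~ x = (fun k => T 0 x + series (D ^~ x) k).
  apply/funext => k; elim: k => [|k IH]; first by rewrite /series /= big_geq// addr0.
  by rewrite T_succ IH /series /= big_nat_recr//= addrA.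
have cD : cvgn (series (D ^~ x)).
  apply: normed_cvg; apply: (@series_le_cvg _ _ (geometric (b x) 2^-1)) => //.
  - by move=> k /=; exact: normr_ge0.
  - by move=> k; rewrite /= mulr_ge0 ?sqrtr_ge0// exprn_ge0// invr_ge0.
  - by move=> k; exact: D_le.
  - by apply: is_cvg_geometric_series; rewrite gtr0_norm ?invr_gt0// invf_lt1// ltr1n.
by rewrite TE; apply: is_cvgD => //; exact: is_cvg_cst.
Qed.

Let h_le_M x : E x -> `|h x| <= M x.
Proof.
move=> Ex; have hx : `|T k x| @[k --> \oo] --> `|h x| by apply: cvg_norm; exact: T_cvg.
by apply: (ler_cvg_to hx (cvg_cst (M x))); apply: nearW => k; exact: T_le_M.
Qed.

Let e_ge0 x : 0 <= e x.
Proof. by rewrite (le_trans _ (M4_le x))// exprn_ge0. Qed.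

Let integrable_e : leb.-integrable E (EFin \o e).
Proof.
have i1 : leb.-integrable E (EFin \o (fun x => 8 * T 0 x ^+ 4)).
  apply: (integrableS mI mE EI).
  apply: torus_integrable => x; apply: cvgM; first exact: cvg_cst.
  exact: band4_continuous.
have i2 : leb.-integrable E (EFin \o (fine \o a)).
  apply: eq_integrable (integrableS mI mE EI integrable_a) => // x /set_mem[_ /= ax].
  by rewrite fineK// ge0_fin_numE.
exact: (integrableD mE i1 (integrableZl mE 128 i2)).
Qed.

Let mT k : measurable_fun E (T k).
Proof.
apply: measurable_funTS; apply: continuous_measurable_fun; exact: band_continuous.
Qed.

Let mh : measurable_fun E h.
Proof. exact: (measurable_fun_cvg mT T_cvg). Qed.

Let quartic_cvg : leb.-integrable E (EFin \o (fun x => h x ^+ 4)) /\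
  \int[leb]_(x in E) (T k x ^+ 4) @[k --> \oo] --> \int[leb]_(x in E) (h x ^+ 4).
Proof.
apply: (@dominated_cvg_Rintegral _ _ _ leb E _ _ e mE) => //.
- by move=> k; apply: measurable_funX; exact: mT.
- move=> x Ex; apply: (cvg_comp _ (fun y : R => y ^+ 4) (T_cvg Ex)).
  exact: continuous_expr.
- move=> k x Ex; apply: le_trans (M4_le x); rewrite normrX.
  by apply: lerXn2r; rewrite ?nnegrE//; exact: T_le_M.
Qed.

Let cubic_cvg :
  \int[leb]_(x in E) (h x * T k x ^+ 3) @[k --> \oo] --> \int[leb]_(x in E) (h x ^+ 4).
Proof.
apply: (proj2 (@dominated_cvg_Rintegral _ _ _ leb E _ _ e mE _ _ _ _)) => //.
- by move=> k; apply: measurable_funM => //; apply: measurable_funX; exact: mT.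
- move=> x Ex; rewrite exprS; apply: cvgM; first exact: cvg_cst.
  by apply: (cvg_comp _ (fun y : R => y ^+ 3) (T_cvg Ex)); exact: continuous_expr.
- move=> k x Ex; apply: le_trans (M4_le x); rewrite normrM normrX [M x ^+ 4]exprS.
  apply: ler_pM => //; first exact: h_le_M.
  by apply: lerXn2r; rewrite ?nnegrE//; exact: T_le_M.
Qed.

(** Continuous functions on the torus are bounded, and |T| <= 1 + T ^ 4, so the
    function e still dominates. *)
Let linear_cvg (f : R -> R) : continuous f ->
  leb.-integrable E (EFin \o (fun x => h x * f x)) /\
  \int[leb]_(x in E) (T k x * f x) @[k --> \oo] --> \int[leb]_(x in E) (h x * f x).
Proof.
move=> cf.
have [C fC] : exists C, forall x, I x -> `|f x| <= C.
  have [C [_ fC]] : bounded_set (f @` `[0, 1]%classic).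
    apply: compact_bounded; apply: continuous_compact; last exact: segment_compact.
    exact: continuous_subspaceT.
  exists (C + 1) => x Ix; apply: fC; first by rewrite ltrDl.
  by exists x.
have mf : measurable_fun E f.
  by apply: measurable_funTS; exact: continuous_measurable_fun.
apply: (@dominated_cvg_Rintegral _ _ _ leb E _ _ (fun x => C * (1 + e x)) mE).
- by move=> k; apply: measurable_funM => //; exact: mT.
- by move=> x Ex; apply: cvgM; [exact: T_cvg|exact: cvg_cst].
- have i1 : leb.-integrable E (EFin \o cst 1).
    apply: (integrableS mI mE EI); apply: torus_integrable; exact: cst_continuous.
  exact: (integrableZl mE C (integrableD mE i1 integrable_e)).
- move=> k x Ex; rewrite normrM mulrC ler_pM//; first by apply: fC; exact: EI.
  apply: (le_trans (T_le_M k Ex)); apply: (@le_trans _ _ (1 + M x ^+ 4)); last by rewrite lerD2l.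
  have [M1|M1] := leP (M x) 1; first by rewrite (le_trans M1)// lerDl exprn_ge0.
  apply: (@le_trans _ _ (M x ^+ 4)); last by rewrite lerDr.
  by apply: ler_eXnr => //; exact: ltW.
Qed.

Let integrable_vanish (F : R -> R) : (forall x, I x -> ~ E x -> F x = 0) ->
  leb.-integrable E (EFin \o F) -> leb.-integrable I (EFin \o F).
Proof.
move=> F0; rewrite integrable_mkcond// => iF; rewrite integrable_mkcond//.
rewrite (_ : _ \_ I = (EFin \o F) \_ E)//; apply/funext => x; rewrite !patchE.
case: ifPn => [/set_mem Ix|nIx]; case: ifPn => [/set_mem Ex|nEx] //.
  by rewrite /= F0// => Ex; move: nEx; rewrite (mem_set Ex).
by move: nIx; rewrite (mem_set (EI Ex)).
Qed.

Let h_vanish x : I x -> ~ E x -> h x = 0.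
Proof. by move=> Ix nE; rewrite /h; case: ifP => // ax; case: nE. Qed.

Let sixteen_pow_cvg : (16 ^ k)%N @[k --> \oo] --> \oo.
Proof.
move=> A [N _ NA]; exists N => // k /= Nk; apply: NA => /=.
by rewrite (leq_trans Nk)// ltnW// ltn_expl.
Qed.

Let represents_h : represents h u.
Proof.
have hf (f : R -> R) : continuous f ->
    leb.-integrable I (EFin \o (fun x => h x * f x)).
  move=> cf; apply: integrable_vanish; last exact: (linear_cvg cf).1.
  by move=> x Ix nE; rewrite h_vanish// mul0r.
split.
  have c1 : continuous (cst 1 : R -> R) by move=> x; exact: cvg_cst.
  have := hf _ c1.
  by congr (leb.-integrable _ _); apply/funext => x /=; rewrite mulr1.
move=> f; have cf := @testfun_continuous _ f.
have lim1 := cvg_comp _ _ sixteen_pow_cvg ((is_fourier_sumE u).1 u_sum f).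
apply: (cvg_unique (@Rhausdorff R) lim1); rewrite /torus_integral (restrict_E (hf f cf)).
rewrite (_ : _ \o _ = fun k => \int[leb]_(x in E) (T k x * f x)).
  exact: (linear_cvg cf).2.
apply/funext => k /=; rewrite restrict_E.
  by rewrite partial_sum_band.
apply: torus_integrable => x; apply: cvgM; last exact: cf.
exact: trig_poly_continuous.
Qed.

Let quarticE k : quartic 0 (16 ^ k) u = \int[leb]_(x in E) (T k x ^+ 4).
Proof.
by rewrite /quartic /torus_integral restrict_E//; apply: torus_integrable;
  exact: band4_continuous.
Qed.

Let integrable_h4 : leb.-integrable I (EFin \o (fun x => h x ^+ 4)).
Proof.
apply: integrable_vanish; last exact: quartic_cvg.1.
by move=> x Ix nE; rewrite h_vanish// expr0n.
Qed.

(** A function representing u is tested against the cubes of the partial sums;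
    by the inequality of Young no such function has a smaller fourth moment than
    the limit of the partial sums. *)
Let quartic_lower h' : represents h' u ->
  ((\int[leb]_(x in E) (h x ^+ 4))%R%:E <= \int[leb]_(x in I) (h' x ^+ 4)%:E)%E.
Proof.
move=> [ih' uh'].
have mh' : measurable_fun I h' by apply/measurable_EFinP; exact: measurable_int ih'.
have mh4 : measurable_fun I (fun x => h' x ^+ 4) by exact: measurable_funX.
have h4_ge0 x : (0 <= (h' x ^+ 4)%:E)%E by rewrite lee_fin exprn_even_ge0.
have [jo|j_fin] := eqVneq (\int[leb]_(x in I) (h' x ^+ 4)%:E)%E +oo%E.
  by rewrite jo leey.
have ih4 : leb.-integrable I (EFin \o (fun x => h' x ^+ 4)).
  apply/integrableP; split; first exact/measurable_EFinP.
  under eq_integral do rewrite gee0_abs ?h4_ge0//.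
  by rewrite ltey.
rewrite -[leRHS]fineK; last by rewrite ge0_fin_numE ?ltey ?integral_ge0.
rewrite lee_fin; set j := fine _; set l := \int[leb]_(x in E) _.
suff : l <= 4^-1 * j + 3 / 4 * l by lra.
have lim : 4^-1 * j + 3 / 4 * (\int[leb]_(x in E) (T k x ^+ 4)) @[k --> \oo] -->
    4^-1 * j + 3 / 4 * l.
  by apply: cvgD; [exact: cvg_cst|apply: cvgM; [exact: cvg_cst|exact: quartic_cvg.2]].
apply: (ler_cvg_to cubic_cvg lim); apply: nearW => k.
have sT : ((fun x => T k x * (T k x * T k x)) : R -> R^o) \in smooth_periodic.
  have sk : (T k : R -> R^o) \in smooth_periodic.
    by rewrite /T -partial_sum_band; exact: trig_poly_smooth_periodic.
  by apply: smooth_periodicM => //; exact: smooth_periodicM.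
pose f := Testfun sT.
have fE x : f x = T k x ^+ 3 by rewrite /= !exprS expr0 mulr1.
have cT4 : continuous (fun x => T k x ^+ 4) by exact: band4_continuous.
have i4 := torus_integrable cT4.
have iY : leb.-integrable I (EFin \o (fun x => 4^-1 * h' x ^+ 4 + 3 / 4 * T k x ^+ 4)).
  exact: (integrableD mI (integrableZl mI 4^-1 ih4) (integrableZl mI (3 / 4) i4)).
have ihT : leb.-integrable I (EFin \o (fun x => h' x * T k x ^+ 3)).
  apply: (le_integrable mI _ _ iY).
    apply/measurable_EFinP; apply: measurable_funM => //; apply: measurable_funX.
    by apply: measurable_funTS; apply: continuous_measurable_fun; exact: band_continuous.
  move=> x _ /=; rewrite lee_fin normrM normrX.
  apply: (le_trans (young_cubic _ _)); apply: le_trans (ler_norm _).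
  by rewrite -!normrX ![`|_ ^+ 4|]ger0_norm ?exprn_even_ge0.
have -> : \int[leb]_(x in E) (h x * T k x ^+ 3) = torus_integral (fun x => h' x * T k x ^+ 3).
  have := uh' f; rewrite (represents_h.2 f) => e1.
  transitivity (torus_integral (fun x => h x * f x)).
    rewrite /torus_integral restrict_E; first by apply: eq_Rintegral => x _; rewrite fE.
    apply: integrable_vanish; first by move=> x Ix nE; rewrite h_vanish// mul0r.
    exact: (linear_cvg (@testfun_continuous _ f)).1.
  by rewrite e1; apply: eq_Rintegral => x _; rewrite fE.
apply: (@le_trans _ _ (torus_integral (fun x => 4^-1 * h' x ^+ 4 + 3 / 4 * T k x ^+ 4))).
  by apply: le_Rintegral => // x _; exact: young_cubic.
rewrite /torus_integral (RintegralD mI (integrableZl mI 4^-1 ih4) (integrableZl mI (3 / 4) i4)).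
rewrite (RintegralZl _ mI ih4) (RintegralZl _ mI i4) lerD2l ler_wpM2l ?divr_ge0//.
by rewrite -quarticE.
Qed.

Lemma quartic_integral_cvg : exists2 q : R, quartic_integral u = q%:E &
  quartic 0 (16 ^ k) u @[k --> \oo] --> q.
Proof.
exists (\int[leb]_(x in E) (h x ^+ 4)).
  apply/eqP; rewrite eq_le; apply/andP; split.
    apply: ereal_inf_lbound; exists h; first exact: represents_h.
    by rewrite -(restrict_E integrable_h4) /Rintegral fineK//; exact: integrable_fin_num.
  by apply: le_ereal_inf_tmp => _ [h' rh' <-]; exact: quartic_lower.
by under eq_fun do rewrite quarticE; exact: quartic_cvg.2.
Qed.

End quartic_limit.

(** * The Gibbs measure is dominated by the Gaussian measure *)

Lemma eseries_le (R : realType) (e : nat -> \bar R) (C : \bar R) :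
  (forall n, 0 <= e n)%E -> (forall N, \sum_(0 <= n < N) e n <= C)%E ->
  (\sum_(n <oo) e n <= C)%E.
Proof.
move=> e0 eC; apply: lime_le; last exact: nearW.
by apply: is_cvg_nneseries => n _ _; exact: e0.
Qed.

Lemma limn_einf_le (R : realType) (e : nat -> \bar R) (C : \bar R) :
  (forall n, e n <= C)%E -> (limn_einf e <= C)%E.
Proof.
move=> eC; rewrite limn_einf_lim; apply: lime_le; first exact: is_cvg_einfs.
apply: nearW => n; apply: le_trans (eC n).
by apply: ereal_inf_lbound; exists n => /=.
Qed.

Section lower_integral.
Import HBNNSimple.

(** The integral of a nonnegative function is the supremum over the simple
    functions below it; hence it is monotone even if the functions are not
    measurable. *)
Lemma ge0_le_lower_integral (R : realType) d (T : measurableType d)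
    (m : {measure set T -> \bar R}) (D : set T) (f1 f2 : T -> \bar R) :
  (forall x, D x -> 0 <= f1 x)%E -> (forall x, D x -> f1 x <= f2 x)%E ->
  (\int[m]_(x in D) f1 x <= \int[m]_(x in D) f2 x)%E.
Proof.
move=> f10 f12.
have f20 x : D x -> (0 <= f2 x)%E.
  by move=> Dx; exact: le_trans (f10 x Dx) (f12 x Dx).
rewrite !ge0_integralE//; apply: ge_ereal_sup => _ [h /= hf <-].
apply: le_ereal_sup_tmp; exists (sintegral m h) => //; exists h => // x.
apply: (le_trans (hf x)); rewrite !patchE.
by case: ifPn => // /set_mem Dx; exact: f12.
Qed.

End lower_integral.

Section bad_set.
Context (R : realType) (s : R).
Local Notation H := (sobolev R s).
Context d (Omega : measurableType d) (P : probability Omega R).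
Context (g : nat -> Omega -> R[i]).
Hypothesis iid_g : iid_std_complex_gaussian P g.
Context (beta : R) (mu : probability (borel H) R).
Hypothesis beta0 : 0 < beta.
Hypothesis mu_law : gaussian_series_law P g beta mu.

Local Notation kappa := (moment P g 4).
Local Notation w := (frequency_scale beta).
Local Notation V := (variance (series_variance beta)).

Let coords_mu := series_coords iid_g beta0 mu_law.
Let v0 n := series_variance_gt0 n beta0.
Let v1 n := series_variance_le1 beta0 n.

Lemma measurable_roughness :
  measurable_fun setT (fun u : borel H => roughness (u : H)).
Proof.
apply: ge0_emeasurable_sum => // [k u _ _|k _].
  by rewrite lee_fin mulr_ge0 ?exprn_ge0 ?quartic_ge0.
apply/measurable_EFinP; apply: measurable_funM => //; exact: measurable_quartic.
Qed.

Lemma roughness_ge0 (u : torus_distribution R) : (0 <= roughness u)%E.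
Proof.
by apply: nneseries_ge0 => k _ _; rewrite lee_fin mulr_ge0 ?exprn_ge0 ?quartic_ge0.
Qed.

Lemma sum_sixteenth_powers (n : nat) : \sum_(0 <= k < n) (16^-1 : R) ^+ k <= 2.
Proof.
suff : \sum_(0 <= k < n) (16^-1 : R) ^+ k <= 2 - 2 * (16^-1) ^+ n.
  by move/le_trans; apply; rewrite gerBl mulr_ge0// exprn_ge0// invr_ge0.
elim: n => [|n IH]; first by rewrite big_geq// expr0; lra.
rewrite big_nat_recr//= exprS; have : 0 <= (16^-1 : R) ^+ n by rewrite exprn_ge0// invr_ge0.
by move: (_ ^+ n) IH => x; lra.
Qed.

(** The block from 16 ^ k to 16 ^ (k + 1) has variance O (16 ^ (- k)), hence a
    quartic integral of mean O (16 ^ (- 2 k)), against the weight 16 ^ k. *)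
Lemma roughness_mean : (\int[mu]_u roughness u < +oo)%E.
Proof.
have k0 : 0 <= kappa := moment_ge0 P g 2.
have q0 k (u : H) : 0 <= 16 ^+ k * quartic (16 ^ k) (16 ^ k.+1) u.
  by apply: mulr_ge0; [exact: exprn_ge0|exact: quartic_ge0].
rewrite /roughness integral_nneseries//; last 2 first.
- move=> k; apply/measurable_EFinP; apply: measurable_funM => //; exact: measurable_quartic.
- by move=> k u _; rewrite lee_fin.
set C := kappa * (8 / w ^+ 2) ^+ 2.
have C0 : 0 <= C by rewrite mulr_ge0// sqr_ge0.
apply: (@le_lt_trans _ _ (C * 2)%:E); last exact: ltry.
apply: eseries_le => [k|N]; first by apply: integral_ge0 => u _; rewrite lee_fin.
apply: (@le_trans _ _ (\sum_(0 <= k < N) (C * (16^-1) ^+ k)%:E)%E).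
  apply: lee_sum => k _; under eq_integral do rewrite EFinM.
  rewrite ge0_integralZl_EFin//= ?exprn_ge0//; last 2 first.
  - by move=> u _; rewrite lee_fin quartic_ge0.
  - apply/measurable_EFinP; exact: measurable_quartic.
  rewrite (quartic_mean iid_g coords_mu v0) -EFinM lee_fin.
  have p0 : (0 < 16 ^ k)%N by rewrite expn_gt0.
  have pk : (16 ^ k <= 16 ^ k.+1)%N by rewrite leq_exp2l.
  have := variance_tail beta0 p0 pk; rewrite natrX.
  have := variance_ge0 v0 (16 ^ k) (16 ^ k.+1).
  set v := V _ _; rewrite exprVn.
  have : 0 < (16 : R) ^+ k by rewrite exprn_gt0.
  move: ((16 : R) ^+ k) => x x0 vv0 vx.
  have v2 : v ^+ 2 <= (8 / w ^+ 2 / x) ^+ 2 by rewrite lerXn2r ?nnegrE// (le_trans vv0).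
  apply: (le_trans (ler_wpM2l (ltW x0) (ler_wpM2r k0 v2))).
  by rewrite le_eqVlt /C; apply/orP; left; apply/eqP; field;
    rewrite !gt_eqF// frequency_scale_gt0.
rewrite sumEFin lee_fin -mulr_sumr ler_wpM2l//; exact: sum_sixteenth_powers.
Qed.

Lemma measurable_rough :
  measurable ([set u | roughness (u : H) = +oo%E] : set (borel H)).
Proof.
have := measurable_roughness measurableT (emeasurable_set1 +oo%E).
by rewrite setTI.
Qed.

Lemma rough_null : mu [set u | roughness (u : H) = +oo%E] = 0%E.
Proof.
have ir : mu.-integrable setT (fun u : borel H => roughness (u : H)).
  apply/integrableP; split; first exact: measurable_roughness.
  by under eq_integral do rewrite gee0_abs ?roughness_ge0//; exact: roughness_mean.
have [N [mN N0 sN]] := integrable_ae measurableT ir.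
apply: (@subset_measure0 _ _ _ mu _ N) => //.
  exact: measurable_rough.
by move=> u /= ru; apply: sN => /= /(_ I); rewrite ru.
Qed.

Lemma variance_cvg : exists2 Vlim : R, V 0 (16 ^ k) @[k --> \oo] --> Vlim &
  0 <= Vlim <= 8 / w.
Proof.
have nd : nondecreasing_seq (fun k => V 0 (16 ^ k)).
  apply/nondecreasing_seqP => k; rewrite /variance ler_wpM2l//.
  have pk : (16 ^ k <= 16 ^ k.+1)%N by rewrite leq_exp2l.
  rewrite (big_cat_nat (leq0n _) pk) /= lerDl.
  by apply: sumr_ge0 => n _; exact: ltW.
have ub k : V 0 (16 ^ k) <= 8 / w by exact: variance_le.
have cV : cvgn (fun k => V 0 (16 ^ k)).
  apply: nondecreasing_is_cvgn => //; exists (8 / w) => _ [k _ <-]; exact: ub.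
exists (limn (fun k => V 0 (16 ^ k))) => //; apply/andP; split.
  by apply: limr_ge => //; apply: nearW => k; exact: variance_ge0.
by apply: limr_le => //; apply: nearW.
Qed.

(** Since V <= 8 / w and beta <= w ^ 2, the factor beta ^ 2 V ^ 3 is at most
    512 w. *)
Lemma deviation_bound k :
  (\int[mu]_u ((beta * (quartic 0 (16 ^ k) u - kappa * V 0 (16 ^ k) ^+ 2)) ^+ 2)%:E
   <= (26 * moment8 R * 512 * w)%:E)%E.
Proof.
have w0 := frequency_scale_gt0 beta0; have bw := beta_le_scale beta0.
have M0 : 0 <= moment8 R.
  by apply: le_trans (moment8_ge iid_g); exact: (moment_ge0 P g 4).
have Vp : 0 < V 0 (16 ^ k) by apply: variance_gt0 => //; rewrite expn_gt0.
under eq_integral do rewrite exprMn EFinM.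
rewrite ge0_integralZl_EFin//= ?sqr_ge0//; last 2 first.
- by move=> u _; rewrite lee_fin sqr_ge0.
- apply/measurable_EFinP; apply: measurable_funX; apply: measurable_funB => //.
  exact: measurable_quartic.
apply: (le_trans (lee_wpmul2l _ (quartic_deviation iid_g coords_mu v0 v1 Vp))).
  by rewrite lee_fin sqr_ge0.
rewrite -EFinM lee_fin.
have := variance_le beta0 (16 ^ k); move: (V _ _) Vp => v vp vw.
have A0 : 0 <= 26 * moment8 R by exact: mulr_ge0 (ler0n _ 26) M0.
rewrite mulrCA -(mulrA (26 * moment8 R)); apply: ler_wpM2l => //.
have h1 : beta ^+ 2 <= (w ^+ 2) ^+ 2 by rewrite lerXn2r// nnegrE ?sqr_ge0// ltW.
have h2 : v ^+ 3 <= (8 / w) ^+ 3.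
  by rewrite lerXn2r ?nnegrE ?divr_ge0// ltW.
have := ler_pM (sqr_ge0 beta) (exprn_ge0 3 (ltW vp)) h1 h2.
rewrite (_ : (w ^+ 2) ^+ 2 * (8 / w) ^+ 3 = 512 * w)//.
by field; rewrite gt_eqF.
Qed.

(** The squared deviations have a small mean at every level k; the lemma of Fatou
    passes this to their lower limit, which is the squared deviation of the
    quartic integral itself wherever the roughness is finite. *)
Lemma bad_set_exists (delta : R) : 0 < delta -> exists (B : set (borel H)) (theta : R),
  [/\ measurable B, (mu B <= (26 * moment8 R * 512 * w / delta ^+ 2)%:E)%E,
    0 <= theta <= 64 * kappa &
    forall u : H, ~ B u -> exists2 q : R, quartic_integral u = q%:E &
      `|beta * q - theta| < delta].
Proof.
move=> delta0; have w0 := frequency_scale_gt0 beta0; have bw := beta_le_scale beta0.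
have k0 : 0 <= kappa := moment_ge0 P g 2.
have [Vl Vcvg /andP[Vl0 Vlw]] := variance_cvg.
pose D k (u : borel H) := (beta * (quartic 0 (16 ^ k) (u : H) - kappa * V 0 (16 ^ k) ^+ 2)) ^+ 2.
have mD k : measurable_fun setT (D k).
  apply: measurable_funX; apply: measurable_funM => //; apply: measurable_funB => //.
  exact: measurable_quartic.
pose G (u : borel H) := limn_einf (fun k => (D k u)%:E).
have mG : measurable_fun setT G.
  rewrite (_ : G = (fun u => - limn_esup (fun k => (- D k u)%:E))%E)//.
  apply: measurableT_comp => //; apply: measurable_fun_limn_esup => k.
  by apply/measurable_EFinP; exact: measurableT_comp.
have G0 u : (0 <= G u)%E.
  rewrite /G limn_einf_lim; apply: lime_ge; first exact: is_cvg_einfs.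
  by apply: nearW => n; apply: le_ereal_inf_tmp => _ [k _ <-]; rewrite lee_fin sqr_ge0.
have int_G : (\int[mu]_u G u <= (26 * moment8 R * 512 * w)%:E)%E.
  apply: le_trans (fatou mu measurableT _ _) _.
  - by move=> k; exact/measurable_EFinP.
  - by move=> k u _; rewrite lee_fin sqr_ge0.
  - by apply: limn_einf_le => k; exact: deviation_bound.
pose B1 : set (borel H) := [set u | roughness (u : H) = +oo%E].
pose B2 : set (borel H) := [set u | (delta ^+ 2)%:E <= `|G u|]%E.
have mB1 : measurable B1 by exact: measurable_rough.
have mB2 : measurable B2.
  rewrite [X in measurable X](_ : _ = setT `&` B2); last by rewrite setTI.
  apply: emeasurable_fun_c_infty => //; exact: measurableT_comp.
have d2 : 0 < delta ^+ 2 by rewrite exprn_gt0.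
exists (B1 `|` B2), (beta * (kappa * Vl ^+ 2)); split.
- exact: measurableU.
- have hU : (mu (B1 `|` B2) <= mu B1 + mu B2)%E by exact: measureU2.
  apply: (le_trans hU); rewrite rough_null add0e.
  have := le_integral_abse mu measurableT mG d2; rewrite setTI.
  under eq_integral do rewrite gee0_abs//.
  move/le_trans => /(_ _ int_G).
  by rewrite muleC -lee_pdivlMr// -EFinM.
- rewrite !mulr_ge0 ?sqr_ge0 ?(ltW beta0)//=.
  have h : Vl ^+ 2 <= (8 / w) ^+ 2.
    by rewrite lerXn2r ?nnegrE ?divr_ge0// ltW.
  rewrite mulrCA mulrC ler_wpM2r//.
  apply: (le_trans (ler_pM (ltW beta0) (sqr_ge0 _) bw h)).
  by rewrite le_eqVlt; apply/orP; left; apply/eqP; field; rewrite gt_eqF.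
- move=> u nB.
  have ru : (roughness u < +oo)%E.
    by rewrite ltey; apply/eqP => ru; apply: nB; left.
  have [q qE qcvg] := quartic_integral_cvg (@sobolev_sum _ _ u) ru.
  exists q => //.
  have Dlim : (D k u)%:E @[k --> \oo] --> ((beta * q - beta * (kappa * Vl ^+ 2)) ^+ 2)%:E.
    apply: cvg_EFin; first exact: nearW.
    apply: (cvg_comp _ (fun y : R => y ^+ 2)); last exact: continuous_expr.
    rewrite -mulrBr; apply: cvgM; first exact: cvg_cst.
    apply: cvgB => //; apply: cvgM; first exact: cvg_cst.
    by apply: (cvg_comp _ (fun y : R => y ^+ 2) Vcvg); exact: continuous_expr.
  have GE : G u = ((beta * q - beta * (kappa * Vl ^+ 2)) ^+ 2)%:E.
    by rewrite /G (cvg_limn_einf_sup Dlim).1.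
  have : (G u < (delta ^+ 2)%:E)%E.
    rewrite ltNge; apply/negP => h; apply: nB; right; rewrite /B2 /=.
    by rewrite gee0_abs.
  rewrite GE lte_fin -real_normK ?num_real// ltr_pXn2r// ?nnegrE//; exact: ltW.
Qed.

End bad_set.

Section gibbs_bound.
Context (R : realType) (s : R).
Local Notation H := (sobolev R s).
Context (beta : R) (mu Q : probability (borel H) R).
Hypothesis beta0 : 0 < beta.
Hypothesis gibbs : quartic_gibbs beta mu Q.
Context (B : set (borel H)) (theta delta p : R).
Hypothesis mB : measurable B.
Hypothesis muB : mu B = p%:E.
Hypothesis p1 : p < 1.
Hypothesis near_theta : forall u : H, ~ B u -> exists2 q : R,
  quartic_integral u = q%:E & `|beta * q - theta| < delta.

Local Notation W := (fun u : borel H => quartic_weight beta (u : H)).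

Lemma quartic_integral_ge0 (u : torus_distribution R) : (0 <= quartic_integral u)%E.
Proof.
apply: le_ereal_inf_tmp => _ [h _ <-]; apply: integral_ge0 => x _.
by rewrite lee_fin exprn_even_ge0.
Qed.

Lemma quartic_weight_le1 (u : H) : (0 <= quartic_weight beta u <= 1)%E.
Proof.
rewrite /quartic_weight expeR_ge0 /= -expeR0 lee_expeR oppe_le0 mule_ge0//.
  by rewrite lee_fin ltW.
exact: quartic_integral_ge0.
Qed.

Lemma quartic_weight_off (u : H) : ~ B u ->
  ((expR (- theta - delta))%:E <= quartic_weight beta u <= (expR (delta - theta))%:E)%E.
Proof.
move=> /near_theta[q qE]; rewrite /quartic_weight qE -EFinM -EFinN /= !lee_fin !ler_expR.
by rewrite ltr_norml => /andP[h1 h2]; apply/andP; split; lra.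
Qed.

Lemma partition_function_ge :
  ((expR (- theta - delta) * (1 - p))%:E <= \int[mu]_u W u)%E.
Proof.
apply: (@le_trans _ _ (\int[mu]_u (expR (- theta - delta) * \1_(~` B) u)%:E)%E).
  under eq_integral do rewrite EFinM.
  rewrite ge0_integralZl_EFin ?expR_ge0//; last first.
    by apply/measurable_EFinP; apply: measurable_indic; exact: measurableC.
  rewrite integral_indic//; last exact: measurableC.
  have muC : mu (~` B) = (1 - p)%:E.
    by have := probability_setC mu mB; rewrite muB -EFinB.
  by rewrite setIT [X in (_ <= _ * X)%E]muC EFinM.
apply: ge0_le_lower_integral => u _; first by rewrite lee_fin mulr_ge0 ?expR_ge0.
rewrite indicE; have [Bu|nB] := pselect (B u).
  by rewrite memNset ?mulr0; [have /andP[] := quartic_weight_le1 u|exact].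
by rewrite mem_set// mulr1; have /andP[] := quartic_weight_off nB.
Qed.

Lemma partition_function_le1 : (\int[mu]_u W u <= 1)%E.
Proof.
rewrite -(probability_integral_cst mu 1); apply: ge0_le_lower_integral => u _.
  by have /andP[] := quartic_weight_le1 u.
by have /andP[] := quartic_weight_le1 u.
Qed.

Lemma partition_function_inv :
  0 <= (fine (\int[mu]_u W u))^-1 <= expR (theta + delta) / (1 - p).
Proof.
have q0 : 0 < 1 - p by rewrite subr_gt0.
have z0 := partition_function_ge; have z1 := partition_function_le1.
have zfin : (\int[mu]_u W u)%E \is a fin_num.
  rewrite ge0_fin_numE; first exact: le_lt_trans z1 (ltry _).
  by apply: integral_ge0 => u _; have /andP[] := quartic_weight_le1 u.
move: z0; rewrite -(fineK zfin) lee_fin /=; move: (fine _) => z zge.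
have e0 : 0 < expR (- theta - delta) * (1 - p) by rewrite mulr_gt0 ?expR_gt0.
have zp : 0 < z by exact: lt_le_trans e0 zge.
rewrite invr_ge0 ltW//= (_ : _ / _ = (expR (- theta - delta) * (1 - p))^-1).
  by rewrite lef_pV2 ?posrE.
by rewrite invfM -expRN; congr (expR _ * _); ring.
Qed.

(** Off the exceptional set the density is almost constant, and everywhere it is
    at most 1; no measurability of the density is involved. *)
Lemma gibbs_le A : measurable A ->
  (Q A <= (expR (2 * delta) / (1 - p))%:E * mu A +
          (expR (theta + delta) / (1 - p))%:E * mu (A `&` B))%E.
Proof.
move=> mA; have q0 : 0 < 1 - p by rewrite subr_gt0.
rewrite gibbs//; set z := fine _.
have /andP[z0 zle] : 0 <= z^-1 <= expR (theta + delta) / (1 - p).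
  exact: partition_function_inv.
have up : (\int[mu]_(u in A) W u <= (expR (delta - theta))%:E * mu A + mu (A `&` B))%E.
  apply: (@le_trans _ _ (\int[mu]_(u in A) (expR (delta - theta) + \1_B u)%:E)%E).
    apply: ge0_le_lower_integral => u _; first by have /andP[] := quartic_weight_le1 u.
    rewrite indicE; have [Bu|nB] := pselect (B u).
      rewrite mem_set//; apply: (@le_trans _ _ 1%E).
        by have /andP[] := quartic_weight_le1 u.
      by rewrite lee_fin lerDr expR_ge0.
    by rewrite memNset// addr0; have /andP[] := quartic_weight_off nB.
  under eq_integral do rewrite EFinD.
  rewrite ge0_integralD//; last first.
    by apply: measurable_funTS; apply/measurable_EFinP; exact: measurable_indic.
  by rewrite integral_cst// integral_indic// setIC.
apply: (le_trans (lee_wpmul2l _ up)); first by rewrite lee_fin.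
apply: (@le_trans _ _ ((expR (theta + delta) / (1 - p))%:E *
   ((expR (delta - theta))%:E * mu A + mu (A `&` B)))%E).
  by rewrite lee_wpmul2r ?lee_fin// adde_ge0// mule_ge0// lee_fin expR_ge0.
rewrite ge0_muleDr ?mule_ge0 ?lee_fin ?expR_ge0// muleA -EFinM mulrAC -expRD.
by rewrite (_ : theta + delta + (delta - theta) = 2 * delta)//; ring.
Qed.

(** A bound between measures passes to integrals; here the right-hand side of
    gibbs_le is itself a measure. *)
Lemma gibbs_integral_le (phi : H -> R) (M : R) :
  measurable_fun setT (phi : borel H -> R) -> (forall u, 0 <= phi u <= M) ->
  \int[Q]_u phi u <= expR (2 * delta) / (1 - p) * \int[mu]_u phi u
    + expR (theta + delta) / (1 - p) * (M * p).
Proof.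
move=> mphi phiM; have q0 : 0 < 1 - p by rewrite subr_gt0.
have phi0 u : 0 <= phi u by have /andP[] := phiM u.
have M0 : 0 <= M by have /andP[/le_trans h /h] := phiM point.
have phiM' u : `|phi u| <= M by rewrite ger0_norm//; have /andP[] := phiM u.
have ca : 0 <= expR (2 * delta) / (1 - p) by rewrite divr_ge0 ?expR_ge0 ?ltW.
have cb : 0 <= expR (theta + delta) / (1 - p) by rewrite divr_ge0 ?expR_ge0 ?ltW.
pose m1 := mscale (NngNum ca) mu; pose m2 := mscale (NngNum cb) (mrestr mu mB).
pose m := measure_add m1 m2.
have Qm A : measurable A -> (Q A <= m A)%E.
  move=> mA; rewrite /m /measure_add/= /msum !big_ord_recl big_ord0 adde0 /=.
  by rewrite /m1 /m2 /mscale /mrestr /=; exact: gibbs_le.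
rewrite -lee_fin -(bounded_integral_EFin Q mphi phiM').
have mE : measurable_fun setT (EFin \o (phi : borel H -> R)) by exact/measurable_EFinP.
have E0 u : (0 <= (phi u)%:E)%E by rewrite lee_fin.
apply: (le_trans (ge0_le_measure_integral Qm measurableT E0 mE)).
rewrite (ge0_integral_measure_add _ _ measurableT) ?EFinD//; apply: leeD.
  rewrite (ge0_integral_mscale _ measurableT)//= EFinM.
  by rewrite (bounded_integral_EFin mu mphi phiM').
rewrite (ge0_integral_mscale _ measurableT)//= [leRHS]EFinM lee_wpmul2l ?lee_fin//.
apply: (@le_trans _ _ (\int[mrestr mu mB]_u M%:E)%E).
  by apply: ge0_le_lower_integral => u _ //; rewrite lee_fin; have /andP[] := phiM u.
by rewrite integral_cst//= /mrestr setTI [X in (_ * X)%E]muB EFinM.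
Qed.

End gibbs_bound.

(** * Convergence of the Gaussian measures *)

Section weight_sum.
Context (R : realType) (s : R).
Hypothesis s_lt : s < - (1 / 2).

Lemma summability_exponent_gt0 : 0 < - 1 - 2 * s.
Proof. by move: s_lt; lra. Qed.
Let e : R := - 1 - 2 * s.
Let e0 : 0 < e := summability_exponent_gt0.

(** The comparison with a telescoping series uses only exp x >= 1 + x and
    ln (1 + x) <= x. *)
Lemma powR_telescope n :
  n.+2%:R `^ (2 * s) <= e^-1 * (n.+1%:R `^ (- e) - n.+2%:R `^ (- e)) :> R.
Proof.
have x0 : 0 < n.+1%:R :> R by rewrite ltr0n.
have y1 : 1 < n.+2%:R :> R by rewrite ltr1n.
have y0 : 0 < n.+2%:R :> R by rewrite ltr0n.
rewrite [leRHS]mulrC ler_pdivlMr//.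
rewrite /powR !gt_eqF//.
have -> : 2 * s * ln n.+2%:R = - e * ln n.+2%:R - ln n.+2%:R :> R by rewrite /e; ring.
rewrite expRD expRN lnK ?posrE//.
have -> : - e * ln n.+1%:R = - e * ln n.+2%:R + e * (ln n.+2%:R - ln n.+1%:R) :> R by ring.
rewrite expRD -{3}[expR (- e * _)]mulr1 -mulrBr -mulrA ler_wpM2l ?expR_ge0//.
apply: (@le_trans _ _ (e * (ln n.+2%:R - ln n.+1%:R))); last first.
  by have := expR_ge1Dx (e * (ln n.+2%:R - ln n.+1%:R) : R); lra.
rewrite mulrC ler_pM2l// -lerN2 opprB -ln_div ?posrE//.
have -> : n.+1%:R / n.+2%:R = 1 + - n.+2%:R^-1 :> R.
  have -> : n.+1%:R = n.+2%:R - 1 :> R by rewrite -[n.+2%:R]natr1 addrK.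
  by rewrite mulrBl divff ?gt_eqF// mul1r.
by apply: le_ln1Dx; rewrite ltrN2 invf_lt1.
Qed.

Lemma sum_weight_le N : \sum_(0 <= n < N) weight s n <= 2 * (1 + e^-1).
Proof.
have ei : 0 <= e^-1 by rewrite invr_ge0 ltW.
case: N => [|N]; first by rewrite big_geq// mulr_ge0// addr_ge0.
rewrite /weight -mulr_sumr ler_wpM2l// big_nat_recl// powR1 lerD2l.
apply: (le_trans (ler_sum _ (fun n _ => powR_telescope n))).
rewrite -mulr_sumr ler_piMr//.
under eq_bigr do rewrite -opprB.
rewrite sumrN (telescope_sumr (fun n => n.+1%:R `^ (- e)))// opprB powR1.
by rewrite gerBl powR_ge0.
Qed.

(** The summability of the weights, the one consequence of s < - 1 / 2. *)
Lemma weight_tail (eta : R) : 0 < eta -> exists N,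
  (\sum_(N <= n <oo) (weight s n)%:E <= eta%:E)%E.
Proof.
move=> eta0; have w0 n : (0 <= (weight s n)%:E)%E by rewrite lee_fin weight_ge0.
have fin : (\sum_(n <oo) (weight s n)%:E < +oo)%E.
  apply: (@le_lt_trans _ _ (2 * (1 + e^-1))%:E); last exact: ltry.
  by apply: eseries_le => // N; rewrite sumEFin lee_fin; exact: sum_weight_le.
have [N _ tN] : \forall N \near \oo, (\sum_(N <= n <oo) (weight s n)%:E < eta%:E)%E.
  have := @nneseries_tail_cvg R (fun n => (weight s n)%:E) xpredT fin (fun n _ => w0 n).
  move=> tail; apply: (tail [set y | (y < eta%:E)%E]).
  apply: open_nbhs_nbhs; split; first exact: open_ereal_lt_ereal.
  by rewrite /= lte_fin.
by exists N; apply: ltW; exact: (tN N (leqnn N)).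
Qed.

End weight_sum.

(** Since D <= eta + D ^ 2 / eta, a bound on the second moment of D is enough. *)
Lemma lipschitz_mean (R : realType) d (T : measurableType d) (m : probability T R)
    (F G D : T -> R) (L M eta : R) :
  measurable_fun setT F -> measurable_fun setT G ->
  (forall x, `|F x| <= M) -> (forall x, `|G x| <= M) ->
  measurable_fun setT (fun x => D x ^+ 2) -> 0 <= L -> 0 < eta ->
  (forall x, `|F x - G x| <= L * D x) ->
  (\int[m]_x (D x ^+ 2)%:E <= (eta ^+ 2)%:E)%E ->
  `|\int[m]_x F x - \int[m]_x G x| <= L * (2 * eta).
Proof.
move=> mF mG FM GM mD L0 eta0 FG DE.
have iF := bounded_integrable m mF FM; have iG := bounded_integrable m mG GM.
rewrite -(RintegralB measurableT iF iG).
have mFG : measurable_fun setT (fun x => F x - G x) by exact: measurable_funB.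
apply: (le_trans (le_normr_Rintegral measurableT (integrableB measurableT iF iG))).
have mA : measurable_fun setT (fun x => `|F x - G x|) by exact: measurableT_comp.
have AM x : `| `|F x - G x| | <= M + M.
  by rewrite normr_id (le_trans (ler_normB _ _))// lerD.
rewrite -lee_fin -(bounded_integral_EFin m mA AM).
have Le0 : 0 <= L / eta by rewrite divr_ge0// ltW.
apply: (@le_trans _ _ (\int[m]_x ((L * eta)%:E + (L / eta)%:E * (D x ^+ 2)%:E))%E).
  apply: ge0_le_integral => //.
  - exact/measurable_EFinP.
  - apply: emeasurable_funD => //; apply: measurable_funeM; exact/measurable_EFinP.
  - move=> x _; rewrite -EFinM -EFinD lee_fin; apply: (le_trans (FG x)).
    rewrite -mulrA -mulrDr ler_wpM2l//.
    rewrite -(ler_pM2l eta0) mulrDr mulrA mulfV ?gt_eqF// mul1r.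
    by have := sqr_ge0 (D x - eta); have := sqr_ge0 (D x); nra.
rewrite ge0_integralD//; last 3 first.
- by move=> x _; rewrite lee_fin mulr_ge0// ltW.
- by move=> x _; rewrite -EFinM lee_fin mulr_ge0// sqr_ge0.
- by apply: measurable_funeM; exact/measurable_EFinP.
rewrite probability_integral_cst ge0_integralZl_EFin//; last 2 first.
- by move=> x _; rewrite lee_fin sqr_ge0.
- exact/measurable_EFinP.
apply: (@le_trans _ _ ((L * eta)%:E + (L / eta)%:E * (eta ^+ 2)%:E)%E).
  by rewrite leeD2l// lee_wpmul2l.
rewrite -EFinM -EFinD lee_fin le_eqVlt; apply/orP; left; apply/eqP.
by field; rewrite gt_eqF.
Qed.

Lemma eseries_tail (R : realType) (e : nat -> \bar R) N : (forall n, 0 <= e n)%E ->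
  (\sum_(N <= n <oo) e n = \sum_(n <oo) (if (N <= n)%N then e n else 0))%E.
Proof.
move=> e0; rewrite [RHS](nneseries_split 0 N) => [|n _]; last by case: ifP.
rewrite add0n big1_seq ?add0e => [|n]; last first.
  by rewrite mem_index_iota => /andP[_ /andP[_ nN]]; rewrite leqNgt nN.
by congr (limn _); apply/funext => M; apply: eq_big_nat => n /andP[-> _].
Qed.

Section second_moments.
Context (R : realType) (s : R).
Local Notation H := (sobolev R s).
Context d (Omega : measurableType d) (P : probability Omega R).
Context (g : nat -> Omega -> R[i]).
Hypothesis iid_g : iid_std_complex_gaussian P g.
Context (m : probability (borel H) R) (v : nat -> R).
Hypothesis m_v : gaussian_coords m v.
Hypothesis v0 : forall n, 0 <= v n.
Hypothesis v1 : forall n, v n <= 1.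

Local Notation kappa := (moment P g 2).

Lemma coord_second_moment n b :
  (\int[m]_u (coord u n b ^+ 2)%:E = (v n * kappa)%:E)%E.
Proof.
have := @gaussian_moment R _ _ P g iid_g _ _ m (fun u : borel H => coord (u : H) n b)
  (v n) 1 (measurable_coord n b) (v0 n) isT.
rewrite expr1; apply => t c.
pose j0 : 'I_n.+1 * bool := (ord_max, b).
pose t' j := if j == j0 then t else 0.
have -> : \int[m]_u cos (t * coord u n b + c) = \int[m]_u cos (lin t' (coords u) + c).
  apply: eq_Rintegral => u _; rewrite /lin (bigD1 j0)//= big1 => [|j /negbTE jj].
    by rewrite /t' eqxx addr0.
  by rewrite /t' jj mul0r.
rewrite m_v (bigD1 j0)//= big1 => [|j /negbTE jj]; last by rewrite /t' jj expr0n mul0r.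
by rewrite /t' eqxx addr0.
Qed.

Lemma measurable_weighted n (a : R) : measurable_fun setT
  (fun u : borel H => a * \sum_b coord (u : H) n b ^+ 2).
Proof.
apply: measurable_funM => //; apply: measurable_sum => b.
by apply: measurable_funX; exact: measurable_coord.
Qed.

Lemma weighted_mean n (a : R) : 0 <= a ->
  (\int[m]_u (a * \sum_b coord u n b ^+ 2)%:E = (a * (2 * (v n * kappa)))%:E)%E.
Proof.
move=> a0; under eq_integral do rewrite EFinM.
have c0 b u : 0 <= coord u n b ^+ 2 :> R by exact: sqr_ge0.
have mc b : measurable_fun setT (fun u : borel H => (coord (u : H) n b ^+ 2)%:E).
  by apply/measurable_EFinP; apply: measurable_funX; exact: measurable_coord.
rewrite ge0_integralZl_EFin//; last 2 first.
- by move=> u _; rewrite lee_fin sumr_ge0.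
- apply/measurable_EFinP; have := measurable_weighted n 1.
  by under eq_fun do rewrite mul1r.
under eq_integral do rewrite big_bool EFinD.
rewrite ge0_integralD//; last 2 first.
- by move=> u _; rewrite lee_fin.
- by move=> u _; rewrite lee_fin.
by rewrite !coord_second_moment -EFinD -EFinM mulr_natl mulr2n.
Qed.

Lemma truncate_dist_series N (u : H) :
  ((sobolev_dist u (truncate N u) ^+ 2)%:E =
   \sum_(n <oo) ((if (N <= n)%N then weight s n else 0) * \sum_b coord u n b ^+ 2)%:E)%E.
Proof.
rewrite truncate_dist (eseries_tail N) => [|n]; last first.
  by rewrite lee_fin mulr_ge0 ?weight_ge0 ?sumr_ge0// => b _; exact: sqr_ge0.
by apply: eq_eseriesr => n _; case: ifP => // _; rewrite mul0r.
Qed.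

Let tail_weight_ge0 N n : 0 <= (if (N <= n)%N then weight s n else 0).
Proof. by case: ifP => // _; exact: weight_ge0. Qed.

Let tail_term_ge0 N n (u : H) :
  (0 <= ((if (N <= n)%N then weight s n else 0) * \sum_b coord u n b ^+ 2)%:E)%E.
Proof.
by rewrite lee_fin mulr_ge0// sumr_ge0// => b _; exact: sqr_ge0.
Qed.

Lemma measurable_truncate_dist N : measurable_fun setT
  (fun u : borel H => sobolev_dist (u : H) (truncate N u) ^+ 2).
Proof.
apply/measurable_EFinP; rewrite (_ : _ \o _ = fun u : borel H => \sum_(n <oo)
  ((if (N <= n)%N then weight s n else 0) * \sum_b coord (u : H) n b ^+ 2)%:E)%E; last first.
  by apply/funext => u /=; rewrite truncate_dist_series.
apply: ge0_emeasurable_sum => // n _; apply/measurable_EFinP.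
exact: measurable_weighted.
Qed.

(** Uniformly over Gaussian laws with variances at most 1, the error of
    truncation is small in mean square. *)
Lemma truncation_mean N :
  (\int[m]_u (sobolev_dist u (truncate N u) ^+ 2)%:E <=
   (2 * kappa)%:E * \sum_(N <= n <oo) (weight s n)%:E)%E.
Proof.
have k0 : 0 <= kappa := moment_ge0 P g 1.
under eq_integral do rewrite truncate_dist_series.
rewrite integral_nneseries//; last first.
  by move=> n; apply/measurable_EFinP; exact: measurable_weighted.
rewrite (eseries_tail N) => [|n]; last by rewrite lee_fin weight_ge0.
rewrite -nneseriesZl => [|n _]; last by case: ifP => // _; rewrite lee_fin weight_ge0.
apply: lee_nneseries => [n _ _|n _].
  by apply: integral_ge0 => u _.
rewrite weighted_mean//; case: ifP => _; last by rewrite mul0r mule0.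
rewrite -EFinM lee_fin mulrC ler_wpM2r ?weight_ge0// ler_wpM2l//.
by rewrite ler_piMl.
Qed.

End second_moments.

Lemma cvg_sumr (R : realType) (J : Type) (r : seq J) (f : nat -> J -> R) (l : J -> R) :
  (forall j, f ^~ j @ \oo --> l j) ->
  \sum_(j <- r) f k j @[k --> \oo] --> \sum_(j <- r) l j.
Proof.
move=> fl; elim: r => [|j r IH].
  by under eq_fun do rewrite big_nil; rewrite big_nil; exact: cvg_cst.
by under eq_fun do rewrite big_cons; rewrite big_cons; exact: cvgD.
Qed.

Section trigonometric_functional.
Context (R : realType) (s : R).
Local Notation H := (sobolev R s).
Context (phi : H -> R) (L M : R).
Hypothesis L0 : 0 <= L.
Hypothesis phi_lip : forall u v, `|phi u - phi v| <= L * sobolev_dist u v.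
Hypothesis phiM : forall u, `|phi u| <= M.
Context (N : nat).

Lemma eq_trig_sobolev (t t' : nat -> bool -> R) :
  (forall n b, (n < N)%N -> t n b = t' n b) -> trig_sobolev N t s = trig_sobolev N t' s.
Proof.
move=> tt'; apply: sobolev_dist_eq0; apply/eqP; rewrite -sqrf_eq0; apply/eqP.
rewrite trig_sobolev_dist big1// => n _; rewrite big1 ?mulr0// => b _.
by rewrite tt'// subrr mul0r expr0n.
Qed.

Definition extend_coords (x : 'I_N * bool -> R) n b : R :=
  if insub n is Some i then x (i, b) else 0.

Lemma extend_coordsE x (i : 'I_N) b : extend_coords x i b = x (i, b).
Proof. by rewrite /extend_coords valK. Qed.

(** phi at the truncation of u, as a function of finitely many coordinates, to
    which the uniqueness of laws applies. *)
Definition trig_functional (x : 'I_N * bool -> R) : R :=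
  phi (trig_sobolev N (fun n b => 2 * extend_coords x n b) s).

Lemma trig_functional_coords (u : H) : trig_functional (coords u) = phi (truncate N u).
Proof.
congr phi; apply: eq_trig_sobolev => n b nN.
by rewrite -[n]/(nat_of_ord (Ordinal nN)) extend_coordsE.
Qed.

Lemma trig_functional_dist x x' :
  sobolev_dist (trig_sobolev N (fun n b => 2 * extend_coords x n b) s)
    (trig_sobolev N (fun n b => 2 * extend_coords x' n b) s) ^+ 2 =
  \sum_(n < N) weight s n * \sum_b (x (n, b) - x' (n, b)) ^+ 2.
Proof.
rewrite trig_sobolev_dist; apply: eq_bigr => n _; congr (_ * _).
apply: eq_bigr => b _; rewrite !extend_coordsE -mulrBr mulrC mulKf//.
Qed.

Lemma trig_functional_le x x' : `|trig_functional x - trig_functional x'| <=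
  L * Num.sqrt (\sum_(n < N) weight s n * \sum_b (x (n, b) - x' (n, b)) ^+ 2).
Proof.
by rewrite -trig_functional_dist sqrtr_sqr (le_trans (phi_lip _ _))// ler_wpM2l// ler_norm.
Qed.

Lemma trig_functional_cvg (x_ : nat -> 'I_N * bool -> R) x :
  (forall j, x_ ^~ j @ \oo --> x j) ->
  trig_functional (x_ k) @[k --> \oo] --> trig_functional x.
Proof.
move=> xx; apply/subr_cvg0; apply/norm_cvg0P.
apply: (@squeeze_cvgr _ _ _ _ (cst 0) (fun k => L * Num.sqrt (\sum_(n < N)
   weight s n * \sum_b (x_ k (n, b) - x (n, b)) ^+ 2))).
- by apply: nearW => k; rewrite normr_ge0 trig_functional_le.
- exact: cvg_cst.
- rewrite -[X in _ --> X](mulr0 L); apply: cvgM; first exact: cvg_cst.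
  rewrite -[X in _ --> X]sqrtr0; apply: (cvg_comp _ Num.sqrt); last exact: sqrt_continuous.
  have sum0 : \sum_(n < N) weight s n * \sum_(b : bool) (0 : R) ^+ 2 = 0.
    by rewrite big1// => n _; rewrite big1 ?mulr0// => b _; rewrite expr0n.
  rewrite -[X in _ `=>` nbhs X]sum0.
  apply: cvg_sumr => n; apply: cvgM; first exact: cvg_cst.
  apply: cvg_sumr => b.
  apply: (cvg_comp _ (fun y : R => y ^+ 2)); last exact: continuous_expr.
  by apply/subr_cvg0; exact: xx.
Qed.

End trigonometric_functional.

Section gaussian_limit.
Context (R : realType) (s : R).
Local Notation H := (sobolev R s).
Hypothesis s_lt : s < - (1 / 2).
Context d (Omega : measurableType d) (P : probability Omega R).
Context (g : nat -> Omega -> R[i]).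
Hypothesis iid_g : iid_std_complex_gaussian P g.
Context (Q0 : probability (borel H) R).
Hypothesis Q0_white : white_noise Q0.
Context (phi : H -> R) (L M : R).
Hypothesis L0 : 0 <= L.
Hypothesis phi_lip : forall u v, `|phi u - phi v| <= L * sobolev_dist u v.
Hypothesis phiM : forall u, `|phi u| <= M.

Local Notation kappa := (moment P g 2).
Let k0 : 0 <= kappa := moment_ge0 P g 1.

Let mphi : measurable_fun setT (phi : borel H -> R).
Proof. by apply: continuous_borel; exact: lipschitz_continuous phi_lip. Qed.

Section resampling.
Context (m : probability (borel H) R) (v : nat -> R).
Hypothesis m_v : gaussian_coords m v.
Hypothesis v0 : forall n, 0 <= v n.
Hypothesis v1 : forall n, v n <= 1.
Context (N : nat) (eta : R).
Hypothesis eta0 : 0 < eta.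

Let Phi := @trig_functional R s phi N.
Let rescaled (u : H) (j : 'I_N * bool) : R := Num.sqrt (v j.1) * coords u j.

Let measurable_rescaled j : measurable_fun setT (fun u : borel H => rescaled (u : H) j).
Proof. by apply: measurable_funM => //; exact: measurable_coord. Qed.

(** White noise with its coordinates multiplied by the standard deviations of m
    has the law of m, as far as finitely many coordinates are concerned. *)
Lemma resampling : [/\
  measurable_fun setT (fun u : borel H => phi (truncate N (u : H))),
  measurable_fun setT (fun u : borel H => Phi (rescaled (u : H))) &
  \int[m]_u phi (truncate N u) = \int[Q0]_u Phi (rescaled u)].
Proof.
have mc (j : 'I_N * bool) : measurable_fun setT (fun u : borel H => coords (u : H) j).
  exact: measurable_coord.
have [|||a b c] := @law_uniqueness _ _ _ _ m (fun u : borel H => coords (u : H))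
  _ _ Q0 (fun u : borel H => rescaled (u : H)) mc measurable_rescaled Phi M.
- move=> t e; rewrite m_v.
  transitivity (\int[Q0]_u cos (lin (fun j => t j * Num.sqrt (v j.1)) (coords u) + e)).
    rewrite (white_noise_coords Q0_white); congr (expR (- (_ / 4)) * _).
    by apply: eq_bigr => j _; rewrite exprMn sqr_sqrtr// mulr1.
  by apply: eq_Rintegral => u _; rewrite /lin; congr (cos (_ + _));
    apply: eq_bigr => j _; rewrite mulrA.
- by move=> x; exact: phiM.
- by move=> x_ x; apply: trig_functional_cvg L0 phi_lip _ _ _.
have E : (fun u : borel H => phi (truncate N (u : H))) = Phi \o (fun u : borel H => coords (u : H)).
  by apply/funext => u; rewrite /= /Phi trig_functional_coords.
by rewrite E.
Qed.

Lemma truncation_close :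
  ((2 * kappa)%:E * \sum_(N <= n <oo) (weight s n)%:E <= (eta ^+ 2)%:E)%E ->
  `|\int[m]_u phi u - \int[m]_u phi (truncate N u)| <= L * (2 * eta).
Proof.
move=> tail; have [mt _ _] := resampling.
apply: (@lipschitz_mean _ _ _ m _ _ (fun u : borel H => sobolev_dist (u : H) (truncate N u))
  L M eta) => //.
- exact: measurable_truncate_dist.
- exact: le_trans (truncation_mean iid_g m_v v0 v1 N) tail.
Qed.

Lemma rescaling_close :
  2 * kappa * \sum_(n < N) weight s n * (Num.sqrt (v n) - 1) ^+ 2 <= eta ^+ 2 ->
  `|\int[Q0]_u Phi (rescaled u) - \int[Q0]_u Phi (coords u)| <= L * (2 * eta).
Proof.
move=> small; have [_ mr _] := resampling.
have mc : measurable_fun setT (fun u : borel H => Phi (coords (u : H))).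
  have [+ _ _] := resampling; rewrite (_ : (fun u : borel H => phi _) =
    fun u : borel H => Phi (coords (u : H)))//.
  by apply/funext => u; rewrite /Phi trig_functional_coords.
pose q (u : H) : R := \sum_(n < N)
  weight s n * (Num.sqrt (v n) - 1) ^+ 2 * \sum_b coord u n b ^+ 2.
have c0 n : 0 <= weight s n * (Num.sqrt (v n) - 1) ^+ 2.
  by rewrite mulr_ge0 ?weight_ge0 ?sqr_ge0.
have s0 (u : H) n : 0 <= \sum_b coord u n b ^+ 2 :> R.
  by apply: sumr_ge0 => b _; exact: sqr_ge0.
have q0 u : 0 <= q u by apply: sumr_ge0 => n _; rewrite mulr_ge0.
have mq : measurable_fun setT (fun u : borel H => q (u : H)).
  by apply: measurable_sum => n; exact: measurable_weighted.
have qE (u : H) : q u ^+ 1 = Num.sqrt (q u) ^+ 2 by rewrite sqr_sqrtr.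
apply: (@lipschitz_mean _ _ _ Q0 _ _ (fun u : borel H => Num.sqrt (q (u : H))) L M eta) => //.
- by move=> u; exact: phiM.
- by move=> u; exact: phiM.
- by under eq_fun do rewrite -qE.
- move=> u; apply: (le_trans (trig_functional_le L0 phi_lip _ _)).
  rewrite ler_wpM2l// le_eqVlt; apply/orP; left; apply/eqP; congr (Num.sqrt _).
  apply: eq_bigr => n _; rewrite -mulrA; congr (_ * _); rewrite mulr_sumr.
  by apply: eq_bigr => b _; rewrite /rescaled /coords /= -exprMn; congr (_ ^+ 2); ring.
- under eq_integral do rewrite -qE expr1 /q -sumEFin.
  rewrite ge0_integral_sum//; last 2 first.
  - by move=> n; apply/measurable_EFinP; exact: measurable_weighted.
  - by move=> n u _; rewrite lee_fin mulr_ge0.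
  have w1 n a : 0 <= a -> (\int[Q0]_u (a * \sum_b coord u n b ^+ 2)%:E =
      (a * (2 * (1 * kappa)))%:E)%E.
    by move=> a0; apply: (weighted_mean iid_g (white_noise_coords Q0_white)).
  under eq_bigr do rewrite w1//.
  rewrite sumEFin lee_fin -mulr_suml mul1r mulrC; exact: small.
Qed.

End resampling.

Lemma sqrt_variance_close (beta : R) n : 0 < beta ->
  (Num.sqrt (series_variance beta n) - 1) ^+ 2 <= frequency_scale beta ^+ 2 * n.+1%:R ^+ 2.
Proof.
move=> beta0; set v := series_variance beta n.
have vp : 0 < v := series_variance_gt0 n beta0.
have v1 : v <= 1 := series_variance_le1 beta0 n.
set r := Num.sqrt v; have r2 : r ^+ 2 = v by rewrite sqr_sqrtr// ltW.
have r0 : 0 <= r := sqrtr_ge0 v.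
have r1 : r <= 1 by rewrite -sqrtr1 ler_sqrt.
set t := _ ^+ 2 * _; have t0 : 0 <= t by rewrite mulr_ge0 ?sqr_ge0.
have vt : v * (1 + t) = 1.
  rewrite /t frequency_scale_sqr// /v /series_variance mulVf// gt_eqF//.
  by rewrite ltr_pwDl// frequency_ge0.
have h1 : 0 <= r * (1 - r) by rewrite mulr_ge0 ?subr_ge0.
have h2 : 0 <= (1 - v) * t by rewrite mulr_ge0 ?subr_ge0.
by clearbody r t v; nra.
Qed.

(** Truncation of both laws at a common frequency N, and comparison of the
    truncations through the rescaling of white noise; N is chosen before the bound
    on beta, which depends on it. *)
Lemma gaussian_close (eta : R) : 0 < eta -> exists2 w0 : R, 0 < w0 &
  forall (beta : R) (mu : probability (borel H) R), 0 < beta ->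
  gaussian_series_law P g beta mu -> frequency_scale beta <= w0 ->
  `|\int[mu]_u phi u - \int[Q0]_u phi u| <= L * (6 * eta).
Proof.
move=> eta0; have e2 : 0 < eta ^+ 2 by rewrite exprn_gt0.
have k1 : 0 < 2 * kappa + 1 by rewrite ltr_wpDl// mulr_ge0.
have [N tN] := weight_tail s_lt (divr_gt0 e2 k1).
have tail : ((2 * kappa)%:E * \sum_(N <= n <oo) (weight s n)%:E <= (eta ^+ 2)%:E)%E.
  apply: (le_trans (lee_wpmul2l _ tN)); first by rewrite lee_fin mulr_ge0.
  rewrite -EFinM lee_fin mulrA ler_pdivrMr// mulrC ler_wpM2l ?(ltW e2)//.
  by rewrite lerDl.
pose K := \sum_(n < N) weight s n * n.+1%:R ^+ 2.
have K0 : 0 <= K by apply: sumr_ge0 => n _; rewrite mulr_ge0 ?weight_ge0 ?sqr_ge0.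
have K1 : 0 < 2 * kappa * K + 1 by rewrite ltr_wpDl// !mulr_ge0.
exists (Num.sqrt (eta ^+ 2 / (2 * kappa * K + 1))); first by rewrite sqrtr_gt0 divr_gt0.
move=> beta mu beta0 mu_law wb.
have mu_v := series_coords iid_g beta0 mu_law.
have v0 n : 0 <= series_variance beta n by rewrite ltW// series_variance_gt0.
have v1 n : series_variance beta n <= 1 by exact: series_variance_le1.
have Q_v := white_noise_coords Q0_white.
have wb2 : frequency_scale beta ^+ 2 <= eta ^+ 2 / (2 * kappa * K + 1).
  rewrite -[leRHS]sqr_sqrtr ?divr_ge0 ?(ltW e2) ?(ltW K1)//.
  by rewrite lerXn2r ?nnegrE ?sqrtr_ge0.
have A := truncation_close mu_v v0 v1 eta0 tail.
have C := truncation_close Q_v (fun=> ler01) (fun=> lexx 1) eta0 tail.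
have [_ _ E] := resampling mu_v v0 N.
have B := @rescaling_close _ _ mu_v v0 N eta eta0.
rewrite -E in B.
have {}B : `|\int[mu]_u phi (truncate N u) - \int[Q0]_u phi (truncate N u)| <= L * (2 * eta).
  have -> : \int[Q0]_u phi (truncate N u) =
      \int[Q0]_u trig_functional phi (coords (N := N) u).
    by apply: eq_Rintegral => u _; rewrite trig_functional_coords.
  apply: B; apply: (@le_trans _ _ (2 * kappa * (frequency_scale beta ^+ 2 * K))).
    rewrite ler_wpM2l ?mulr_ge0// /K mulr_sumr; apply: ler_sum => n _.
    rewrite [leRHS]mulrCA ler_wpM2l ?weight_ge0//; exact: sqrt_variance_close.
  apply: (@le_trans _ _ (2 * kappa * (eta ^+ 2 / (2 * kappa * K + 1) * K))).
    by rewrite ler_wpM2l ?mulr_ge0// ler_wpM2r.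
  rewrite (_ : _ * _ = eta ^+ 2 * (2 * kappa * K) / (2 * kappa * K + 1)); last first.
    by field; rewrite gt_eqF.
  by rewrite ler_pdivrMr// ler_wpM2l ?(ltW e2)// lerDl.
move: A B C; move: (\int[mu]_u phi u) (\int[Q0]_u phi u) => x y.
move: (\int[mu]_u phi _) (\int[Q0]_u phi _) => x' y' A B C.
rewrite (_ : x - y = (x - x') + (x' - y') + (y' - y)); last by ring.
apply: (le_trans (ler_normD _ _)); rewrite (distrC y').
apply: (le_trans (lerD (ler_normD _ _) (lexx _))).
apply: (le_trans (lerD (lerD A B) C)).
by rewrite le_eqVlt; apply/orP; left; apply/eqP; ring.
Qed.

End gaussian_limit.

(** * Weak convergence *)

Section upper_envelope.
Context (R : realType) (s : R).
Local Notation H := (sobolev R s).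
Context (phi : H -> R) (M : R).
Hypothesis phi_cont : continuous phi.
Hypothesis phiM : forall u, 0 <= phi u <= M.

(** The Lipschitz regularization of phi from above. *)
Definition envelope (k : nat) (u : H) : R :=
  sup (range (fun v => phi v - k%:R * sobolev_dist u v)).

Let dist_ge0 (u v : H) : 0 <= sobolev_dist u v. Proof. exact: sqrtr_ge0. Qed.

Let range_ub k u : ubound (range (fun v => phi v - k%:R * sobolev_dist u v)) M.
Proof.
move=> _ [v _ <-]; have /andP[_ h] := phiM v; apply: le_trans h.
by rewrite gerBl mulr_ge0.
Qed.

Lemma term_le_envelope k u v : phi v - k%:R * sobolev_dist u v <= envelope k u.
Proof. by apply: ub_le_sup; [exists M; exact: range_ub|exists v]. Qed.

Lemma envelope_le (C : R) k u : (forall v, phi v - k%:R * sobolev_dist u v <= C) ->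
  envelope k u <= C.
Proof.
move=> h; apply: ge_sup; first by exists (phi u - k%:R * sobolev_dist u u); exists u.
by move=> _ [v _ <-].
Qed.

Lemma le_envelope k u : phi u <= envelope k u.
Proof. by have := term_le_envelope k u u; rewrite sobolev_distxx mulr0 subr0. Qed.

Lemma envelope_bound k u : 0 <= envelope k u <= M.
Proof.
have /andP[h _] := phiM u; rewrite (le_trans h (le_envelope k u))/=.
by apply: envelope_le => v; apply: range_ub; exists v.
Qed.

Lemma envelope_lipschitz k u v :
  `|envelope k u - envelope k v| <= k%:R * sobolev_dist u v.
Proof.
have half x y : envelope k x - envelope k y <= k%:R * sobolev_dist x y.
  rewrite lerBlDr; apply: envelope_le => z.
  apply: (@le_trans _ _ (k%:R * sobolev_dist x y + (phi z - k%:R * sobolev_dist y z))).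
    rewrite addrCA lerD2l -mulrBr -mulrN ler_wpM2l// lerNl opprB lerBlDl.
    by rewrite (sobolev_dist_sym x y) sobolev_dist_triangle.
  by rewrite lerD2l term_le_envelope.
rewrite ler_norml half andbT lerNl opprB sobolev_dist_sym; exact: half.
Qed.

(** Points far from u are discarded by the penalty k d (u, v), points near u by the
    continuity of phi. *)
Lemma envelope_cvg u : envelope k u @[k --> \oo] --> phi u.
Proof.
have M0 : 0 <= M by have /andP[/le_trans h /h] := phiM u.
apply/cvgrPdist_le => e e0.
have FF : Filter (nbhs u) := nbhs_filter u.
have cu : phi v @[v --> u] --> phi u by exact: phi_cont.
have /nbhs_ballP[r /= r0 near_u] : \forall v \near u, `|phi u - phi v| < e.
  by move/cvgrPdist_lt : cu; apply.
near=> k; rewrite distrC ger0_norm ?subr_ge0 ?le_envelope// lerBlDr.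
apply: envelope_le => v; have [uv|uv] := ltP (sobolev_dist u v) r.
  have : `|phi u - phi v| < e by apply: near_u; rewrite ballEmdist.
  rewrite distrC => /ltW; rewrite ler_norml => /andP[_ h].
  by rewrite (@le_trans _ _ (phi v)) ?gerBl ?mulr_ge0// -lerBlDr.
have /andP[pu _] := phiM u; have /andP[_ pv] := phiM v.
apply: (@le_trans _ _ 0); last by rewrite addr_ge0// ltW.
rewrite subr_le0 (le_trans pv)// (@le_trans _ _ (k%:R * r)) ?ler_wpM2l//.
rewrite -ler_pdivrMr//; near: k; exact: nbhs_infty_ger.
Unshelve. all: by end_near. Qed.

End upper_envelope.

Section gibbs_limit.
Context (R : realType) (s : R).
Local Notation H := (sobolev R s).
Hypothesis s_lt : s < - (1 / 2).
Context d (Omega : measurableType d) (P : probability Omega R).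
Context (g : nat -> Omega -> R[i]).
Hypothesis iid_g : iid_std_complex_gaussian P g.
Context (Q0 : probability (borel H) R).
Hypothesis Q0_white : white_noise Q0.

Local Notation kappa := (moment P g 4).

(** One inequality suffices: it will be applied to phi + M and to M - phi. *)
Lemma gibbs_limsup (phi : H -> R) (M e : R) : continuous phi ->
  (forall u, 0 <= phi u <= M) -> 0 < e -> exists2 w1 : R, 0 < w1 &
  forall (beta : R) (mu Q : probability (borel H) R), 0 < beta ->
  gaussian_series_law P g beta mu -> quartic_gibbs beta mu Q ->
  frequency_scale beta <= w1 -> \int[Q]_u phi u <= \int[Q0]_u phi u + e.
Proof.
move=> cphi phiM e0.
have M0 : 0 <= M by have /andP[/le_trans h /h] := phiM point.
have absM (f : H -> R) : (forall u, 0 <= f u <= M) -> forall u, `|f u| <= M.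
  by move=> fM u; have /andP[f0 f1] := fM u; rewrite ger0_norm.
have envM k := envelope_bound phiM k.
have envL k := envelope_lipschitz phiM k.
have menv k : measurable_fun setT (envelope phi k : borel H -> R).
  by apply: continuous_borel; exact: lipschitz_continuous (envL k).
have mphi : measurable_fun setT (phi : borel H -> R) by exact: continuous_borel.
have [k envE] : exists k, \int[Q0]_u envelope phi k u <= \int[Q0]_u phi u + e / 4.
  have lim : \int[Q0]_u envelope phi k u @[k --> \oo] --> \int[Q0]_u phi u.
    apply: (bounded_cvg_Rintegral (M := M)); [exact: menv| |exact: envelope_cvg].
    by move=> k; exact: absM.
  have [N _ hN] : \forall k \near \oo,
      \int[Q0]_u envelope phi k u < \int[Q0]_u phi u + e / 4.
    by apply: (cvgr_lt _ lim); rewrite ltrDl divr_gt0.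
  by exists N; apply: ltW; exact: (hN N (leqnn N)).
pose eta := e / (24 * (k%:R + 1)).
have k1 : 0 < k%:R + 1 :> R by rewrite ltr_wpDl.
have eta0 : 0 < eta by rewrite divr_gt0// mulr_gt0.
have [w0 w0p close] := gaussian_close s_lt iid_g Q0_white (ler0n _ k) (envL k)
  (absM _ (envM k)) eta0.
have keta : k%:R * (6 * eta) <= e / 4.
  rewrite (_ : k%:R * (6 * eta) = (e / 4) * (k%:R / (k%:R + 1))).
    by rewrite ler_piMr ?divr_ge0 ?(ltW e0)// ler_pdivrMr// mul1r lerDl.
  by rewrite /eta; field; rewrite gt_eqF.
have E0 : 0 <= \int[Q0]_u phi u.
  by apply: Rintegral_ge0 => u _; have /andP[] := phiM u.
pose A := \int[Q0]_u phi u + e / 2.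
have A0 : 0 < A by rewrite ltr_wpDl// divr_gt0.
have eA : 0 < e / (4 * A) by rewrite divr_gt0// mulr_gt0.
pose delta := ln (1 + e / (4 * A)) / 2.
have delta0 : 0 < delta by rewrite divr_gt0// ln_gt0// ltrDl.
have expd : expR (2 * delta) * A = A + e / 4.
  rewrite /delta (mulrC 2) divfK// lnK ?posrE ?addr_gt0//.
  by field; rewrite gt_eqF.
pose G := expR (64 * kappa + delta) * M + A + e / 2.
have G0 : e / 2 <= G by rewrite lerDr addr_ge0 ?(ltW A0)// mulr_ge0// expR_ge0.
have Gp : 0 < G by apply: lt_le_trans G0; rewrite divr_gt0.
have mom0 : 0 <= moment8 R.
  by apply: le_trans (moment8_ge iid_g); exact: (moment_ge0 P g 4).
have [C CE] : exists C : R, C = 26 * moment8 R * 512 by eexists.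
have C0 : 0 <= C.
  by rewrite CE mulr_ge0 ?ler0n//; exact: mulr_ge0 (ler0n _ 26) mom0.
have C1 : 0 < C + 1 by rewrite ltr_wpDl.
have d2 : 0 < delta ^+ 2 by rewrite exprn_gt0.
pose w2 := e * delta ^+ 2 / (4 * G * (C + 1)).
have G4 : 0 < 4 * G by rewrite mulr_gt0.
have w2p : 0 < w2 := divr_gt0 (mulr_gt0 e0 d2) (mulr_gt0 G4 C1).
exists (Num.min w0 w2); first by rewrite lt_min w0p.
move=> beta mu Q beta0 mu_law gibbs; rewrite le_min => /andP[ww0 ww2].
have Y : \int[mu]_u envelope phi k u <= A.
  have := close beta mu beta0 mu_law ww0; rewrite ler_norml => /andP[_ h].
  rewrite /A; move: h envE keta; move: (\int[mu]_u _) (\int[Q0]_u envelope _ _ _).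
  by move=> x y h1 h2 h3; lra.
have [B [theta [mB muB /andP[th0 th1] off]]] := bad_set_exists iid_g beta0 mu_law delta0.
have pfin : mu B \is a fin_num by apply: fin_num_measure.
pose p := fine (mu B); have muBp : mu B = p%:E by rewrite fineK.
have p0 : 0 <= p by rewrite fine_ge0.
have pG : p * G <= e / 4.
  have pw : p <= C * w2 / delta ^+ 2.
    rewrite -lee_fin -muBp; apply: (le_trans muB); rewrite -CE lee_fin.
    by rewrite ler_wpM2r ?invr_ge0 ?(ltW d2)// ler_wpM2l.
  apply: (le_trans (ler_wpM2r (ltW Gp) pw)).
  rewrite (_ : C * w2 / delta ^+ 2 * G = (e / 4) * (C / (C + 1))).
    by rewrite ler_piMr ?divr_ge0 ?(ltW e0)// ler_pdivrMr// mul1r lerDl.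
  by rewrite /w2; field; rewrite !gt_eqF.
have p1 : p < 1.
  rewrite -(ltr_pM2r Gp) mul1r; apply: (le_lt_trans pG); apply: lt_le_trans G0.
  by lra.
have phi_le : \int[Q]_u phi u <= \int[Q]_u envelope phi k u.
  apply: le_Rintegral => //.
  - exact: bounded_integrable mphi (absM _ phiM).
  - exact: bounded_integrable (menv k) (absM _ (envM k)).
  - by move=> u _; exact: le_envelope.
apply: (le_trans phi_le).
apply: (le_trans (gibbs_integral_le beta0 gibbs mB muBp p1 off (menv k) (envM k))).
have q0 : 0 < 1 - p by rewrite subr_gt0.
rewrite mulrAC [X in _ + X]mulrAC -mulrDl ler_pdivrMr//.
have h1 : expR (2 * delta) * \int[mu]_u envelope phi k u <= A + e / 4.
  by rewrite -expd ler_wpM2l ?expR_ge0.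
have h2 : expR (theta + delta) * (M * p) <= expR (64 * kappa + delta) * M * p.
  by rewrite mulrA ler_wpM2r// ler_wpM2r// ler_expR lerD2r.
apply: (le_trans (lerD h1 h2)).
rewrite (_ : \int[Q0]_u phi u + e = A + e / 2); last by rewrite /A; field.
move: pG; rewrite /G; move: (expR _ * M) => X pG.
rewrite -subr_ge0 (_ : _ - _ = e / 4 - p * (X + A + e / 2)) ?subr_ge0//.
by field.
Qed.

End gibbs_limit.

Theorem theorem1p3 (R : realType) (s : R)
    (d : measure_display) (Omega : measurableType d) (P : probability Omega R)
    (g : nat -> Omega -> complex R)
    (mu Q : R -> probability (borel (sobolev R s)) R)
    (Q0 : probability (borel (sobolev R s)) R) :
  s < - (1 / 2) ->
  iid_std_complex_gaussian P g ->
  (forall beta : R, 0 < beta -> gaussian_series_law P g beta (mu beta)) ->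
  (forall beta : R, 0 < beta -> quartic_gibbs beta (mu beta) (Q beta)) ->
  white_noise Q0 ->
  weak_cvg 0^'+ Q Q0.
Proof.
move=> s_lt iid_g mu_law Q_gibbs Q0_white psi cpsi [M psiM].
have M0 : 0 <= M by exact: le_trans (normr_ge0 _) (psiM point).
have bounds u : - M <= psi u <= M by rewrite -ler_norml.
have mpsi : measurable_fun setT (psi : borel (sobolev R s) -> R) by exact: continuous_borel.
have shift (m : probability (borel (sobolev R s)) R) :
    \int[m]_u (M + psi u) = M + \int[m]_u psi u /\
    \int[m]_u (M - psi u) = M - \int[m]_u psi u.
  have i1 := finite_measure_integrable_cst m M measurableT.
  have i2 := bounded_integrable m mpsi psiM.
  have cM : \int[m]_u cst M u = M.
    by rewrite /Rintegral probability_integral_cst.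
  split.
    by rewrite (RintegralD measurableT i1 i2) cM.
  by rewrite (RintegralB measurableT i1 i2) cM.
have cplus : continuous (fun u => M + psi u).
  move=> u; have FF : Filter (nbhs u) := nbhs_filter u.
  by apply: cvgD; [exact: cvg_cst|exact: cpsi].
have cminus : continuous (fun u => M - psi u).
  move=> u; have FF : Filter (nbhs u) := nbhs_filter u.
  by apply: cvgB; [exact: cvg_cst|exact: cpsi].
apply/cvgrPdist_le => e e0.
have plusM u : 0 <= M + psi u <= M + M by have := bounds u; lra.
have minusM u : 0 <= M - psi u <= M + M by have := bounds u; lra.
have [w1 w1p up] := gibbs_limsup s_lt iid_g Q0_white cplus plusM e0.
have [w2 w2p down] := gibbs_limsup s_lt iid_g Q0_white cminus minusM e0.
pose w := Num.min w1 w2; have wp : 0 < w by rewrite lt_min w1p.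
have pi2 : 0 < 4 * pi ^+ 2 :> R by rewrite mulr_gt0// exprn_gt0// pi_gt0.
near=> beta.
have beta0 : 0 < beta by near: beta; exact: nbhs_right_gt.
have scale : frequency_scale beta <= w.
  have bw : beta <= w ^+ 2 / (4 * pi ^+ 2).
    by near: beta; apply: nbhs_right_ltW; rewrite divr_gt0// exprn_gt0.
  rewrite -[leRHS]ger0_norm ?(ltW wp)// -sqrtr_sqr ler_sqrt ?sqr_ge0//.
  by rewrite mulrC -ler_pdivlMr.
move: scale; rewrite le_min => /andP[sc1 sc2].
have := up _ _ _ beta0 (mu_law _ beta0) (Q_gibbs _ beta0) sc1.
have := down _ _ _ beta0 (mu_law _ beta0) (Q_gibbs _ beta0) sc2.
rewrite !(shift _).1 !(shift _).2 ler_norml.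
move: (\int[Q beta]_u _) (\int[Q0]_u _) => x y h1 h2.
by apply/andP; split; lra.
Unshelve. all: by end_near. Qed.
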